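(* Let $G$ be a simple plane graph that contains no subgraph isomorphic to either of the following two graphs: (a) the graph on vertices $o,a,b,c,d$ with edges $oa,ob,ab,oc,od,cd$ (two triangles $oab$ and $ocd$ sharing exactly one vertex); (b) the graph on vertices $o,a,b,c,d,e$ with edges $oa,ab,bc,co,cd,do,de,eo$ (two triangles $ocd$ and $ode$ sharing the edge $od$, together with the $4$-cycle $oabc$ sharing the edge $oc$ with the triangle $ocd$). Let $\mathscr{M}$ be a $4$-matching assignment for $G$. If $S$ is the vertex set of a cycle of $G$ of length at most $6$, then every $\mathscr{M}$-coloring $\phi$ of $G[S]$ can be extended to an $\mathscr{M}$-coloring $\varphi$ of $G$.
   Context: A $4$-matching assignment for a graph $G$ is given by the list assignment $L(v)=[4]=\{1,2,3,4\}$ for every vertex $v$, together with, for each edge $uv\in E(G)$, a matching $\mathscr{M}_{uv}$ (not necessarily perfect, possibly empty) between $L_u=\{u\}\times L(u)$ and $L_v=\{v\}\times L(v)$; $\mathscr{M}=\bigcup_{uv\in E(G)}\mathscr{M}_{uv}$. The cover $H$ is the graph with vertex set $\bigsqcup_v L_v$ and edge set $\mathscr{M}$. An $\mathscr{M}$-coloring of $G$ is an independent set $\mathcal I$ in $H$ with $|\mathcal I\cap L_v|=1$ for every $v\in V(G)$; an $\mathscr{M}$-coloring of an induced subgraph $G[S]$ is defined in the same way using the vertices $v\in S$ and the matchings on edges of $G[S]$. An $\mathscr{M}$-coloring $\varphi$ of $G$ extends $\phi$ if $\varphi\cap L_v=\phi\cap L_v$ for all $v\in S$. ''Subgraph isomorphic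 to'' means a (not necessarily induced) subgraph. *)

(* Defs.v *)
From mathcomp Require Import all_boot fingroup perm.
Set Implicit Arguments. Unset Strict Implicit. Unset Printing Implicit Defensive.

Section Defs.
Variable T : finType.

Definition simple_graph (e : rel T) : Prop := symmetric e /\ irreflexive e.

Local Notation dart e := (sig (fun p : T * T => e p.1 p.2)).

Definition rotation_system (e : rel T) (sigma : {perm dart e}) : Prop :=
  (forall d, (val (sigma d)).1 = (val d).1) /\
  (forall d d', (val d).1 = (val d').1 -> fconnect sigma d d').

Definition face_step (e : rel T) (sigma : {perm dart e})
  : rel (dart e) :=
  fun d d' => [exists d'' : dart e,
                 (val d'' == ((val d).2, (val d).1)) && (sigma d'' == d')].

Definition num_faces (e : rel T) (sigma : {perm dart e}) : nat :=
  n_comp (face_step sigma) predT.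

Definition isolated (e : rel T) (x : T) : bool := [forall y, ~~ e x y].

(* Combinatorial planarity: some rotation system has genus 0 on every
   component, i.e. Euler's formula  V - E + F + I = 2C  holds, where F counts
   face orbits, I isolated vertices, C connected components, E = #darts/2. *)
Definition planar (e : rel T) : Prop :=
  exists sigma : {perm dart e},
    rotation_system sigma /\
    2 * (#|T| + num_faces sigma + #|[pred x | isolated e x]|)
      = #|[pred p : T * T | e p.1 p.2]| + 4 * n_comp e predT.

Definition contains_bowtie (e : rel T) : Prop :=
  exists o a b c d : T, uniq [:: o; a; b; c; d] /\
    [&& e o a, e o b, e a b, e o c, e o d & e c d].

Definition contains_graph_b (e : rel T) : Prop :=
  exists o a b c d f : T, uniq [:: o; a; b; c; d; f] /\
    ([/\ e o a, e a b, e b c & e c o] /\ [/\ e c d, e d o, e d f & e f o]).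

(* A 4-matching assignment: M u v i j  means (u,i) ~ (v,j) in the cover H. *)
Definition matching_assignment (e : rel T) (M : T -> T -> 'I_4 -> 'I_4 -> bool) : Prop :=
  [/\ (forall u v i j, M u v i j = M v u j i),
      (forall u v i j, M u v i j -> e u v) &
      (forall u v i j j', M u v i j -> M u v i j' -> j = j')].

(* An M-coloring of G[S], given as the choice c v in L(v) for v in S
   (values outside S are irrelevant). *)
Definition M_coloring_on (e : rel T) (M : T -> T -> 'I_4 -> 'I_4 -> bool)
  (S : {set T}) (c : T -> 'I_4) : Prop :=
  forall u v, u \in S -> v \in S -> e u v -> ~~ M u v (c u) (c v).

Definition short_cycle_vertex_set (e : rel T) (S : {set T}) : Prop :=
  exists p : seq T, [/\ uniq p, 3 <= size p <= 6, path.cycle e p &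
                        S = [set x | x \in p]].

End Defs.

(* Main.v *)
(* Take a counterexample with as few non-isolated vertices off S as possible and
   delete the chords of S, so that S bounds a face of the plane graph. Every vertex
   off S then has degree at least 4, and no cycle of length at most 6 other than S
   has vertices on both sides. A triangle off S that shares no edge with another
   triangle and has three vertices of degree 4 is reducible: delete it and join a
   neighbour of one corner to the outer neighbours of another corner; no new
   triangle appears, hence neither forbidden graph. So each such triangle has a
   corner of degree at least 5, and no two of them share a corner. A triangle off S
   that shares an edge with another triangle has faces of length at least 5 on its
   other two sides, because the graphs (a) and (b) are excluded, and a face gives to at
   most half of its sides. With charges deg(v) - 4 and |f| - 4, Euler's formula then
   bounds the darts between S and the rest so tightly that, S having at most 6
   vertices, two triangles on edges of S form a bowtie.

   Planarity is handled through a pair of permutations whose orbits are the vertices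
   and the edges, the faces being the orbits of their product. The genus of the pair
   does not increase when a transposition cuts a cycle of either, which covers
   deletion and contraction of edges and the Jordan curve theorem. *)

(* The bound six on the length of the cycle serves three ends. A 4-cycle through a new edge of the
   reduction turns into a 6-cycle of [e] when the new edge is replaced by the path over two deleted
   corners, so statements about cycles of length at most six control graph (b). The reduction needs
   an outer neighbour of the triangle off S, since a new edge inside S could conflict with [phi];
   the six outer neighbours can all lie on S only if they exhaust it. Finally, the discharging gives
   2n + 8 <= 2|S| for the number n of darts from S to the rest that lie on faces other than
   triangles, and this meets a lower bound of 2 for n. Precoloured short cycles make the induction
   work: a short cycle with vertices on both sides is coloured together with one side, and then
   becomes the precoloured cycle of the other. Colours at different vertices cannot be compared
   under a matching assignment, so the reduction sends the constraint along compositions of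
   matchings. *)
Require Import Defs.
From mathcomp Require Import all_boot fingroup perm.
From mathcomp Require Import zify.
Set Implicit Arguments. Unset Strict Implicit. Unset Printing Implicit Defensive.

(** * Hypermaps of genus 0 *)

Section Components.
Variables (D : finType) (r r' : rel D) (x y : D).
Hypotheses (sr : connect_sym r) (sr' : connect_sym r').
Hypothesis r_r' : forall u v, r u v ->
  [|| connect r' u v, connect r' u x && connect r' v y
    | connect r' u y && connect r' v x].

Let merged u v := [|| connect r' u v, connect r' u x && connect r' v y
    | connect r' u y && connect r' v x].

Lemma connect_merged u v : connect r u v -> merged u v.
Proof.
have mergedE w z : merged w z = [|| root r' w == root r' z,
    (root r' w == root r' x) && (root r' z == root r' y)
  | (root r' w == root r' y) && (root r' z == root r' x)].
  by rewrite /merged !(root_connect sr').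
case/connectP => p; elim: p u => [|w p IHp] u /=.
  by move=> _ ->; rewrite /merged connect0.
case/andP=> /r_r'; rewrite -/(merged u w) => uw /IHp{}IHp /IHp.
move: uw; rewrite !mergedE.
by case/or3P=> [/eqP->|/andP[/eqP-> /eqP->]|/andP[/eqP-> /eqP->]];
  case/or3P=> [/eqP->|/andP[/eqP E /eqP->]|/andP[/eqP E /eqP->]];
  rewrite ?E ?eqxx ?orbT // -?E ?eqxx ?orbT.
Qed.

(** Only the [r']-components of [x] and [y] can be glued together in [r], so [root r] is injective
    on the roots of [r'] once that of [y] is left out. *)
Lemma n_comp_le_merge : n_comp r' D <= (n_comp r D).+1.
Proof.
rewrite /n_comp_mem (cardD1 (root r' y)).
apply: leq_trans (leq_add (leq_b1 _) (leqnn _)) _; rewrite add1n ltnS.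
have inj_root : {in [predD1 predI (roots r') D & root r' y] &,
    injective (root r)}.
  move=> u v; rewrite !inE !andbT => /andP[uy /eqP ru] /andP[vy /eqP rv] /rootP.
  move/(_ sr)/connect_merged; case/or3P.
  - by move/(rootP sr'); rewrite ru rv.
  - by case/andP=> _ /(rootP sr'); rewrite rv => vE; rewrite vE eqxx in vy.
  - by case/andP=> /(rootP sr'); rewrite ru => uE; rewrite uE eqxx in uy.
rewrite -(card_in_imset inj_root); apply: subset_leq_card.
by apply/subsetP=> _ /imsetP[u _ ->]; rewrite !inE roots_root.
Qed.

Lemma n_comp_le_connected : connect r' x y -> n_comp r' D <= n_comp r D.
Proof.
move=> xy; have rr' u v : connect r u v -> connect r' u v.
  case/connect_merged/or3P => // /andP[ux vy].
    by apply: connect_trans ux _; apply: connect_trans xy _; rewrite sr'.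
  apply: connect_trans ux _; rewrite sr'; apply: connect_trans vy _.
  exact: xy.
rewrite /n_comp_mem.
have inj_root : {in predI (roots r') D &, injective (root r)}.
  move=> u v; rewrite !inE !andbT => /eqP ru /eqP rv /rootP.
  by move/(_ sr)/rr'/(rootP sr'); rewrite ru rv.
rewrite -(card_in_imset inj_root); apply: subset_leq_card.
by apply/subsetP=> _ /imsetP[u _ ->]; rewrite !inE roots_root.
Qed.

End Components.

Section Hypermap.
Variable D : finType.
Implicit Types (a b : {perm D}) (x y : D).

Definition link a b : rel D := relU (frel a) (frel b).
Definition comps a b := n_comp (link a b) D.
Definition orbs a := #|porbits a|.
(** The cycles of [a], of [b] and of their product are the vertices, edges and faces of a hypermap;
    [#|D| + 2 * comps a b - orbs3 a b] is twice its total genus. *)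
Definition orbs3 a b := orbs a + orbs b + orbs (b * a)%g.

Lemma link_sym a b : connect_sym (link a b).
Proof. by apply: relU_sym; apply: fconnect_sym; apply: perm_inj. Qed.

Lemma link1 a b x : connect (link a b) x (a x).
Proof. by apply/connect1/orP; left; apply/eqP. Qed.

Lemma link2 a b x : connect (link a b) x (b x).
Proof. by apply/connect1/orP; right; apply/eqP. Qed.

Lemma porbit_fconnect a x y : (y \in porbit a x) = fconnect a x y.
Proof.
apply/porbitP/idP => [[i ->]|/iter_findex <-]; first by rewrite permX fconnect_iter.
by exists (findex a x y); rewrite permX.
Qed.

Lemma link_orbit1 a b x y : y \in porbit a x -> connect (link a b) x y.
Proof.
rewrite porbit_fconnect; apply: connect_sub => u v /= /eqP<-; exact: link1.
Qed.

Lemma orbs_tperm a x y : x != y -> let t := tperm x y in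
  orbs (t * a)%g + (x \notin porbit a y).*2 = (orbs a).+1.
Proof. by move=> xy; rewrite /= porbits_mul_tperm xy addn1. Qed.

Lemma mem_porbit_tperm a x y : x != y -> x \notin porbit a y ->
  x \in porbit (tperm x y * a)%g y.
Proof.
move=> xy nxy; apply/negPn/negP => nxy'.
move: (orbs_tperm a xy) (orbs_tperm (tperm x y * a)%g xy).
rewrite /= mulgA tperm2 mul1g nxy nxy' /=; lia.
Qed.

Lemma orbs_conj a b : orbs (a * b)%g = orbs (b * a)%g.
Proof.
have orb z : porbit (b * a)%g (a z) = a @: porbit (a * b)%g z.
  apply/setP => w; apply/idP/imsetP.
    case/porbitP => i ->; exists (((a * b) ^+ i)%g z); first exact: mem_porbit.
    elim: i => [|i IHi]; first by rewrite !perm1.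
    by rewrite !expgSr !permM IHi.
  case=> u /porbitP[i ->] ->; apply/porbitP; exists i.
  elim: i => [|i IHi]; first by rewrite !perm1.
  by rewrite !expgSr !permM IHi.
rewrite /orbs /porbits -(card_imset _ (imset_inj (@perm_inj _ a))).
apply: eq_card => A; apply/imsetP/imsetP => [[B /imsetP[z _ ->] ->]|[z _ ->]].
  by exists (a z); rewrite ?orb.
exists (porbit (a * b)%g ((a^-1)%g z)); first exact: imset_f.
by rewrite -orb permKV.
Qed.

(** The step of [a] from [x] is the step of [a'] from [y], and conversely; this is the hypothesis
    [r_r'] on components. *)
Lemma link_split a b x y u v (a' := (tperm x y * a)%g) : link a b u v ->
  [|| connect (link a' b) u v, connect (link a' b) u x && connect (link a' b) v y
    | connect (link a' b) u y && connect (link a' b) v x].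
Proof.
case/orP=> /= /eqP<-; last by rewrite link2.
have axy z : a' z = a (tperm x y z) by rewrite permM.
case: (tpermP x y u) (axy u) => [->|->|_ _] E.
- apply/or3P/Or32; rewrite connect0 link_sym -(tpermR x y) -axy; exact: link1.
- apply/or3P/Or33; rewrite connect0 link_sym -{1}(tpermL x y) -axy; exact: link1.
- by rewrite -E link1.
Qed.

(** The cut adds a cycle to [a]. If [x] and [y] share a cycle of the product, that one splits too,
    which pays for one new component. Otherwise two cycles of the product merge and the counts
    balance; the merged cycle joins [x] to [y], so no component is created. *)
Lemma split_genus a b x y (a' := (tperm x y * a)%g) :
  x != y -> y \in porbit a x ->
  orbs3 a b + 2 * comps a' b <= orbs3 a' b + 2 * comps a b.
Proof.
move=> xy; rewrite porbit_sym => xya.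
have oa := orbs_tperm a xy; rewrite /= xya /= addn0 -/a' in oa.
have oc : orbs (b * a')%g = orbs (tperm x y * (a * b))%g.
  by rewrite orbs_conj /a' mulgA.
have oab : orbs (b * a)%g = orbs (a * b)%g by rewrite orbs_conj.
have o3 := orbs_tperm (a * b)%g xy; rewrite /= in o3.
have C1 := n_comp_le_merge (link_sym a b) (link_sym a' b) (@link_split a b x y).
case: (boolP (x \in porbit (a * b)%g y)) o3 => [xy3 | nxy3] /= o3.
  rewrite /orbs3 /comps; lia.
have xy' : connect (link a' b) x y.
  move: (mem_porbit_tperm xy nxy3); rewrite mulgA -/a' porbit_sym.
  rewrite porbit_fconnect; apply: connect_sub => u v /= /eqP<-.
  by rewrite permM; apply: connect_trans (link1 a' b u) (link2 a' b _).
have C2 := n_comp_le_connected (link_sym a b) (link_sym a' b) (@link_split a b x y) xy'.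
by rewrite /orbs3 /comps; lia.
Qed.

Lemma orbs_le a : orbs a <= #|D|.
Proof. exact: leq_imset_card. Qed.

Lemma orbs1 : orbs 1 = #|D|.
Proof.
apply: card_imset => x y /eqP; rewrite eq_porbit_mem => /porbitP[i].
by rewrite expg1n perm1.
Qed.

Lemma comps11 : comps 1 1 = #|D|.
Proof.
rewrite -(fcard_id D); apply: (@eq_n_comp D _ (frel id)).
by apply: eq_connect => x y; rewrite /link /= !perm1 orbb.
Qed.

Lemma orbs3_sym a b : orbs3 a b = orbs3 b a.
Proof. by rewrite /orbs3 orbs_conj (addnC (orbs a)). Qed.

Lemma comps_sym a b : comps a b = comps b a.
Proof.
by apply: (@eq_n_comp D); apply: eq_connect => x y; rewrite /link /= orbC.
Qed.

(** Cutting a cycle of [a] or [b] never raises the genus, and repeated cuts end at two identities,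
    where all orbit counts are [#|D|] and equality holds. *)
Lemma genus_ge0 a b : orbs3 a b <= #|D| + 2 * comps a b.
Proof.
have [n] := ubnP ((#|D| - orbs a) + (#|D| - orbs b)).
elim: n => // n IHn in a b *; rewrite ltnS => le_n.
wlog [x ax] : a b le_n / exists x, a x != x.
  move=> IH; case: (pickP (fun x => a x != x)) => [x ax|a1]; first by apply: IH; last by exists x.
  case: (pickP (fun x => b x != x)) => [x bx|b1].
    rewrite orbs3_sym comps_sym; apply: IH; last by exists x.
    by rewrite addnC.
  have one (c : {perm D}) : (fun x : D => c x != x) =1 xpred0 -> c = 1%g.
    by move=> c1; apply/permP=> x; rewrite perm1; apply/eqP/negPn; rewrite c1.
  by rewrite (one a a1) (one b b1) /orbs3 mulg1 orbs1 comps11; lia.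
rewrite eq_sym in ax; have xax : a x \in porbit a x by exact: (mem_porbit a 1).
have := split_genus b ax xax; set a' := (tperm x (a x) * a)%g => S.
have := orbs_tperm a ax; rewrite /= porbit_sym xax /= addn0 -/a' => oa.
have la := orbs_le a'; have := IHn a' b; rewrite /orbs3 in S * => IH.
clearbody a'.
have lt : #|D| - orbs a' + (#|D| - orbs b) < n.
  move: le_n la oa; move: #|D| (orbs a) (orbs b) (orbs a') => N p q r; lia.
move: {IH lt}(IH lt) S oa {la le_n IHn}; move: (comps _ _) (comps _ _) #|D| => p q r.
move: (orbs a) (orbs b) (orbs a') (orbs _) (orbs _) => *; lia.
Qed.

(* The pair has genus 0: [genus_ge0] is the reverse inequality. *)
Definition euler a b := #|D| + 2 * comps a b <= orbs3 a b.

Lemma euler_sym a b : euler a b -> euler b a.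
Proof. by rewrite /euler comps_sym orbs3_sym. Qed.

Lemma euler_split a b x y : y \in porbit a x -> euler a b ->
  euler (tperm x y * a)%g b.
Proof.
case: (eqVneq x y) => [->|xy xya]; first by rewrite tperm1 mul1g.
by have := split_genus b xy xya; rewrite /euler; lia.
Qed.

(** The product of the new pair is [a] again, so vertices, edges and faces only exchange their
    roles. For an involution [b] this is duality. *)
Lemma euler_rot a b : euler a b -> euler (b * a)%g (b^-1)%g.
Proof.
have -> : euler (b * a)%g (b^-1)%g = euler a b; last by [].
rewrite /euler; congr (_ + 2 * _ <= _); last first.
  rewrite /orbs3 mulgA mulVg mul1g {2}/orbs porbitsV -/(orbs b).
  by rewrite addnC addnA [RHS]addnAC [orbs a + _]addnC addnC addnA addnAC.
apply: (@eq_n_comp D) => x y; apply/idP/idP; apply: connect_sub => {x y} u v.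
  case/orP=> /= /eqP<-; first by rewrite permM (connect_trans (link2 a b u)) ?link1.
  by rewrite link_sym -{2}[u](permKV b) link2.
have cb w : connect (link (b * a) b^-1)%g w (b w).
  by rewrite link_sym -{2}[w](permK b) link2.
case/orP=> /= /eqP<-; last exact: cb.
rewrite -{2}[u](permKV b) -permM (connect_trans (link2 (b * a) b^-1 u)%g) //.
exact: link1.
Qed.

(* Two of the three orbit counts go up, so the genus would become negative unless
   the cut also creates a component. *)
Lemma split_separates a b x y : euler a b -> x != y -> y \in porbit a x ->
  y \in porbit (a * b)%g x -> ~~ connect (link (tperm x y * a)%g b) x y.
Proof.
move=> eul xy; rewrite porbit_sym => xya; rewrite porbit_sym => xy3.
apply/negP => xy'.
have C2 := n_comp_le_connected (link_sym a b) (link_sym (tperm x y * a)%g b)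
  (@link_split a b x y) xy'.
have := orbs_tperm a xy; rewrite /= xya /= => oa.
have := orbs_tperm (a * b)%g xy; rewrite /= xy3 /= => o3.
have := genus_ge0 (tperm x y * a)%g b.
move: eul C2 oa o3; rewrite /euler /orbs3 /comps (orbs_conj b (_ * a)%g) -mulgA.
rewrite (orbs_conj b a) !addn0; clear.
move=> eul C2 oa o3; rewrite oa o3; move: eul C2.
move: (n_comp _ _) (n_comp _ _) #|D| (orbs a) (orbs b) (orbs (a * b)%g) => *; lia.
Qed.

End Hypermap.

(** * Plane graphs *)

Section Skip.
Variable D : finType.
Implicit Types (s b : {perm D}) (d x y : D).

Lemma porbit_tperm_mono s x y u v : x \notin porbit s y -> v \in porbit s u ->
  v \in porbit (tperm x y * s)%g u.
Proof.
move=> nxy; set s' := (_ * s)%g.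
have xy : x != y by apply: contraNneq nxy => ->; exact: porbit_id.
have xy' : fconnect s' y x by rewrite -porbit_fconnect mem_porbit_tperm.
have yx' : fconnect s' x y by rewrite fconnect_sym //; apply: perm_inj.
rewrite !porbit_fconnect; apply: connect_sub => {u v} u _ /= /eqP<-.
have s'E z : s' (tperm x y z) = s z by rewrite /s' permM tpermK.
rewrite -s'E; case: tpermP => [->|->|_ _].
- exact: connect_trans yx' (fconnect1 _ _).
- exact: connect_trans xy' (fconnect1 _ _).
- exact: fconnect1.
Qed.

(** Takes [d] out of its cycle: the predecessor of [d] is sent straight to [s d]. *)
Definition skip s d := (tperm d (s^-1 d) * s)%g.

Lemma skipd s d : skip s d d = d.
Proof. by rewrite permM tpermL permKV. Qed.

Lemma skip_out s d x : x != d -> s x != d -> skip s d x = s x.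
Proof.
move=> xd sxd; rewrite permM tpermD 1?eq_sym //.
by apply: contraNneq sxd => ->; rewrite permKV.
Qed.

Lemma skip_porbit s d x y : x != d -> y != d -> y \in porbit s x ->
  y \in porbit (skip s d) x.
Proof.
move=> xd yd; rewrite !porbit_fconnect => /iter_findex yE; rewrite -yE in yd *.
move: (findex s x y) yd {yE} => n yd.
(* A walk that stands at [d] is represented by the predecessor of [d], from which [skip] jumps over
   [d]. *)
suff: if iter n s x == d then fconnect (skip s d) x ((s^-1)%g d)
      else fconnect (skip s d) x (iter n s x).
  by rewrite (negPf yd).
elim: n {yd} => [|n] /=; first by rewrite (negPf xd) connect0.
case: (eqVneq (iter n s x) d) => [->|nd] IH.
  case: (eqVneq (s d) d) => // sd; apply: (connect_trans IH).
  apply: connect1. apply/eqP.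
  by rewrite permM tpermR.
case: (eqVneq (s (iter n s x)) d) => [sd|sd].
  by rewrite (_ : (s^-1)%g d = iter n s x) // -sd permK.
by apply: (connect_trans IH); apply/connect1/eqP; rewrite skip_out.
Qed.

Lemma euler_skip s b d : euler s b -> euler (skip s d) b.
Proof.
apply: euler_split; rewrite -porbitV; exact: (mem_porbit (s^-1)%g 1).
Qed.

End Skip.

Section Rep.
Variable T : finType.
Implicit Types (e : rel T).

(** [sg] turns round a vertex and [ep] reverses an edge. Fixed points of [ep] are dead darts: they
    carry no edge but may stay in the cycles of [sg], so that deletions and contractions can keep
    the type [D]. *)
Record prerep e (D : finType) (sg ep : {perm D}) (src : D -> T) : Prop := Prerep {
  rep_inv : forall d, ep (ep d) = d;
  rep_src : forall d, src (sg d) = src d;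
  rep_orb : forall d d', ep d != d -> ep d' != d' -> src d = src d' ->
    d' \in porbit sg d;
  rep_edge : forall u v,
    e u v <-> exists d, [/\ ep d != d, src d = u & src (ep d) = v];
  rep_uniq : forall d d', ep d != d -> ep d' != d' ->
    src d = src d' -> src (ep d) = src (ep d') -> d = d';
  rep_euler : euler sg ep }.

Definition plane e := exists (D : finType) (sg ep : {perm D}) (src : D -> T),
  prerep e sg ep src.

Definition plane_map e (D : finType) (sg ep : {perm D}) (src : D -> T) : Prop :=
  prerep e sg ep src /\ (forall d, ep d = d -> sg d = d).

(** [skip] takes the dead darts out of the rotation one at a time without raising the genus, so that
    face walks from live darts meet live darts only. *)
Lemma plane_mapP e : plane e -> exists (D : finType) (sg ep : {perm D}) (src : D -> T),
  plane_map e sg ep src.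
Proof.
case=> D [sg [ep [src rp]]]; exists D.
have [n] := ubnP #|[pred d | (ep d == d) && (sg d != d)]|.
elim: n sg rp => // n IHn sg rp; rewrite ltnS => le_n.
case: (pickP [pred d | (ep d == d) && (sg d != d)]) => [d /= /andP[/eqP ed sd]|no]; last first.
  exists sg, ep, src; split=> // d ed; apply/eqP/negPn/negP => sd.
  by have := no d; rewrite /= ed eqxx sd.
have dead x : ep x != x -> x != d by apply: contraNneq => ->; rewrite ed.
apply: (IHn (skip sg d)).
  case: rp => inv srcs orb edge un eul; split=> //; last exact: euler_skip.
    move=> x; rewrite permM; case: tpermP => [->|->|_ _].
    - by rewrite permKV.
    - by rewrite srcs -[in LHS](permKV sg d) srcs.
    - exact: srcs.
  by move=> x y lx ly xy; apply: skip_porbit; rewrite ?dead // orb.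
apply: leq_trans le_n; apply: proper_card; apply/properP; split; last first.
  by exists d; rewrite !inE ?ed ?eqxx //= skipd eqxx.
apply/subsetP=> x; rewrite !inE => /andP[-> /=]; apply: contraNneq => sx.
have xd : x != d by apply: contraNneq sd => xd; rewrite -{1}xd sx xd.
by rewrite skip_out ?sx.
Qed.

Lemma eq_plane e e' : e =2 e' -> plane e -> plane e'.
Proof.
move=> ee [D [sg [ep [src [inv srcs orb edge un eul]]]]].
by exists D, sg, ep, src; split=> // u v; rewrite -ee.
Qed.

(* Deleting or contracting an edge both turn its two darts into fixed points of
   the edge involution. *)
Lemma cut_edge (D : finType) (ep : {perm D}) d (ep' := (tperm d (ep d) * ep)%g) :
  (forall d, ep (ep d) = d) ->
  [/\ ep' d = d, ep' (ep d) = ep d,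
      forall x, x != d -> x != ep d -> ep' x = ep x
    & forall x, (ep' x != x) = [&& ep x != x, x != d & x != ep d]].
Proof.
move=> inv; have E1 : ep' d = d by rewrite permM tpermL inv.
have E2 : ep' (ep d) = ep d by rewrite permM tpermR.
have E3 x : x != d -> x != ep d -> ep' x = ep x.
  by move=> x1 x2; rewrite permM tpermD 1?eq_sym.
split=> // x; case: (eqVneq x d) => [->|x1]; first by rewrite E1 eqxx andbF.
case: (eqVneq x (ep d)) => [->|x2]; first by rewrite E2 eqxx !andbF.
by rewrite E3 // !andbT.
Qed.

Lemma plane_del1 e a b : plane e -> e a b ->
  plane (fun u v => e u v && ~~ ((u == a) && (v == b) || (u == b) && (v == a))).
Proof.
move=> [D [sg [ep [src rp]]]] /(rep_edge rp)[d [ld da db]].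
case: rp => inv srcs orb edge un eul.
have [E1 E2 E3 E4] := cut_edge d inv; set ep' := (_ * ep)%g in E1 E2 E3 E4.
have lep x : ep (ep x) != ep x = (ep x != x) by rewrite (inj_eq perm_inj).
exists D, sg, ep', src; split=> //.
- move=> x; case: (eqVneq x d) => [->|x1]; first by rewrite !E1.
  case: (eqVneq x (ep d)) => [->|x2]; first by rewrite !E2.
  rewrite [ep' x]E3 // E3 //; first by apply: contraNneq x2 => <-; rewrite inv.
  by rewrite (inj_eq perm_inj).
- by move=> x y; rewrite !E4 => /andP[lx _] /andP[ly _]; apply: orb.
- move=> u v; split.
    case/andP=> /edge[x [lx xu xv]] nab; exists x.
    have x1 : x != d.
      by apply: contraNneq nab => xd; rewrite -xu -xv xd da db !eqxx.
    have x2 : x != ep d.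
      by apply: contraNneq nab => xd; rewrite -xu -xv xd inv da db !eqxx orbT.
    by rewrite E4 lx x1 x2 E3.
  case=> x []; rewrite E4 => /and3P[lx x1 x2] xu; rewrite E3 // => xv.
  apply/andP; split; first by apply/edge; exists x.
  apply/negP => /orP[] /andP[/eqP ua /eqP vb].
    by case/eqP: x1; apply: un => //; rewrite ?xu ?xv ?ua ?vb.
  by case/eqP: x2; apply: un => //; rewrite ?lep // ?inv ?xu ?xv ?ua ?vb.
- move=> x y; rewrite !E4 => /and3P[lx x1 x2] /and3P[ly y1 y2].
  by rewrite !E3 //; apply: un.
- apply: euler_sym; apply: euler_split; last exact: euler_sym.
  exact: (mem_porbit ep 1).
Qed.

Lemma plane_del e e' : simple_graph e -> simple_graph e' -> subrel e' e ->
  plane e -> plane e'.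
Proof.
move=> se [se' ie']; have [n] := ubnP #|[pred p : T * T | e p.1 p.2 && ~~ e' p.1 p.2]|.
elim: n e se => // n IHn e se; rewrite ltnS => le_n sub pe.
case: (pickP [pred p : T * T | e p.1 p.2 && ~~ e' p.1 p.2])
    => [[a b]/= /andP[eab eab']|no]; last first.
  apply: eq_plane pe => u v; apply/idP/idP; last exact: sub.
  by move=> uv; apply/negPn/negP => uv'; have := no (u, v); rewrite /= uv uv'.
set e1 := fun u v => e u v && ~~ ((u == a) && (v == b) || (u == b) && (v == a)).
apply: (IHn e1); last exact: plane_del1.
- case: se => [se ie]; split=> [u v|u]; last by rewrite /e1 ie.
  by rewrite /e1 se; congr (_ && ~~ _); rewrite orbC; congr (_ || _); rewrite andbC.
- apply: leq_trans le_n; apply: proper_card; apply/properP; split; last first.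
    by exists (a, b); rewrite !inE /= ?eab ?eab' // /e1 !eqxx andbF.
  by apply/subsetP=> -[u v]; rewrite !inE /= /e1 => /andP[/andP[-> _] ->].
- move=> u v uv'; rewrite /e1 sub //; apply: contra eab' => /orP[] /andP[/eqP<- /eqP<-] //.
  by rewrite se'.
Qed.

(** The vertex type is kept: [y] survives as an isolated vertex, and its edges move to [y']. *)
Definition contract e y y' : rel T := fun u v =>
  [&& u != y, v != y & [|| e u v, [&& u == y', e y v & v != y']
                                 | [&& v == y', e u y & u != y']]].

Lemma contract_simple e y y' : simple_graph e -> simple_graph (contract e y y').
Proof.
case=> se ie; split=> [u v|u]; rewrite /contract; last first.
  by rewrite ie /=; case: (eqVneq u y') => _; rewrite /= ?andbF /= ?andbF.
rewrite /= andbCA (se u v) (se u y) (se v y); congr [&& _, _ & _ || _].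
exact: orbC.
Qed.

(** The transposition of the two darts of the edge merges the rotations at [y] and [y']. A common
    neighbour would create a double edge and break [rep_uniq]. *)
Lemma plane_contract e y y' : simple_graph e -> plane e -> e y y' ->
  (forall w, ~~ (e y w && e y' w)) -> plane (contract e y y').
Proof.
move=> [se ie] [D [sg [ep [src rp]]]] eyy'.
case/(rep_edge rp): (eyy') => d [ld dy dy'] ncom.
have yy' : y != y' by apply: contraTneq eyy' => ->; rewrite ie.
case: rp => inv srcs orb edge un eul.
have [E1 E2 E3 E4] := cut_edge d inv; set ep' := (_ * ep)%g in E1 E2 E3 E4.
have lep x : ep (ep x) != ep x = (ep x != x) by rewrite (inj_eq perm_inj).
pose rho w := if w == y then y' else w.
have dart x : ep x != x -> e (src x) (src (ep x)) by move=> lx; apply/edge; exists x.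
have ndd : d \notin porbit sg (ep d).
  apply/negP => /porbitP[i di]; case/eqP: yy'; rewrite -dy -dy' [in LHS]di permX.
  by elim: i {di} => //= i IHi; rewrite srcs.
have rhoy w : rho w != y by rewrite /rho; case: (eqVneq w y) => // _; rewrite eq_sym.
have rhoE w : w != y -> rho w = w by rewrite /rho => /negPf->.
have rhoyE : rho y = y' by rewrite /rho eqxx.
have cut x : [&& ep x != x, x != d & x != ep d] ->
  ~ (src x = y /\ src (ep x) = y') /\ ~ (src x = y' /\ src (ep x) = y).
  case/and3P=> lx x1 x2; split=> -[xa xb].
    by case/eqP: x1; apply: un; rewrite // ?xa ?xb ?dy ?dy'.
  by case/eqP: x2; apply: un; rewrite // ?lep ?inv // ?xa ?xb ?dy ?dy'.
have nloop x : ep x != x -> src x <> src (ep x).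
  by move=> lx xE; have := dart x lx; rewrite -xE ie.
have dartr x : ep x != x -> e (src (ep x)) (src x) by move=> lx; rewrite se dart.
have ncom1 w : e y w -> e y' w -> False by move=> w1 w2; have := ncom w; rewrite w1 w2.
have inv' x : ep' (ep' x) = x.
  case: (eqVneq x d) => [->|x1]; first by rewrite !E1.
  case: (eqVneq x (ep d)) => [->|x2]; first by rewrite !E2.
  rewrite [ep' x]E3 // E3 //; first by apply: contraNneq x2 => <-; rewrite inv.
  by rewrite (inj_eq perm_inj).
exists D, (tperm d (ep d) * sg)%g, ep', (rho \o src); split=> //.
- move=> x /=; rewrite permM; case: tpermP => [->|->|_ _]; rewrite srcs //.
    by rewrite dy dy' /rho eqxx eq_sym (negPf yy').
  by rewrite dy dy' /rho eqxx eq_sym (negPf yy').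
- move=> x z; rewrite !E4 => /and3P[lx x1 x2] /and3P[lz z1 z2] /= xz.
  wlog xz' : x z lx lz x1 x2 z1 z2 xz / src z = src x \/ (src x = y /\ src z = y').
    move=> IH; case: (eqVneq (src x) (src z)) => [E|ne]; first by apply: IH => //; left.
    case: (eqVneq (src x) y) => [xy|xy].
      case: (eqVneq (src z) y) => [zy|zy]; first by rewrite xy zy eqxx in ne.
      by apply: IH => //; right; split=> //; rewrite -(rhoE _ zy) -xz xy.
    case: (eqVneq (src z) y) => [zy|zy]; last by rewrite !rhoE // in xz; rewrite xz eqxx in ne.
    rewrite porbit_sym; apply: IH => //; right; split=> //.
    by rewrite -(rhoE _ xy) xz zy.
  case: xz' => [E|[xy zy']]; first by apply: porbit_tperm_mono ndd _; apply: orb.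
  have dx := porbit_tperm_mono ndd (orb x d lx ld ltac:(by rewrite xy dy)).
  have zd : z \in porbit sg (ep d) by apply: orb; rewrite ?lep // dy'.
  have := porbit_tperm_mono ndd zd.
  rewrite -!eq_porbit_mem in dx * => /eqP->; rewrite -(eqP dx) eq_sym eq_porbit_mem.
  by apply: mem_porbit_tperm => //; apply: contraNneq ndd => <-; exact: porbit_id.
- move=> u v; split.
    case/and3P=> uy vy; case/or3P=> [uv|/and3P[/eqP uE yv vy']|/and3P[/eqP vE uy' uy2]].
    + case/edge: uv => x [lx xu xv]; exists x.
      have x1 : x != d by apply: contraNneq uy => xd; rewrite -xu xd dy.
      have x2 : x != ep d by apply: contraNneq vy => xd; rewrite -xv xd inv dy.
      by rewrite E4 lx x1 x2 E3 //= xu xv !rhoE.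
    + case/edge: yv => x [lx xu xv]; exists x.
      have x1 : x != d by apply: contraNneq vy' => xd; rewrite -xv xd dy'.
      have x2 : x != ep d by apply: contraNneq yy' => xd; rewrite -xu xd dy'.
      by rewrite E4 lx x1 x2 E3 //= xu xv rhoyE uE rhoE.
    + case/edge: uy' => x [lx xu xv]; exists x.
      have x1 : x != d by apply: contraNneq yy' => xd; rewrite -xv xd dy'.
      have x2 : x != ep d by apply: contraNneq uy2 => xd; rewrite -xu xd dy'.
      by rewrite E4 lx x1 x2 E3 //= xu xv rhoyE vE rhoE.
  case=> x [] /=; rewrite E4 => lx <-.
  have [c1 c2] := cut x lx; case/and3P: lx => lx x1 x2; rewrite E3 // => <-.
  have ed := dart x lx; rewrite /contract !rhoy /=.
  case: (eqVneq (src x) y) => [xy|xy].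
    have py : src (ep x) != y by apply: contra_notN (nloop x lx) => /eqP->.
    rewrite xy rhoyE rhoE // -xy ed eqxx /=.
    have -> : src (ep x) != y' by apply/eqP => py'; apply: c1.
    by rewrite orbT.
  case: (eqVneq (src (ep x)) y) => [py|py]; last by rewrite !rhoE // ed.
  rewrite py rhoyE rhoE // -py ed eqxx /=.
  have -> : src x != y' by apply/eqP => py'; apply: c2.
  by rewrite !orbT.
- move=> x z; rewrite !E4 => lx lz; have [x1 x2] := cut x lx; have [z1 z2] := cut z lz.
  case/and3P: lx => lx n1 n2; case/and3P: lz => lz n3 n4; rewrite !E3 //= => xz pq.
  have key u v u' v' : e u v -> e u' v' -> ~ (u = y' /\ v = y) ->
      ~ (u' = y' /\ v' = y) -> rho u = rho u' -> rho v = rho v' -> u = u'.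
    move=> uv uv' c c'; rewrite /rho.
    case: (eqVneq u y) (eqVneq u' y) => [uE|_] [uE'|_] //; first by rewrite uE uE'.
      case: (eqVneq v y) => [vE|_]; first by move: uv; rewrite uE vE ie.
      case: (eqVneq v' y) => [vE'|_ uE2 vE]; first by move=> uE2; case: c'.
      by case: (ncom1 v); rewrite ?vE ?uE2 // -?uE // -?vE.
    case: (eqVneq v' y) => [vE'|_]; first by move: uv'; rewrite uE' vE' ie.
    case: (eqVneq v y) => [vE|_ uE2 vE]; first by move=> uE2; case: c.
    by case: (ncom1 v'); rewrite -?uE2 -?vE // -uE'; rewrite vE.
  have swap u v : ~ (u = y /\ v = y') -> ~ (v = y' /\ u = y) by move=> h [? ?]; apply: h.
  apply: un => //.
    exact: (key _ _ _ _ (dart x lx) (dart z lz)).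
  by apply: (key _ _ _ _ (dartr x lx) (dartr z lz)) => //; apply: swap.
(* The face permutation [ep * sg] is unchanged, so in the dual the contraction is a deletion:
   [euler_rot] passes to faces and edges, [euler_split] cuts the edge, and [euler_rot] comes
   back. *)
- have eps2 : (ep * ep = 1)%g by apply/permP=> x; rewrite permM inv perm1.
  have invE : (ep'^-1 = ep')%g.
    by apply/permP=> x; apply: (@perm_inj _ ep'); rewrite permKV inv'.
  have -> : (tperm d (ep d) * sg = ep' * (ep * sg))%g.
    by rewrite /ep' -mulgA (mulgA ep) eps2 mul1g.
  rewrite -{2}invE; apply: euler_rot; apply: euler_sym; apply: euler_split.
    exact: (mem_porbit ep 1).
  have := euler_rot eul; rewrite (_ : ep^-1 = ep)%g; first exact: euler_sym.
  by apply/eqP; rewrite eq_invg_mul eps2.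
Qed.

End Rep.

(** * Counting orbits, and rotation systems from the given notion of planarity *)

Section Counting.
Variable D : finType.
Implicit Types (s : {perm D}) (Z : {set D}).

Lemma sum_porbits s Z : \sum_(A in porbits s) #|A :&: Z| = #|Z|.
Proof.
rewrite -[RHS]sum1_card (partition_big (porbit s) (mem (porbits s))) /=; last first.
  by move=> d _; apply: imset_f.
apply: eq_bigr => _ /imsetP[d _ ->]; rewrite -sum1_card; apply: eq_bigl => x.
by rewrite !inE eq_porbit_mem andbC.
Qed.

Lemma fcard_porbits s : n_comp (frel s) D = orbs s.
Proof.
have sy := fconnect_sym (@perm_inj _ s).
rewrite /n_comp_mem -(@card_in_imset _ _ (porbit s)); last first.
  move=> x y; rewrite !inE !andbT => /eqP rx /eqP ry /eqP.
  by rewrite eq_porbit_mem porbit_fconnect => /(rootP sy); rewrite rx ry.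
apply: eq_card => A; apply/imsetP/imsetP => -[x _ ->]; first by exists x.
exists (froot s x); first by rewrite !inE roots_root.
by apply/eqP; rewrite eq_porbit_mem porbit_fconnect sy connect_root.
Qed.

Lemma orbs_involution s : (forall x, s (s x) = x) -> (forall x, s x != x) ->
  #|D| = 2 * orbs s.
Proof.
move=> inv nfix; rewrite -cardsT -(sum_porbits s) mulnC -sum_nat_const.
apply: eq_bigr => _ /imsetP[x _ ->]; rewrite setIT.
have -> : porbit s x = [set x; s x]; last by rewrite cards2 eq_sym nfix.
apply/setP=> y; rewrite !inE; apply/porbitP/orP; last first.
  by case=> /eqP->; [exists 0; rewrite perm1 | exists 1; rewrite expg1].
case=> i ->; elim: i => [|i]; first by rewrite perm1; left.
by rewrite expgSr permM => -[]/eqP->; rewrite ?inv; [right|left].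
Qed.

End Counting.

Section Planar.
Variables (T : finType) (e : rel T).
Hypothesis se : simple_graph e.

Local Notation dart := (sig (fun p : T * T => e p.1 p.2)).

Let flip_proof (d : dart) : e (val d).2 (val d).1.
Proof. by rewrite (proj1 se); exact: (valP d). Qed.

Let flip (d : dart) : dart := exist _ ((val d).2, (val d).1) (flip_proof d).

Let flipK : involutive flip.
Proof. by move=> d; apply: val_inj; rewrite /=; case: (val d). Qed.

(** Darts miss the isolated vertices. Each of these counts once among the vertices, once in the
    extra term and at least once among the components, and these contributions cancel in the given
    formula. *)
Lemma planar_plane : planar e -> plane e.
Proof.
case: se => sym irr; case=> sg [[sgs sgo] eul].
pose ep : {perm dart} := perm (inv_inj flipK).
pose src (d : dart) := (val d).1.
have epE d : ep d = flip d by rewrite permE.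
have inv d : ep (ep d) = d by rewrite !epE flipK.
have live d : ep d != d.
  rewrite epE; apply/eqP => /(congr1 (fun d => (val d).1)) /= E.
  by have := valP d; rewrite E irr.
have orb d d' : src d = src d' -> d' \in porbit sg d.
  by rewrite porbit_fconnect => /sgo.
exists dart, sg, ep, src; split=> //.
- by move=> d d' _ _; apply: orb.
- move=> u v; split=> [uv|[d [_ <- <-]]]; last by rewrite epE /=; exact: (valP d).
  by exists (exist _ (u, v) uv); split; rewrite // epE.
- move=> d d' _ _; rewrite !epE /src /= => E1 E2; apply: val_inj.
  by case: d d' E1 E2 => [[a b] ?] [[a' b'] ?] /= -> ->.
pose iso := [pred x | isolated e x].
have nE : #|[pred p : T * T | e p.1 p.2]| = #|{: dart}| by rewrite card_sig.
have nep := orbs_involution inv live.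
have nF : num_faces sg = orbs (ep * sg)%g.
  rewrite -fcard_porbits; apply: (@eq_n_comp dart); apply: eq_connect => d d' /=.
  rewrite permM /face_step; apply/existsP/eqP => [[d2 /andP[/eqP E /eqP<-]]|<-].
    by congr (sg _); apply: val_inj; rewrite epE E.
  by exists (ep d); rewrite epE /= !eqxx.
have nV : #|T| = orbs sg + #|iso|.
  rewrite -(cardC iso) addnC; congr (_ + _).
  pose f v := [set d | src d == v].
  rewrite -(@card_in_imset _ _ f); last first.
    move=> u v; rewrite !inE negb_forall => /existsP[w]; rewrite negbK => uw _ /setP fuv.
    by have := fuv (exist _ (u, w) uw); rewrite !inE eqxx => /esym/eqP.
  apply: eq_card => A; apply/imsetP/imsetP => [[v]|[d _ ->]].
    rewrite !inE negb_forall => /existsP[w]; rewrite negbK => vw ->.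
    exists (exist _ (v, w) vw) => //; apply/setP => d; rewrite inE.
    apply/eqP/idP => [E|/porbitP[i ->]]; first by apply: orb.
    rewrite permX; elim: i => //= i IHi; by rewrite /src sgs.
  exists (src d).
    rewrite !inE negb_forall; apply/existsP; exists (val d).2; rewrite negbK.
    exact: (valP d).
  apply/setP => d'; rewrite inE; apply/idP/eqP => [/porbitP[i ->]|E]; last by apply: orb.
  by rewrite permX; elim: i => //= i IHi; rewrite /src sgs.
have con u v d d' : connect e u v -> src d = u -> src d' = v -> connect (link sg ep) d d'.
  case/connectP=> p; elim: p u d => [|w p IHp] u d /=.
    by move=> _ -> E1 E2; apply: link_orbit1; apply: orb; rewrite E1.
  case/andP=> uw pw lw du dv.
  pose x : dart := exist _ (u, w) uw.
  apply: connect_trans (link_orbit1 ep (orb d x du)) _.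
  apply: connect_trans (link2 sg ep x) _.
  by apply: (IHp w) => //; rewrite epE.
have esym : connect_sym e by apply: sym_connect_sym.
have nC : comps sg ep + #|iso| <= n_comp e predT.
  rewrite /n_comp_mem /comps /n_comp_mem.
  pose f d := root e (src d).
  have <- : #|f @: predI (roots (link sg ep)) {: dart}| =
      #|predI (roots (link sg ep)) {: dart}|.
    apply: card_in_imset => d d'; rewrite !inE !andbT => /eqP rd /eqP rd' /(rootP esym).
    by move/con/(_ erefl erefl)/(rootP (link_sym sg ep)); rewrite rd rd'.
  rewrite -cardUI (_ : #|predI _ _| = 0) ?addn0; last first.
    apply: eq_card0 => v; rewrite !inE; apply/negP => /andP[/imsetP[d _ ->]].
    have := valP d; rewrite -/(src d) {}/f /=; move: (connect_root e (src d)) => /connectP[p].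
    case/lastP: p => [|p w]; first by move=> _ /= -> dd /forallP/(_ (val d).2); rewrite dd.
    rewrite last_rcons rcons_path => /andP[_ lw] wE _.
    by move=> /forallP/(_ (last (src d) p)); rewrite wE sym lw.
  apply: subset_leq_card; apply/subsetP => v; rewrite !inE andbT => /orP[].
    by case/imsetP => d _ ->; rewrite /f roots_root.
  move=> iv; rewrite /roots; apply/eqP.
  move: (connect_root e v) => /connectP[[|w p]] //=.
  by case/andP => vw; move/forallP/(_ w): iv; rewrite vw.
move: eul; rewrite nF nE /euler /orbs3 nV; move: nep nC; clear.
move: #|{: dart}| #|iso| (n_comp _ _) (comps _ _) (orbs sg) (orbs ep) (orbs _)  => *; lia.
Qed.

End Planar.

Lemma next_neq_prev (T : eqType) (p : seq T) v :
  uniq p -> 2 < size p -> v \in p -> next p v != prev p v.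
Proof.
move=> up sp /rot_to[i q pE]; rewrite -(next_rot i up) -(prev_rot i up) pE.
move: up sp; rewrite -(rot_uniq i) -(size_rot i) pE.
have prev_last s y : v \notin s -> prev_at v v y s = last y s.
  elim: s y => [|z s IHs] y /=; first by rewrite eqxx.
  by rewrite inE negb_or => /andP[/negPf-> /IHs].
case: q {pE} => [|a [|b q]] // /andP[vq /andP[aq _]] _.
rewrite /prev prev_last // /= eqxx.
by apply: contraNneq aq => ->; rewrite mem_last.
Qed.

Section Restrict.
Variables (D : finType) (ep b : {perm D}).
Hypothesis inv : forall d, ep (ep d) = d.

Lemma edge_ends d x :
  (ep x != d) && (ep x != ep d) = (x != d) && (x != ep d).
Proof.
rewrite andbC (inj_eq perm_inj); congr (_ && ~~ _).
by rewrite -{1}[d]inv (inj_eq perm_inj).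
Qed.

(** The edges inside [Z] are cut one after another. With the face permutation as [b], this deletes
    edges of the dual. *)
Lemma euler_restrict (Z : pred D) : (forall d, Z (ep d) = Z d) -> euler ep b ->
  exists2 s : {perm D}, forall d, s d = (if Z d then d else ep d) & euler s b.
Proof.
have [n] := ubnP #|[pred d | Z d && (ep d != d)]|.
elim: n Z => // n IHn Z; rewrite ltnS => le_n Zep eul.
case: (pickP [pred d | Z d && (ep d != d)]) => [d /= /andP[Zd ld]|no]; last first.
  exists ep => // d; case: ifP => // Zd; apply/eqP/negPn/negP => ld.
  by have := no d; rewrite /= Zd ld.
pose Z' := [pred x | Z x && (x != d) && (x != ep d)].
have Z'ep x : Z' (ep x) = Z' x.
  by rewrite /= Zep -!andbA edge_ends.
have [|s sE es] := IHn Z' _ Z'ep eul.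
  apply: leq_trans le_n; apply: proper_card; apply/properP; split; last first.
    by exists d; rewrite !inE ?Zd ?ld ?eqxx ?andbF.
  by apply/subsetP=> x; rewrite !inE => /andP[/andP[/andP[-> _] _] ->].
have sd : s d = ep d by rewrite sE /= eqxx andbF.
exists (tperm d (ep d) * s)%g; last first.
  by apply: euler_split es; rewrite -sd; exact: (mem_porbit s 1).
move=> x; rewrite permM; case: tpermP => [->|->|/eqP xd /eqP xe].
- by rewrite sE /= eqxx andbF inv Zd.
- by rewrite sd Zep Zd.
- by rewrite sE /= xd xe !andbT.
Qed.

End Restrict.

(** * The Jordan curve theorem for a cycle *)

Section Jordan.
Variables (T : finType) (e : rel T) (D : finType) (sg ep : {perm D}) (src : D -> T).
Hypothesis rp : prerep e sg ep src.

Definition on_cycle (p : seq T) d := [&& ep d != d, src d \in p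
  & (src (ep d) == next p (src d)) || (src (ep d) == prev p (src d))].

Variable p : seq T.
Hypotheses (up : uniq p) (sp : 2 < size p) (cp : path.cycle e p).
Let onQ := on_cycle p.

Let inv := rep_inv rp.

Lemma live_epE d : (ep (ep d) != ep d) = (ep d != d).
Proof. by rewrite (inj_eq perm_inj). Qed.

Let onQ_ep d : onQ (ep d) = onQ d.
Proof.
wlog suff: d / onQ d -> onQ (ep d).
  by move=> H; apply/idP/idP => [/H|/H //]; rewrite inv.
rewrite /onQ /on_cycle live_epE inv => /and3P[-> dp].
by case/orP=> /eqP->; rewrite ?mem_next ?mem_prev ?dp ?prev_next ?next_prev ?eqxx ?orbT.
Qed.

Let outd v : v \in p -> exists d, [/\ ep d != d, src d = v & src (ep d) = next p v].
Proof. by move=> vp; apply/(rep_edge rp); apply: next_cycle. Qed.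

Lemma rotate a b : ep a != a -> ep b != b -> src a = src b -> a != b ->
  (forall x, onQ x -> src x = src a -> (x == a) || (x == b)) ->
  exists2 n, iter n sg (sg a) = b & forall i, i < n -> ~~ onQ (iter i sg (sg a)).
Proof.
move=> la lb ab nab H.
have fab : fconnect sg a b by rewrite -porbit_fconnect (rep_orb rp).
have := iter_findex fab; have := findex_max fab; set m := findex sg a b => mo mE.
have m0 : 0 < m by rewrite lt0n findex_eq0.
exists m.-1; first by rewrite -iterSr prednK.
move=> i im; rewrite -iterSr; apply/negP => Qi.
have im' : i.+1 < m by rewrite -ltnS prednK // in im *; rewrite -(prednK m0) ltnS.
have sE : src (iter i.+1 sg a) = src a.
  by elim: (i.+1) => //= k IHk; rewrite (rep_src rp).
have fi : findex sg a (iter i.+1 sg a) = i.+1 by apply: findex_iter; apply: ltn_trans mo.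
case/orP: (H _ Qi sE) => /eqP E; move: fi; rewrite E ?findex0 //.
by move=> mi; rewrite -/m in mi; rewrite mi ltnn in im'.
Qed.

(** [X] tells on which side of the cycle the face of a dart lies. Contract all edges of the cycle
    but one, that is, cut them in the dual: the last edge becomes a loop, with both darts in one
    vertex orbit. By [split_separates], cutting it as well puts its two darts into different parts
    of the dual, and [X] is one of these parts. *)
Theorem jordan : exists2 X : D -> bool, forall d, X (ep d) = X d (+) on_cycle p d
  & forall d, X ((ep * sg)%g d) = X d.
Proof.
have [v0 v0p] : exists v, v \in p by case: p sp => // v q _; exists v; exact: mem_head.
have [dd _] := outd v0p.
pose o v := odflt dd [pick d | [&& ep d != d, src d == v & src (ep d) == next p v]].
have oP v : v \in p -> [/\ ep (o v) != o v, src (o v) = v & src (ep (o v)) = next p v].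
  move=> vp; rewrite /o; case: pickP => [d /and3P[? /eqP? /eqP?] //|no].
  by have [d [d1 d2 d3]] := outd vp; have := no d; rewrite d1 d2 d3 !eqxx.
pose i v := ep (o (prev p v)).
have iP v : v \in p -> [/\ ep (i v) != i v, src (i v) = v & src (ep (i v)) = prev p v].
  move=> vp; have := oP (prev p v); rewrite mem_prev => /(_ vp)[].
  by rewrite /i live_epE inv next_prev.
have io v : v \in p -> i (next p v) = ep (o v) by move=> vp; rewrite /i prev_next.
have oQ v : v \in p -> onQ (o v).
  by move=> vp; have [a b c] := oP v vp; rewrite /onQ /on_cycle a b c vp eqxx.
have iQ v : v \in p -> onQ (i v).
  by move=> vp; rewrite /i onQ_ep oQ // mem_prev.
have QE x : onQ x -> (x == i (src x)) || (x == o (src x)).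
  case/and3P=> lx xp; have [a b c] := oP _ xp; have [a' b' c'] := iP _ xp.
  case/orP=> /eqP xE; [rewrite orbC|]; apply/orP; left; apply/eqP;
    apply: (rep_uniq rp) => //; by rewrite ?c ?c' ?b ?b'.
have ion v : v \in p -> i v != o v.
  move=> vp; apply/eqP => E; have [_ _ c] := oP v vp; have [_ _ c'] := iP v vp.
  by have := next_neq_prev up sp vp; rewrite -c -c' E eqxx.
have rot_io v : v \in p -> exists2 n, iter n sg (sg (i v)) = o v
    & forall k, k < n -> ~~ onQ (iter k sg (sg (i v))).
  move=> vp; have [a b c] := oP v vp; have [a' b' c'] := iP v vp.
  apply: rotate => //; rewrite ?b ?b' ?ion // => x /QE xE xv.
  by rewrite xv in xE.
have rot_oi v : v \in p -> exists2 n, iter n sg (sg (o v)) = i v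
    & forall k, k < n -> ~~ onQ (iter k sg (sg (o v))).
  move=> vp; have [a b c] := oP v vp; have [a' b' c'] := iP v vp.
  apply: rotate => //; rewrite ?b ?b' 1?eq_sym ?ion // => x /QE xE xv.
  by rewrite orbC; rewrite xv in xE.
have reach v : v \in p -> exists n, v = iter n (next p) v0.
  move=> vp; have : fconnect (next p) v0 v by rewrite (fconnect_cycle (cycle_next up)).
  by move/iter_findex <-; eexists.
have itp n : iter n (next p) v0 \in p by elim: n => //= n IHn; rewrite mem_next.
pose d0 := i v0.
have [ld0 _ _] := iP v0 v0p; rewrite -/d0 in ld0.
have Qd0 : onQ d0 by exact: iQ.
pose phi := (ep * sg)%g.
have phiE x : sg x = phi (ep x) by rewrite permM inv.
have eul : euler ep phi.
  apply: euler_sym; have := euler_rot (rep_euler rp).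
  suff -> : (ep^-1 = ep)%g by [].
  by apply/permP=> x; apply: (@perm_inj _ ep); rewrite permKV inv.
pose Z1 := [pred x | onQ x && (x != d0) && (x != ep d0)].
have Z1ep x : Z1 (ep x) = Z1 x.
  by rewrite /= onQ_ep -!andbA (edge_ends inv).
have [s1 s1E es1] := euler_restrict inv Z1ep eul.
have s1d0 : s1 d0 = ep d0 by rewrite s1E /= eqxx andbF.
(* [s1] fixes all darts of the cycle except the two of the edge of [d0], so the orbits of [th] are
   the vertices after the contraction. *)
pose th := (s1 * phi)%g.
have thE x : th x = if Z1 x then sg (ep x) else sg x.
  by rewrite permM s1E; case: ifP; rewrite phiE ?inv.
have th_nQ x : ~~ onQ x -> th x = sg x by move=> nQ; rewrite thE /= (negPf nQ).
have th_rot n x : (forall k, k < n -> ~~ onQ (iter k sg x)) ->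
    fconnect th x (iter n sg x).
  elim: n => [|n IHn] H /=; first exact: connect0.
  apply: connect_trans (IHn _) _; first by move=> k kn; apply: H; apply: ltnW.
  by apply: connect1; apply/eqP; rewrite th_nQ // H.
(* From [d0] the orbit turns round [v0] to [o v0], crosses to the next vertex of the cycle, and so
   follows the cycle on one side until it meets [ep d0]. *)
have walk n : fconnect th d0 (o (iter n (next p) v0)) \/ fconnect th d0 (ep d0).
  elim: n => [|n [IHn|]] /=; last by right.
    left; have [n <- H] := rot_io _ v0p; apply: connect_trans (th_rot n _ H).
    by apply: connect1; apply/eqP; rewrite thE /= eqxx andbF.
  set w := iter n _ _ in IHn *.
  case: (eqVneq (o w) (ep d0)) => [<-|od]; first by right.
  left; have wp : w \in p by exact: itp.
  have od0 : o w != d0.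
    apply: contraNneq (ion _ v0p) => E; rewrite -/d0 -E.
    have [_ ow _] := oP _ wp; have [_ dw _] := iP _ v0p.
    by rewrite -/d0 -E ow in dw; rewrite dw.
  apply: connect_trans IHn _.
  have thw : th (o w) = sg (i (next p w)) by rewrite thE /= oQ // od od0 io.
  apply: connect_trans (fconnect1 _ _) _; rewrite thw.
  have nwp : next p w \in p by rewrite mem_next.
  by have [k <- H] := rot_io _ nwp; apply: th_rot.
have hit : ep d0 \in porbit th d0.
  have pv : prev p v0 \in p by rewrite mem_prev.
  rewrite porbit_fconnect; have [n nE] := reach _ pv.
  by case: (walk n) => //; rewrite -nE /d0 /i inv.
have sep : ~~ connect (link (tperm d0 (ep d0) * s1)%g phi) d0 (ep d0).
  apply: split_separates => //; first by rewrite eq_sym.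
  by rewrite -s1d0; exact: (mem_porbit s1 1).
set sQ := (_ * s1)%g in sep.
have sQE x : sQ x = if onQ x then x else ep x.
  rewrite permM; case: tpermP => [->|->|/eqP xd /eqP xe].
  - by rewrite s1E /= eqxx andbF inv Qd0.
  - by rewrite s1d0 onQ_ep Qd0.
  - by rewrite s1E /= xd xe !andbT.
pose X x := connect (link sQ phi) d0 x.
have Xphi x : X (phi x) = X x.
  by rewrite /X; symmetry; apply: (same_connect_r (link_sym sQ phi)); exact: link2.
have XnQ x : ~~ onQ x -> X (ep x) = X x.
  move=> nQ; have <- : sQ x = ep x by rewrite sQE (negPf nQ).
  by rewrite /X; symmetry; apply: (same_connect_r (link_sym sQ phi)); exact: link1.
have Xsg x : X (sg x) = X (ep x) by rewrite phiE Xphi.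
have Xrot n x : (forall k, k < n -> ~~ onQ (iter k sg x)) -> X (iter n sg x) = X x.
  elim: n => //= n IHn H; rewrite Xsg XnQ ?H // IHn // => k kn; apply: H.
  exact: ltnW.
(* One turn round [v] meets the cycle only at [i v] and [o v], so either both crossings change the
   side or neither does. From [d0] the change spreads along the whole cycle. *)
have flip v : v \in p -> X (ep (i v)) (+) X (i v) = X (ep (o v)) (+) X (o v).
  move=> vp; have [n E H] := rot_io _ vp; have [m F G] := rot_oi _ vp.
  rewrite -[in RHS]E Xrot // -[X (i v)]/(X (i v)) -{2}F Xrot // !Xsg addbC.
  by rewrite ?E ?F addbC.
have flip0 : X (ep d0) (+) X d0 by rewrite /X connect0 (negPf sep).
have flipo n : X (ep (o (iter n (next p) v0))) (+) X (o (iter n (next p) v0)).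
  elim: n => [|n IHn] /=; first by rewrite -flip.
  by rewrite -flip ?mem_next ?itp // io ?itp // inv addbC.
have flipO v : v \in p -> X (ep (o v)) (+) X (o v).
  by move=> vp; have [n ->] := reach _ vp.
exists X => // x; case: (boolP (onQ x)) => Qx; rewrite -/onQ; last first.
  by rewrite (negPf Qx) addbF XnQ.
have xp : src x \in p by case/and3P: Qx.
have : X (ep x) (+) X x.
  case/orP: (QE _ Qx) => /eqP->; last exact: flipO.
  by rewrite flip ?flipO.
by rewrite Qx addbT; case: (X _); case: (X _).
Qed.

End Jordan.

(** Each further value is corrected by a transposition, which by injectivity leaves the earlier ones
    alone. This completes the matching of an edge to a bijection of colours. *)
Lemma perm_extends (I : finType) (m : I -> I -> bool) :
  (forall i j j', m i j -> m i j' -> j = j') ->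
  (forall i i' j, m i j -> m i' j -> i = i') ->
  exists s : {perm I}, forall i j, m i j -> s i = j.
Proof.
move=> fm im.
suff [s sP] : exists s : {perm I}, forall i j, i \in enum I -> m i j -> s i = j.
  by exists s => i j; apply: sP; rewrite mem_enum.
elim: (enum I) => [|i l [s IHs]]; first by exists 1%g.
case: (pickP (m i)) => [j mij|no]; last first.
  exists s => k j; rewrite inE => /orP[/eqP->|]; last exact: IHs.
  by rewrite no.
exists (s * tperm (s i) j)%g => k j'; rewrite permM inE.
case: (eqVneq k i) => [-> _ mij'|ki /= kl mkj]; first by rewrite tpermL (fm _ _ _ mij mij').
rewrite (IHs _ _ kl mkj) tpermD //.
  by rewrite -(IHs _ _ kl mkj) (inj_eq perm_inj) eq_sym.
by apply: contraNneq ki => jj'; rewrite -jj' in mkj; apply/eqP/(im _ _ _ mkj).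
Qed.

(** * Reductions *)

Section Coloring.
Variable T : finType.
Implicit Types (e : rel T) (M : T -> T -> 'I_4 -> 'I_4 -> bool) (S : {set T}).

Definition extends e M S (phi : T -> 'I_4) := exists varphi : T -> 'I_4,
  M_coloring_on e M setT varphi /\ (forall v, v \in S -> varphi v = phi v).

(** Vertices are deleted by removing their edges, so [T] never changes, and isolated vertices have
    to be left out of the measure of the induction. *)
Definition active e S : pred T := [pred v | (v \notin S) && ~~ isolated e v].

Record instance e M S phi : Prop := Instance {
  inst_simple : simple_graph e;
  inst_plane : plane e;
  inst_bowtie : ~ contains_bowtie e;
  inst_b : ~ contains_graph_b e;
  inst_M : matching_assignment e M;
  inst_S : short_cycle_vertex_set e S;
  inst_phi : M_coloring_on e M S phi }.

Definition below n := forall e M S phi,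
  instance e M S phi -> #|active e S| < n -> extends e M S phi.

Lemma isolatedPn e v : reflect (exists w, e v w) (~~ isolated e v).
Proof.
rewrite negb_forall; apply: (iffP existsP) => -[w]; first by rewrite negbK; exists w.
by move=> vw; exists w; rewrite negbK.
Qed.

(** A coloured vertex [u] forbids at most one colour at [v], namely [f u], so fewer than four
    vertices leave one free. *)
Lemma free_color e M (P : {set T}) v (c : T -> 'I_4) : matching_assignment e M ->
  #|P| < 4 -> exists i, forall u, u \in P -> ~~ M v u i (c u).
Proof.
case=> sM _ iM P4; pose f u := odflt ord0 [pick i | M v u i (c u)].
have fP u i : M v u i (c u) -> i = f u.
  rewrite /f => mi; case: pickP => [j mj|/(_ i)]; last by rewrite mi.
  by apply: (iM u v (c u)); rewrite sM.
have : ~~ ([set: 'I_4] \subset f @: P).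
  apply: contraL P4 => /subset_leq_card; rewrite cardsT card_ord -leqNgt => h.
  by apply: leq_trans h (leq_imset_card _ _).
case/subsetPn=> i _ nfi; exists i => u uP; apply: contra nfi => /fP->.
exact: imset_f.
Qed.

Definition restrict e' M : T -> T -> 'I_4 -> 'I_4 -> bool :=
  fun u v i j => e' u v && M u v i j.

Lemma restrict_matching e e' M : symmetric e' -> matching_assignment e M ->
  matching_assignment e' (restrict e' M).
Proof.
move=> se' [sM eM iM]; split=> [u v i j|u v i j /andP[] //|u v i j j'].
  by rewrite /restrict se' sM.
by move=> /andP[_ m1] /andP[_ m2]; apply: iM m1 m2.
Qed.

Lemma bowtie_sub e e' : subrel e' e -> contains_bowtie e' -> contains_bowtie e.
Proof.
move=> sub [o [a [b [c [d [u /and5P[h1 h2 h3 h4 /andP[h5 h6]]]]]]]].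
by exists o, a, b, c, d; split=> //; rewrite !sub.
Qed.

Lemma graph_b_sub e e' : subrel e' e -> contains_graph_b e' -> contains_graph_b e.
Proof.
move=> sub [o [a [b [c [d [f [u [[h1 h2 h3 h4] [h5 h6 h7 h8]]]]]]]]].
by exists o, a, b, c, d, f; split=> //; split; split; apply: sub.
Qed.

Lemma cycle_sub_in e e' (p : seq T) : uniq p ->
  {in p &, subrel e e'} -> path.cycle e p -> path.cycle e' p.
Proof.
move=> up sub cp; apply: cycle_from_next => // x xp.
by apply: sub; rewrite ?mem_next // next_cycle.
Qed.

Lemma instance_sub e e' M S S' phi c : instance e M S phi -> simple_graph e' ->
  subrel e' e -> short_cycle_vertex_set e' S' -> M_coloring_on e M S' c ->
  instance e' (restrict e' M) S' c.
Proof.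
case=> se pe nbow nb mM _ _ se' sub cS cc; split=> //.
- exact: plane_del pe.
- by move/(bowtie_sub sub).
- by move/(graph_b_sub sub).
- by apply: restrict_matching mM; case: se'.
- by move=> u v uS vS uv; rewrite /restrict uv cc // sub.
Qed.

Definition induced e (A : {set T}) : rel T := fun u v => [&& u \in A, v \in A & e u v].

Lemma induced_simple e A : simple_graph e -> simple_graph (induced e A).
Proof.
by case=> se ie; split=> [u v|u]; rewrite /induced ?ie ?andbF // se andbCA.
Qed.

Lemma induced_sub e A : subrel (induced e A) e.
Proof. by move=> u v /and3P[]. Qed.

Lemma induced_cycle e (A : {set T}) (p : seq T) : uniq p -> {subset p <= A} ->
  path.cycle e p -> path.cycle (induced e A) p.
Proof.
by move=> up pA; apply: cycle_sub_in => // u v /pA uA /pA vA uv; rewrite /induced uA vA.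
Qed.

Lemma card_active_lt e e' S S' v : v \in active e S -> v \notin active e' S' ->
  {subset active e' S' <= active e S} -> #|active e' S'| < #|active e S|.
Proof.
move=> v1 v2 sub; apply: proper_card; apply/properP; split; first exact/subsetP.
by exists v.
Qed.

Section Minimal.
Variables (e : rel T) (M : T -> T -> 'I_4 -> 'I_4 -> bool) (S : {set T}) (phi : T -> 'I_4).
Hypothesis inst : instance e M S phi.
Hypothesis IH : below #|active e S|.

Lemma min_degree v : v \in active e S -> #|[set u | e v u]| < 4 -> extends e M S phi.
Proof.
case: (inst) => se pe nbow nb mM [p [up sp cp SE]] phiP va dv.
have [vS vi] := andP va.
pose e' := induced e (~: [set v]).
have pv : {subset p <= ~: [set v]}.
  by move=> u up'; rewrite !inE; apply: contraNneq vS => <-; rewrite SE inE.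
have [||c [cP cphi]] := @IH e' (restrict e' M) S phi.
- apply: instance_sub inst _ _ _ phiP; first exact: induced_simple.
    exact: induced_sub.
  by exists p; split=> //; apply: induced_cycle.
- apply: (card_active_lt va).
    rewrite !inE vS /= negbK; apply/forallP=> w.
    by rewrite /e' /induced !inE eqxx.
  move=> u; rewrite !inE => /andP[-> /isolatedPn[w /and3P[_ _ uw]]].
  by apply/isolatedPn; exists w.
have [i iP] := free_color v c mM dv.
exists (fun u => if u == v then i else c u); split=> [u w _ _ uw|u uS]; last first.
  by case: eqVneq uS vS => [->->|_ uS _] //; apply: cphi.
have [sM eM iM] := mM; have [sy ir] := se.
case: (eqVneq u v) => [uv|uv]; case: (eqVneq w v) => [wv|wv].
- by rewrite uv wv ir in uw.
- by rewrite uv; apply: iP; rewrite inE -uv.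
- by rewrite sM wv; apply: iP; rewrite inE -wv sy.
- have e'uw : e' u w by rewrite /e' /induced !inE uv wv.
  by have := cP u w (in_setT _) (in_setT _) e'uw; rewrite /restrict e'uw.
Qed.

(* Colour everything outside [B] first, then extend the colouring of [q] inwards. *)
Lemma no_inside (q : seq T) (B : {set T}) z v :
  uniq q -> 3 <= size q <= 6 -> path.cycle e q ->
  (forall u, u \in B -> u \notin S /\ u \notin q) ->
  (forall u w, u \in B -> e u w -> (w \in B) || (w \in q)) ->
  z \in B -> ~~ isolated e z ->
  v \in active e S -> v \notin B -> extends e M S phi.
Proof.
move=> uq sq cq Bout Bcl zB zi va vB.
case: (inst) => se pe nbow nb mM [p [up sp cp SE]] phiP.
have [sM eM iM] := mM; have [sy ir] := se.
pose e1 := induced e (~: B).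
have pB : {subset p <= ~: B}.
  move=> u up'; rewrite !inE; apply/negP => /Bout[]; by rewrite SE inE up'.
have [||c [cP cphi]] := @IH e1 (restrict e1 M) S phi.
- apply: instance_sub inst _ _ _ phiP; first exact: induced_simple.
    exact: induced_sub.
  by exists p; split=> //; apply: induced_cycle.
- apply: (@card_active_lt _ _ _ _ z); first by rewrite !inE zi (proj1 (Bout z zB)).
    rewrite !inE negb_and !negbK; apply/orP; right; apply/forallP=> w.
    by rewrite /e1 /induced !inE zB.
  move=> u; rewrite !inE => /andP[-> /isolatedPn[w /and3P[_ _ uw]]].
  by apply/isolatedPn; exists w.
pose Q := [set u in q]; pose e2 := induced e (B :|: Q).
have cQ : M_coloring_on e M Q c.
  move=> u w uQ wQ uw; have e1uw : e1 u w.
    rewrite /e1 /induced uw !inE andbT; rewrite !inE in uQ wQ.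
    by apply/andP; split; apply/negP => /Bout[_]; rewrite ?uQ ?wQ.
  by have := cP u w (in_setT _) (in_setT _) e1uw; rewrite /restrict e1uw.
have [||c2 [c2P c2c]] := @IH e2 (restrict e2 M) Q c.
- apply: instance_sub inst _ _ _ cQ; first exact: induced_simple.
    exact: induced_sub.
  exists q; split=> //; apply: induced_cycle => // u uq'.
  by rewrite !inE uq' orbT.
- apply: (card_active_lt va).
    rewrite !inE; case: (boolP (v \in q)) => //= vq; rewrite negbK.
    by apply/forallP=> w; rewrite /e2 /induced !inE (negPf vB) (negPf vq).
  move=> u; rewrite !inE => /andP[uq' /isolatedPn[w /and3P[uBQ _ uw]]].
  have uB : u \in B by move: uBQ; rewrite !inE (negPf uq') orbF.
  by rewrite (proj1 (Bout u uB)); apply/isolatedPn; exists w.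
exists (fun u => if u \in B then c2 u else c u); split=> [u w _ _ uw|u uS]; last first.
  case: ifP => uB; last exact: cphi.
  by have [] := Bout u uB; rewrite uS.
wlog uB : u w uw / u \in B \/ (u \notin B /\ w \notin B).
  move=> H; case: (boolP (u \in B)) => uB; first by rewrite -{1}[c2 u]/(c2 u);
    have := H u w uw (or_introl uB); rewrite uB.
  case: (boolP (w \in B)) => wB; last first.
    by have := H u w uw (or_intror (conj uB wB)); rewrite (negPf uB) (negPf wB).
  rewrite sy in uw; have := H w u uw (or_introl wB).
  by rewrite sM (negPf uB) wB.
case: uB => [uB|[uB wB]]; last first.
  rewrite (negPf uB) (negPf wB).
  have e1uw : e1 u w by rewrite /e1 /induced !inE uB wB.
  by have := cP u w (in_setT _) (in_setT _) e1uw; rewrite /restrict e1uw.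
have wBQ := Bcl u w uB uw; rewrite uB.
have e2uw : e2 u w by rewrite /e2 /induced !inE uB wBQ.
have := c2P u w (in_setT _) (in_setT _) e2uw; rewrite /restrict e2uw /=.
case: ifP => // wB; rewrite wB /= in wBQ; by rewrite [c2 w]c2c // inE.
Qed.

End Minimal.
End Coloring.

(** * The reducible triangle *)

Local Ltac neq_by lem :=
  first [done | by rewrite eq_sym | by apply: lem | by rewrite eq_sym; apply: lem].

Section Reduction.
Variables (T : finType) (e : rel T).

(* [b] and [d] lie on different sides of every short cycle through [a], [v], [c]. *)
Definition separated v a c b d := forall l,
  path.cycle e [:: a, v, c & l] -> uniq [:: a, v, c & l] -> size l <= 3 ->
  (b \in l) || (d \in l).

(* The neighbours of [v] in cyclic order; of the embedding only the separation by
   short cycles is recorded. *)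
Definition cross v a b c d := [/\ forall w, e v w = (w \in [:: a; b; c; d]),
  uniq [:: a; b; c; d], separated v a c b d & separated v b d a c].

Variables (M : T -> T -> 'I_4 -> 'I_4 -> bool) (S : {set T}) (phi : T -> 'I_4).
Hypothesis inst : instance e M S phi.
Hypothesis IH : below T #|active e S|.
Variables x y z xy xz yx yz zx zy : T.
Hypotheses (nx : cross x y z xy xz) (ny : cross y x z yx yz)
  (nz : cross z x y zx zy).
Hypotheses (xS : x \notin S) (yS : y \notin S) (zS : z \notin S).
Hypothesis lxy : forall w, e x w -> e y w -> w = z.

Let se : symmetric e := proj1 (inst_simple inst).
Let ie : irreflexive e := proj2 (inst_simple inst).

(* Delete the triangle and join [yx] to [xy] and [xz]. The new matchings transport
   the colour [g] that [yx] forbids at [y] to [x] by a permutation [pi] extending the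
   matching of the edge [y x]: then [pi g] is free at [x], and forbids at [y] only
   [g]. In the plane, the new edges arise by contracting [y] and then [x] into
   [yx]. *)
Lemma reducible_triangle : yx \notin S -> extends e M S phi.
Proof.
move=> sS.
have nbow := inst_bowtie inst; have nb := inst_b inst.
have [Nx ux sx1 sx2] := nx; have [Ny uy sy1 sy2] := ny; have [Nz uz sz1 sz2] := nz.
have exE w : w \in [:: y; z; xy; xz] -> e x w by rewrite Nx.
have eyE w : w \in [:: x; z; yx; yz] -> e y w by rewrite Ny.
have ezE w : w \in [:: x; y; zx; zy] -> e z w by rewrite Nz.
have exy : e x y by rewrite exE // !inE eqxx.
have exz : e x z by rewrite exE // !inE eqxx ?orbT.
have ex1 : e x xy by rewrite exE // !inE eqxx ?orbT.
have ex2 : e x xz by rewrite exE // !inE eqxx ?orbT.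
have eyz : e y z by rewrite eyE // !inE eqxx ?orbT.
have ey1 : e y yx by rewrite eyE // !inE eqxx ?orbT.
have ey2 : e y yz by rewrite eyE // !inE eqxx ?orbT.
have ne u v : e u v -> u != v by apply: contraTneq => ->; rewrite ie.
have nxy := ne _ _ exy; have nxz := ne _ _ exz; have nyz := ne _ _ eyz.
have nx1 := ne _ _ ex1; have nx2 := ne _ _ ex2; have ny1 := ne _ _ ey1.
have ny2 := ne _ _ ey2.
move: (ux); rewrite /= !inE !negb_or andbT.
case/and3P=> /and3P[_ y_xy y_xz] /andP[z_xy z_xz] xy_xz.
move: (uy); rewrite /= !inE !negb_or andbT.
case/and3P=> /and3P[_ x_yx x_yz] /andP[z_yx z_yz] yx_yz.
have common u w : e x u -> e y w -> u != z -> u != w.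
  by move=> xu yw; apply: contraNneq => uw; rewrite (lxy xu) // uw.
have xy_yx : xy != yx by apply: common; rewrite // eq_sym.
have xy_yz : xy != yz by apply: common; rewrite // eq_sym.
have xz_yx : xz != yx by apply: common; rewrite // eq_sym.
have xz_yz : xz != yz by apply: common; rewrite // eq_sym.
set s := yx in ey1 ny1 x_yx z_yx yx_yz xy_yx xz_yx sS Ny uy eyE *.
have bow o a b c d : uniq [:: o; a; b; c; d] -> e o a -> e o b -> e a b -> e o c ->
  e o d -> e c d -> False.
  by move=> u h1 h2 h3 h4 h5 h6; apply: nbow; exists o, a, b, c, d; rewrite h1 h2 h3 h4 h5 h6.
have s_yz : ~~ e s yz.
  apply/negP => syz; apply: (bow y x z s yz) => //; last by rewrite se.
  by rewrite /= !inE !negb_or ?(eq_sym y x) nxy nyz ny1 ny2 nxz x_yx x_yz z_yx z_yz yx_yz.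
have nxyxz : ~~ e xy xz.
  apply/negP => h; apply: (bow x y z xy xz) => //.
  by rewrite /= !inE !negb_or nxy nxz nx1 nx2 nyz y_xy y_xz z_xy z_xz xy_xz.
(* The triangle is an opaque list, so that [inE] does not expand membership in it. *)
have [T3 T3E] : {l : seq T | l = [:: x; y; z]} by exists [:: x; y; z].
(* A short path from [s] to an outer neighbour [w] of [x] starts a cycle through
   [x], [y] and [s]; only [yz] can separate. *)
have far w l : w \in [:: xy; xz] -> path e s l -> last s l = w -> uniq (s :: l) ->
    size l <= 3 -> all (fun u => u \notin T3) l -> yz \in l.
  move=> wx pl lw ul sl /allP lT; case/lastP: l => [|l w'] in pl lw ul sl lT *.
    by move: wx; rewrite -lw /= !inE !(eq_sym s) (negPf xy_yx) (negPf xz_yx).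
  rewrite last_rcons in lw; rewrite {w'}lw in pl ul sl lT *.
  have : (z \in rcons l w) || (yz \in rcons l w).
    apply: sy1 => //.
      rewrite /= rcons_path last_rcons exy ey1 pl /= se exE //.
      by move: wx; rewrite !inE => /orP[]->; rewrite ?orbT.
    have sT : s \notin T3 by rewrite T3E !inE !negb_or ?(eq_sym s) x_yx ny1 z_yx.
    move: ul => /= /andP[-> ->]; rewrite !andbT !inE !negb_or nxy x_yx ny1 /=.
    by apply/andP; split; apply/negP => /lT; rewrite T3E !inE eqxx ?orbT.
  by case/orP=> // /lT; rewrite T3E !inE eqxx !orbT.
have wT w : w \in [:: xy; xz] -> w \notin T3.
  rewrite T3E !inE !negb_or => /orP[]/eqP->.
    by rewrite !(eq_sym xy) nx1 y_xy z_xy.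
  by rewrite !(eq_sym xz) nx2 y_xz z_xz.
have sT : s \notin T3 by rewrite T3E !inE !negb_or ?(eq_sym s) x_yx ny1 z_yx.
have yzT : yz \notin T3 by rewrite T3E !inE !negb_or !(eq_sym yz) x_yz ny2 z_yz.
have w_yz w : w \in [:: xy; xz] -> w != yz by rewrite !inE => /orP[]/eqP->.
have w_s w : w \in [:: xy; xz] -> w != s by rewrite !inE => /orP[]/eqP->.
(* These three facts treat paths of length one, two and three from [s] to [xy] or [xz] that avoid
   the triangle. The first two kinds do not exist, so the new edges are not old and close no path of
   two old edges. The third kind closes over [x] and [y] to a 6-cycle, which forces it to reach [xz]
   through [yz]. *)
have F1 w : w \in [:: xy; xz] -> ~~ e s w.
  move=> wx; apply/negP => sw; have := far w [:: w] wx.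
  rewrite /= sw !inE eq_sym w_s //= => /(_ erefl erefl erefl erefl).
  by rewrite eq_sym (negPf (w_yz w wx)) wT //= => /(_ isT).
have F2 w q : w \in [:: xy; xz] -> q \notin T3 -> e s q -> ~~ e q w.
  move=> wx qT sq; apply/negP => qw; have := far w [:: q; w] wx.
  rewrite /= sq qw !inE negb_or (ne _ _ sq) (ne _ _ qw) (eq_sym s) w_s //=.
  move=> /(_ erefl erefl erefl erefl) H.
  have : (yz == q) || (yz == w).
    by apply: H; rewrite qT wT.
  rewrite (eq_sym yz w) (negPf (w_yz w wx)) orbF => /eqP qE.
  by move: s_yz; rewrite qE sq.
have F3 w a b : w \in [:: xy; xz] -> a \notin T3 -> b \notin T3 -> e w a ->
    e a b -> e b s -> a != s -> b != w -> w = xz /\ a = yz.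
  move=> wx aT bT wa ab bs as_ bw.
  have ayz : a = yz.
    have := far w [:: b; a; w] wx.
    rewrite /= se bs se ab se wa !inE !negb_or (eq_sym s b) (ne _ _ bs) eq_sym as_.
    rewrite (eq_sym s w) (w_s w wx) (eq_sym b a) (ne _ _ ab) bw (eq_sym a w) (ne _ _ wa) /=.
    move=> /(_ erefl erefl erefl erefl) H.
    have : [|| yz == b, yz == a | yz == w].
      by apply: H; rewrite bT aT wT.
    rewrite (eq_sym yz w) (negPf (w_yz w wx)) orbF => /orP[]/eqP // bE.
    by move: s_yz; rewrite bE se bs.
  (* If [w] were [xy], the separation at [x] would put [xz] on the 6-cycle, where it could only be
     [b], a neighbour of [s]; [F1] excludes that. *)
  split=> //; apply/eqP; move: wx; rewrite !inE => /orP[]/eqP // wE.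
  have : (z \in [:: a; b; s]) || (xz \in [:: a; b; s]).
    rewrite wE in wa bw.
    apply: sx1 => //; first by rewrite /= se exy ex1 wa ab bs se ey1.
    have := aT; have := bT; rewrite T3E !inE !negb_or.
    case/and3P=> b1 b2 b3 /and3P[a1 a2 a3].
    rewrite /= !inE !negb_or (eq_sym y x) nxy y_xy (eq_sym y a) a2 (eq_sym y b) b2 ny1.
    rewrite nx1 (eq_sym x a) a1 (eq_sym x b) b1 x_yx (ne _ _ wa) (eq_sym xy) bw xy_yx.
    by rewrite (ne _ _ ab) as_ (ne _ _ bs).
  rewrite !inE; have := aT; have := bT; rewrite T3E !inE !negb_or.
  case/and3P=> _ _ b3 /and3P[_ _ a3].
  rewrite !(eq_sym z) (negPf a3) (negPf b3) [s == z]eq_sym (negPf z_yx) /=.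
  rewrite ayz (negPf xz_yz) (negPf xz_yx) orbF /= => /eqP xzb.
  by have := F1 xz; rewrite !inE eqxx orbT => /(_ erefl); rewrite se xzb bs.
pose new u v := (u == s) && (v \in [:: xy; xz]) || (v == s) && (u \in [:: xy; xz]).
have newC u v : new u v = new v u by rewrite /new orbC.
pose e' u v := [&& u \notin T3, v \notin T3 & e u v || new u v].
have se' : simple_graph e'.
  split=> [u v|u]; first by rewrite /e' se newC andbCA.
  rewrite /e' ie /= /new orbb; apply/negP => /and3P[_ _ /andP[/eqP-> /w_s]].
  by rewrite eqxx.
have e'old u v : e' u v -> ~~ new u v -> e u v.
  by case/and3P=> _ _ /orP[] // ->.
have new_old u v : new u v -> ~~ e u v.
  by case/orP=> /andP[/eqP-> /F1] //; rewrite se.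
(* No triangle contains a new edge: two new edges would make [xy] and [xz] adjacent and give a
   bowtie at [x], and a single one contradicts [F2]. *)
have tri u v w : e' u v -> e' v w -> e' u w -> e u v.
  move=> uv vw uw; apply: (@e'old) => //; apply/negP => nuv.
  wlog [us vx] : u v uv vw uw nuv / u = s /\ v \in [:: xy; xz].
    move=> H; case/orP: (nuv) => /andP[/eqP us vx]; first exact: (H u v).
    apply: (H v u) => //; first by rewrite (proj1 se').
    by rewrite newC.
  have wT' : w \notin T3 by case/and3P: uw.
  have evw : e v w.
    apply: (@e'old) => //; apply/negP => /orP[]/andP[/eqP].
      by move=> vs _; move: (w_s v vx); rewrite vs eqxx.
    by move=> ws _; move: uw; rewrite us ws; case: se' => _ ->.
  case: (boolP (new u w)) => nuw.
    have wx : w \in [:: xy; xz].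
      case/orP: nuw => /andP[_ //] usx; have := w_s u usx; by rewrite us eqxx.
    move: vx wx evw; rewrite !inE => /orP[]/eqP-> /orP[]/eqP->; rewrite ?ie //.
      by rewrite (negPf nxyxz).
    by rewrite se (negPf nxyxz).
  have := F2 v w vx wT'; rewrite -us (e'old _ _ uw nuw) se evw.
  by move/(_ erefl).
have triE u v w : e' u v -> e' v w -> e' u w -> [/\ e u v, e v w & e u w].
  have [sy _] := se'; move=> uv vw uw; split; first exact: tri uv vw uw.
    by apply: (tri v w u); rewrite // sy.
  by apply: (tri u w v); rewrite // sy.
have nbow' : ~ contains_bowtie e'.
  case=> o [a [b [c [d [u /and5P[h1 h2 h3 h4 /andP[h5 h6]]]]]]].
  have [] := triE o a b h1 h3 h2; have [] := triE o c d h4 h6 h5 => g1 g2 g3 g4 g5 g6.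
  exact: (bow o a b c d).
have [se'1 _] := se'.
have e'T u v : e' u v -> u \notin T3 by case/andP.
have e'cases u v : e' u v -> e u v \/ new u v.
  by move=> uv; case: (boolP (new u v)) => nuv; [right | left; apply: (@e'old)].
have newP u v : new u v -> (u = s /\ v \in [:: xy; xz]) \/ (v = s /\ u \in [:: xy; xz]).
  by case/orP=> /andP[/eqP-> ?]; [left|right].
have T3n u v : u \notin T3 -> v \in T3 -> u != v by move=> uT; apply: contraTneq => <-.
have xT : x \in T3 by rewrite T3E !inE eqxx.
have yT : y \in T3 by rewrite T3E !inE eqxx orbT.
have exs w : w \in [:: xy; xz] -> e x w by rewrite !inE => /orP[]/eqP->.
have nb' : ~ contains_graph_b e'.
  case=> o [a [b [c [d [f [u [[oa ab bc co] [cd d_o df fo]]]]]]]].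
  have [eoc ecd eod] : [/\ e o c, e c d & e o d] by apply: triE; rewrite // se'1.
  have [_ edf eof] : [/\ e o d, e d f & e o f] by apply: triE; rewrite // se'1.
  (* Both triangles are old, so new edges occur only on the path from [o] over [a] and [b] to [c].
     With the help of [F3] that path is rerouted through [x] or [y], and the result is graph (b) in
     [e], which [bE] excludes for all replacements [a'] and [b']. *)
  have bE a' b' : uniq [:: o; a'; b'; c; d; f] -> e o a' -> e a' b' -> e b' c -> False.
    move=> u' h1 h2 h3; apply: nb; exists o, a', b', c, d, f; split=> //.
    by split; split=> //; rewrite se.
  have oT := e'T _ _ oa; have aT := e'T _ _ ab; have bT := e'T _ _ bc.
  have cT := e'T _ _ co; have dT := e'T _ _ d_o; have fT : f \notin T3 := e'T _ _ fo.
  move: (u); rewrite /= !inE !negb_or !andbT.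
  case/and5P=> /and5P[o_a o_b o_c o_d o_f] /and4P[a_b a_c a_d a_f]
    /and3P[b_c b_d b_f] /andP[c_d c_f] d_f.
  have uE a' b' : (a' = a \/ a' = b \/ a' \in T3) -> (b' = a \/ b' = b \/ b' \in T3) ->
      a' != b' -> uniq [:: o; a'; b'; c; d; f].
    have N w v : w = a \/ w = b \/ w \in T3 -> v \notin T3 -> v != a -> v != b ->
        (v != w) * (w != v).
      by rewrite [w == v]eq_sym; case=> [->|[->|wT' vT _ _]] //; rewrite T3n.
    move=> ha hb hab; rewrite /= !inE !negb_or o_c o_d o_f c_d c_f d_f hab.
    have := N _ o ha oT o_a o_b; have := N _ o hb oT o_a o_b.
    have := N _ c ha cT; have := N _ c hb cT; rewrite !(eq_sym c) a_c b_c.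
    have := N _ d ha dT; have := N _ d hb dT; rewrite !(eq_sym d) a_d b_d.
    have := N _ f ha fT; have := N _ f hb fT; rewrite !(eq_sym f) a_f b_f.
    by do 6![move=> /(_ isT isT)[_ ->]]; move=> [-> _] [-> _].
  have eys : e y s by []. have esy : e s y by rewrite se.
  have eyzy : e yz y by rewrite se.
  have n_yz : y != yz by []. have n_zy : yz != y by rewrite eq_sym.
  have n_ys : y != s by []. have n_sy : s != y by rewrite eq_sym.
  have wne w : w \in [:: xy; xz] -> w != s by apply: w_s.
  case: (e'cases _ _ oa) => [eoa|noa]; case: (e'cases _ _ ab) => [eab|nab];
    case: (e'cases _ _ bc) => [ebc|nbc].
  - exact: (bE a b).
  - case: (newP _ _ nbc) => [[bs cx]|[cs bx]].
      have [cE oE] : c = xz /\ o = yz.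
        by apply: (F3 c o a) => //; rewrite -?bs // 1?se // 1?eq_sym.
      apply: (bE y x); first by apply: uE; [right; right | right; right | neq_by T3n].
      1-3: by rewrite // ?oE ?cE // 1?se // ?exs // 1?se // ?exs.
    have [bE' aE] : b = xz /\ a = yz.
        by apply: (F3 b a o) => //; rewrite -?cs // 1?se // 1?eq_sym.
    apply: (bE a y); first by apply: uE; [left | right; right | neq_by T3n].
      1-3: by rewrite // ?aE ?cs // 1?se // ?exs // 1?se // ?exs.
  - case: (newP _ _ nab) => [[as_ bx]|[bs ax]].
      have [bE' cE] : b = xz /\ c = yz.
        by apply: (F3 b c o) => //; rewrite -?as_ // 1?se // 1?eq_sym.
      apply: (bE a y); first by apply: uE; [left | right; right | neq_by T3n].
      1-3: by rewrite // ?as_ ?cE // 1?se // ?exs // 1?se // ?exs.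
    have [aE oE] : a = xz /\ o = yz.
        by apply: (F3 a o c) => //; rewrite -?bs // 1?se // 1?eq_sym.
    apply: (bE y b); first by apply: uE; [right; right | right; left | neq_by T3n].
      1-3: by rewrite // ?oE ?bs // 1?se // ?exs // 1?se // ?exs.
  - have bs : b = s.
      case: (newP _ _ nab) => [[as_ bx]|[] //].
      case: (newP _ _ nbc) => [[] //|[cs _]]; by rewrite as_ cs eqxx in a_c.
    have ax : a \in [:: xy; xz].
      case: (newP _ _ nab) => [[as_ _]|[] //]; by rewrite as_ bs eqxx in a_b.
    have cx : c \in [:: xy; xz].
      case: (newP _ _ nbc) => [[] //|[cs _]]; by rewrite cs bs eqxx in b_c.
    apply: (bE a x); first by apply: uE; [left | right; right | neq_by T3n].
      1-3: by rewrite // 1?se // ?exs // 1?se // ?exs.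
  - case: (newP _ _ noa) => [[os ax]|[as_ ox]].
      have [aE bE'] : a = xz /\ b = yz.
        by apply: (F3 a b c) => //; rewrite -?os // 1?se // 1?eq_sym.
      apply: (bE y b); first by apply: uE; [right; right | right; left | neq_by T3n].
      1-3: by rewrite // ?os ?bE' // 1?se // ?exs // 1?se // ?exs.
    have [oE cE] : o = xz /\ c = yz.
        by apply: (F3 o c b) => //; rewrite -?as_ // 1?se // 1?eq_sym.
    apply: (bE x y); first by apply: uE; [right; right | right; right | neq_by T3n].
      1-3: by rewrite // ?oE ?cE // 1?se // ?exs // 1?se // ?exs.
  - exfalso.
    case: (newP _ _ noa) => [[os ax]|[as_ ox]]; case: (newP _ _ nbc) => [[bs cx]|[cs bx]].
    + by rewrite os bs eqxx in o_b.
    + by rewrite os cs eqxx in o_c.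
    + by rewrite as_ bs eqxx in a_b.
    + by rewrite as_ cs eqxx in a_c.
  - have as_ : a = s.
      case: (newP _ _ noa) => [[os ax]|[] //].
      case: (newP _ _ nab) => [[] //|[bs _]]; by rewrite os bs eqxx in o_b.
    have ox : o \in [:: xy; xz].
      case: (newP _ _ noa) => [[os _]|[] //]; by rewrite as_ os eqxx in o_a.
    have bx : b \in [:: xy; xz].
      case: (newP _ _ nab) => [[] //|[bs _]]; by rewrite as_ bs eqxx in a_b.
    apply: (bE x b); first by apply: uE; [right; right | right; left | neq_by T3n].
      1-3: by rewrite // 1?se // ?exs // 1?se // ?exs.
  - exfalso; case: (newP _ _ noa) => [[os ax]|[as_ ox]].
      case: (newP _ _ nab) => [[as_ _]|[bs _]]; first by rewrite os as_ eqxx in o_a.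
      by rewrite os bs eqxx in o_b.
    case: (newP _ _ nbc) => [[bs cx]|[cs bx]]; first by rewrite as_ bs eqxx in a_b.
    by rewrite as_ cs eqxx in a_c.
have zT : z \in T3 by rewrite T3E !inE eqxx !orbT.
have pe' : plane e'.
  (* At the triangle only the path from [s] over [y] to [x] and the edges from [x] to [xy] and [xz]
     are kept. Then the ends of each contracted edge have no common neighbour, and the contractions
     create exactly the new edges. *)
  pose keep u v := [|| (u == s) && (v == y), (u == y) && (v == x)
    | (u == x) && (v \in [:: xy; xz])].
  pose e1 u v := e u v && [|| (u \notin T3) && (v \notin T3), keep u v | keep v u].
  have se1 : simple_graph e1.
    split=> [u v|u]; last by rewrite /e1 ie.
    by rewrite /e1 se [(u \notin _) && _]andbC [keep u v || _]orbC.
  have nyx : y != x by rewrite eq_sym. have nsx : s != x by rewrite eq_sym.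
  have nsy : s != y by rewrite eq_sym. have nzx : z != x by rewrite eq_sym.
  have nzy : z != y by rewrite eq_sym. have nsz : s != z by rewrite eq_sym.
  have e1y v : e1 y v = (v == s) || (v == x).
    rewrite /e1 /keep yT eqxx (negPf nyx) [y == s](negPf ny1) /= !andbT.
    rewrite [y \in _](_ : _ = false) ?andbF ?orbF; last first.
      by rewrite !inE (negPf y_xy) (negPf y_xz).
    rewrite orbC; case: (eqVneq v s) => [->|_] /=; first by rewrite ey1.
    by case: (eqVneq v x) => [->|_] /=; rewrite ?andbF // se exy.
  have e1x v : e1 x v = (v == y) || (v \in [:: xy; xz]).
    rewrite /e1 /keep xT eqxx (negPf nxy) [x == s](negPf x_yx) /= !andbT.
    rewrite [x \in _](_ : _ = false) ?andbF ?orbF; last first.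
      by rewrite !inE (negPf nx1) (negPf nx2).
    rewrite orbC; case: (eqVneq v y) => [->|_] /=; first by rewrite exy.
    by case vx: (v \in _); rewrite ?andbF // exs.
  have pe1 : plane e1.
    apply: plane_del (inst_simple inst) se1 _ (inst_plane inst).
    by move=> u v /andP[].
  pose e2 := contract e1 y s.
  have se2 : simple_graph e2 by apply: contract_simple.
  have pe2 : plane e2.
    apply: plane_contract => //; first by rewrite e1y eqxx.
    move=> w; rewrite e1y; apply/negP => /andP[/orP[]/eqP->].
      by case: se1 => _ ->.
    rewrite /e1 /keep xT !eqxx (negPf nsx) (negPf nsy) (negPf nxy) /= !andbF /=.
    by rewrite !inE !(eq_sym s) (negPf xy_yx) (negPf xz_yx) andbF.
  have e2x v : e2 x v = (v != y) && ((v \in [:: xy; xz]) || (v == s)).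
    rewrite /e2 /contract nxy [x == s](negPf x_yx) /= !e1x eqxx /= !andbT.
    by case: (eqVneq v y).
  have e2s v w : v != y -> w != y -> v != x -> w != x -> e2 v w = e1 v w.
    move=> vy wy vx wx; rewrite /e2 /contract vy wy /= !e1y.
    have -> : e1 v y = e1 y v by case: se1.
    rewrite e1y (negPf vx) (negPf wx) !orbF.
    by case: (v == s) (w == s) => [] [] /=; rewrite ?andbF ?orbF.
  have pe3 : plane (contract e2 x s).
    apply: plane_contract => //; first by rewrite e2x nsy eqxx orbT.
    move=> w; rewrite e2x; apply/negP => /andP[/andP[wy wx] sw].
    case/orP: wx => [wx|/eqP ws]; last by move: sw; rewrite ws; case: se2 => _ ->.
    have wx' : w != x by apply: T3n => //; apply: wT.
    by move: sw; rewrite e2s // /e1 (negPf (F1 _ wx)).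
  apply: eq_plane pe3 => u v; rewrite /contract /e'.
  case: (eqVneq u x) => [->|ux']; first by rewrite xT.
  case: (eqVneq v x) => [->|vx']; first by rewrite xT /= ?andbF /= ?andbF.
  have -> : e2 u x = e2 x u by case: se2.
  have e2y w : e2 y w = false by rewrite /e2 /contract eqxx.
  have e2y' w : e2 w y = false by rewrite /e2 /contract eqxx andbF.
  rewrite !e2x /=.
  case: (eqVneq u y) => [->|uy'].
    by rewrite yT e2y [y == s](negPf ny1) /= ?andbF /= ?andbF.
  case: (eqVneq v y) => [->|vy'].
    by rewrite yT e2y' [y == s](negPf ny1) /= ?andbF /= ?andbF.
  rewrite e2s //=.
  have T3x w : w != x -> w != y -> (w \notin T3) = (w != z).
    by move=> wx wy; rewrite T3E !inE (negPf wx) (negPf wy).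
  have keep0 a b : a != x -> a != y -> b != x -> b != y -> keep a b = false.
    by move=> ax ay bx by_; rewrite /keep (negPf ax) (negPf ay) (negPf by_) !andbF.
  rewrite /e1 !keep0 // !orbF !T3x //.
  case: (eqVneq u z) => [->|uz'] /=.
    rewrite [z == s](negPf z_yx) !inE (negPf z_xy) (negPf z_xz) /= !andbF.
    by [].
  case: (eqVneq v z) => [->|vz'] /=.
    rewrite [z == s](negPf z_yx) !inE (negPf z_xy) (negPf z_xz) /= !andbF.
    by [].
  rewrite andbT /new; congr (_ || _).
  case: (eqVneq u s) (eqVneq v s) => [us|us] [vs|vs] //=; rewrite ?andbF ?andbT ?orbF //.
  rewrite us vs; apply/esym/negP; rewrite orbb => h.
  by have := w_s _ h; rewrite eqxx.
have [sM eM iM] := inst_M inst.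
have [pi piE] : exists pi : {perm 'I_4}, forall i j, M y x i j -> pi i = j.
  by apply: perm_extends => [|i i' j]; [exact: iM | rewrite !(sM y x); exact: iM].
pose K w i j := [exists g, M s y i g && M x w (pi g) j].
pose M' u v i j := if new u v then (if u == s then K v i j else K u j i)
                   else e' u v && M u v i j.
have new_e' u v : new u v -> e' u v.
  move=> nuv; rewrite /e' nuv orbT andbT.
  by case: (newP _ _ nuv) => -[-> /wT->]; rewrite sT.
have newD u v : new u v -> (u == s) = ~~ (v == s).
  by case/newP=> -[-> /w_s/negPf->]; rewrite eqxx.
have mM' : matching_assignment e' M'.
  split=> [u v i j|u v i j|u v i j j'].
  - rewrite /M' (newC v) se'1 sM; case: ifP => // /newD->; by case: (v == s).
  - by rewrite /M'; case: ifP => [/new_e'//|_ /andP[]].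
  - rewrite /M'; case: ifP => [_|_ /andP[_ m1] /andP[_ m2]]; last exact: iM m1 m2.
    case: ifP => _ /existsP[g /andP[g1 g2]] /existsP[h /andP[h1 h2]].
      by rewrite (iM _ _ _ _ _ g1 h1) in g2; apply: iM g2 h2.
    rewrite sM in g2; rewrite sM in h2; have /perm_inj gh := iM _ _ _ _ _ g2 h2.
    by rewrite sM gh in g1; rewrite sM in h1; apply: iM g1 h1.
have M'old u v i j : e' u v -> ~~ new u v -> M' u v i j = M u v i j.
  by rewrite /M' => -> /negPf->.
have inst' : instance e' M' S phi.
  split=> //.
    have [p [up sp cp SE]] := inst_S inst; exists p; split=> //.
    apply: cycle_sub_in cp => // u v up' vp uv.
    have pT w : w \in p -> w \notin T3.
      move=> wp; rewrite T3E !inE !negb_or.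
      by do !(apply/andP; split); apply: contraTneq wp => ->;
        [move: xS | move: yS | move: zS]; rewrite SE inE.
    by rewrite /e' !pT // uv.
  (* Because [s] lies off [S], no new edge joins two precoloured vertices. *)
  move=> u v uS vS uv; have nuv : ~~ new u v.
    apply/negP => /newP[] [us _]; by move: sS; rewrite -us ?uS ?vS.
  by rewrite M'old // (inst_phi inst) // e'old.
have [|c [cP cphi]] := IH inst'.
  apply: (@card_active_lt _ _ _ _ _ x).
  - by rewrite !inE xS; apply/isolatedPn; exists y.
  - rewrite !inE xS /= negbK; apply/forallP=> w; apply/negP => /e'T.
    by rewrite xT.
  - move=> u; rewrite !inE => /andP[-> /isolatedPn[w /e'cases[uw|/newP uw]]].
      by apply/isolatedPn; exists w.
    case: uw => -[us ux']; apply/isolatedPn; first by exists y; rewrite us se.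
    by exists x; rewrite se exs.
have cM u v : e' u v -> ~~ M' u v (c u) (c v) by move=> uv; apply: cP; rewrite ?inE.
suff [cx [cy [cz [Hx Hy Hz [Hxy Hxz Hyz]]]]] : exists cx cy cz,
    [/\ forall w, w \in [set xy; xz] -> ~~ M x w cx (c w),
        forall w, w \in [set s; yz] -> ~~ M y w cy (c w),
        forall w, w \in [set zx; zy] -> ~~ M z w cz (c w)
      & [/\ ~~ M x y cx cy, ~~ M x z cx cz & ~~ M y z cy cz]].
  pose c' w := if w == x then cx else if w == y then cy else if w == z then cz else c w.
  have c'x : c' x = cx by rewrite /c' eqxx.
  have c'y : c' y = cy by rewrite /c' eqxx eq_sym (negPf nxy).
  have c'z : c' z = cz by rewrite /c' eqxx (eq_sym z x) (negPf nxz) (eq_sym z y) (negPf nyz).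
  have c'T w : w \notin T3 -> c' w = c w.
    by rewrite T3E !inE !negb_or /c' => /and3P[/negPf-> /negPf-> /negPf->].
  have zxT : zx \notin T3.
    have ezx : e z zx by rewrite ezE // !inE eqxx ?orbT.
    move: (uz); rewrite /= !inE !negb_or T3E !inE !negb_or => /and3P[/and3P[_ h1 _] /andP[h2 _] _].
    by rewrite !(eq_sym zx) h1 h2 ne.
  have zyT : zy \notin T3.
    have ezy : e z zy by rewrite ezE // !inE eqxx ?orbT.
    move: (uz); rewrite /= !inE !negb_or T3E !inE !negb_or => /and3P[/and3P[_ _ h1] /andP[_ h2] _].
    by rewrite !(eq_sym zy) h1 h2 ne.
  have H3 v : v \in T3 -> forall w, e v w -> ~~ M v w (c' v) (c' w).
    rewrite T3E !inE => /or3P[]/eqP-> w; rewrite ?Nx ?Ny ?Nz !inE ?c'x ?c'y ?c'z.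
    - case/or4P=> /eqP->; rewrite ?c'y ?c'z // c'T ?Hx ?inE ?eqxx ?orbT //;
      by apply: wT; rewrite !inE eqxx ?orbT.
    - case/or4P=> /eqP->; rewrite ?c'x ?c'z //; first by rewrite sM.
        by rewrite c'T // Hy // !inE eqxx.
      by rewrite c'T // Hy // !inE eqxx orbT.
    - case/or4P=> /eqP->; rewrite ?c'x ?c'y; first by rewrite sM.
      + by rewrite sM.
      + by rewrite c'T // Hz // !inE eqxx.
      + by rewrite c'T // Hz // !inE eqxx orbT.
  exists c'; split=> [u v _ _ uv|v vS]; last first.
    rewrite c'T ?cphi // T3E !inE !negb_or.
    by do !(apply/andP; split); apply: contraTneq vS => ->.
  case: (boolP (u \in T3)) => uT; first exact: H3.
  case: (boolP (v \in T3)) => vT; first by rewrite sM H3 // se.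
  have e'uv : e' u v by rewrite /e' uT vT uv.
  have nuv : ~~ new u v by apply: contraL uv => /new_old.
  by rewrite !c'T // -M'old // cM.
have pick3 v a1 a2 a3 (f : T -> 'I_4) : exists i, [/\ ~~ M v a1 i (f a1),
    ~~ M v a2 i (f a2) & ~~ M v a3 i (f a3)].
  have [|i iP] := free_color v f (inst_M inst) (P := [set a1; a2; a3]).
    by rewrite -setUA !cardsU1 cards1; do 2!case: (_ \notin _).
  by exists i; rewrite !iP // !inE eqxx ?orbT.
have in2 a1 a2 v (k : 'I_4) : ~~ M v a1 k (c a1) -> ~~ M v a2 k (c a2) ->
    forall w, w \in [set a1; a2] -> ~~ M v w k (c w).
  by move=> h1 h2 w; rewrite !inE => /orP[]/eqP->.
pose upd v (k : 'I_4) w := if w == v then k else c w.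
have updE v k : upd v k v = k by rewrite /upd eqxx.
have updN v k w : w != v -> upd v k w = c w by rewrite /upd => /negPf->.
have zxx : zx != x.
  by move: uz; rewrite /= !inE !negb_or => /and3P[/and3P[_ h1 _] _ _]; rewrite eq_sym.
have zyx : zy != x.
  by move: uz; rewrite /= !inE !negb_or => /and3P[/and3P[_ _ h1] _ _]; rewrite eq_sym.
case: (pickP (fun g => M s y (c s) g)) => [g sg|sfree].
  have Hx w : w \in [:: xy; xz] -> ~~ M x w (pi g) (c w).
    move=> wx; have nsw : new s w by rewrite /new eqxx wx.
    have := cM s w (new_e' _ _ nsw); rewrite /M' nsw eqxx; apply: contra => m.
    by apply/existsP; exists g; rewrite sg.
  have [cz [z1 z2 z3]] := pick3 z zx zy x (upd x (pi g)).
  rewrite updE !updN // in z1 z2 z3.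
  have [cy [y1 y2 y3]] := pick3 y s yz z (upd z cz).
  rewrite updE !updN 1?eq_sym // in y1 y2 y3.
  exists (pi g), cy, cz; split.
  - by move=> w; rewrite !inE => h; apply: Hx; rewrite !inE.
  - exact: in2.
  - exact: in2.
  - split=> //; last by rewrite sM.
    apply/negP; rewrite sM => /piE/perm_inj gE.
    by rewrite sM -gE in sg; rewrite sg in y1.
(* Here [s] forbids nothing at [y], and in the order [z], [x], [y] each vertex meets at most three
   constraints. *)
have [cz [z1 z2 _]] := pick3 z zx zy zy c.
have [cx [x1 x2 x3]] := pick3 x xy xz z (upd z cz).
rewrite updE !updN 1?eq_sym // in x1 x2 x3.
have [cy [y1 y2 y3]] := pick3 y yz x z (fun w => if w == x then cx else upd z cz w).
rewrite eqxx [yz == x]eq_sym (negPf x_yz) updN 1?eq_sym // in y1 y2.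
rewrite [z == x]eq_sym (negPf nxz) updE in y3.
exists cx, cy, cz; split.
- exact: in2.
- by apply: in2; rewrite // sM; have /negbT := sfree cy.
- exact: in2.
- by split=> //; rewrite sM.
Qed.

End Reduction.

Section Lonely.
Variables (T : finType) (e : rel T).

(** The reflected cyclic order, with the same opposite pairs [a], [c] and [b], [d]. It brings every
    outer neighbour of the triangle into the role of [yx]. *)
Lemma cross_swap v a b c d : cross e v a b c d -> cross e v b a d c.
Proof.
case=> N u s1 s2; split=> //.
- by move=> w; rewrite N !inE; do 4!case: (w == _).
- move: u; rewrite /= !inE !negb_or !andbT.
  by case/and3P=> /and3P[? ? ?] /andP[? ?] ?; rewrite eq_sym; do !(apply/andP; split=> //);
    rewrite eq_sym.
Qed.

Variables (M : T -> T -> 'I_4 -> 'I_4 -> bool) (S : {set T}) (phi : T -> 'I_4).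
Hypothesis inst : instance e M S phi.
Hypothesis IH : below T #|active e S|.
Variables x y z xy xz yx yz zx zy : T.
Hypotheses (nx : cross e x y z xy xz) (ny : cross e y x z yx yz)
  (nz : cross e z x y zx zy).
Hypotheses (xS : x \notin S) (yS : y \notin S) (zS : z \notin S).
Hypotheses (lxy : forall w, e x w -> e y w -> w = z)
  (lxz : forall w, e x w -> e z w -> w = y)
  (lyz : forall w, e y w -> e z w -> w = x).

(** If some outer neighbour lies off [S], a symmetry of the triangle turns it into [yx]. Otherwise
    the six outer neighbours are distinct and fill [S]. Then [zy] is the only one that [xy] can be
    adjacent to: [xz] would give a bowtie, and the other three would close a 4-cycle that violates a
    separation. But [xy] has two neighbours on the cycle. *)
Lemma lonely_triangle : extends e M S phi.
Proof.
have nx' := cross_swap nx; have ny' := cross_swap ny; have nz' := cross_swap nz.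
have red1 := reducible_triangle inst IH nx ny nz xS yS zS lxy.
case: (boolP (yx \in S)) => [yxS|/red1//].
case: (boolP (yz \in S)) => [yzS|yzS]; last first.
  apply: (reducible_triangle inst IH nz' ny' nx' zS yS xS) => // w *; exact: lyz .
case: (boolP (xy \in S)) => [xyS|xyS]; last first.
  apply: (reducible_triangle inst IH ny nx nz' yS xS zS) => // w *; exact: lxy .
case: (boolP (xz \in S)) => [xzS|xzS]; last first.
  apply: (reducible_triangle inst IH nz nx' ny' zS xS yS) => // w *; exact: lxz .
case: (boolP (zx \in S)) => [zxS|zxS]; last first.
  apply: (reducible_triangle inst IH nx' nz ny xS zS yS) => // w *; exact: lxz .
case: (boolP (zy \in S)) => [zyS|zyS]; last first.
  apply: (reducible_triangle inst IH ny' nz' nx yS zS xS) => // w *; exact: lyz .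
exfalso.
have [se ie] := inst_simple inst.
have [Nx ux sx1 sx2] := nx; have [Ny uy sy1 sy2] := ny; have [Nz uz sz1 sz2] := nz.
have ex w : w \in [:: y; z; xy; xz] -> e x w by rewrite Nx.
have ey w : w \in [:: x; z; yx; yz] -> e y w by rewrite Ny.
have ez w : w \in [:: x; y; zx; zy] -> e z w by rewrite Nz.
have exy : e x y by rewrite ex // !inE eqxx.
have exz : e x z by rewrite ex // !inE eqxx ?orbT.
have ex1 : e x xy by rewrite ex // !inE eqxx ?orbT.
have ex2 : e x xz by rewrite ex // !inE eqxx ?orbT.
have eyz : e y z by rewrite ey // !inE eqxx ?orbT.
have ey1 : e y yx by rewrite ey // !inE eqxx ?orbT.
have ey2 : e y yz by rewrite ey // !inE eqxx ?orbT.
have ez1 : e z zx by rewrite ez // !inE eqxx ?orbT.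
have ez2 : e z zy by rewrite ez // !inE eqxx ?orbT.
have ne u v : e u v -> u != v by apply: contraTneq => ->; rewrite ie.
have nS u v : u \notin S -> v \in S -> u != v by move=> uS; apply: contraTneq => <-.
move: (ux); rewrite /= !inE !negb_or andbT.
case/and3P=> /and3P[_ y_xy y_xz] /andP[z_xy z_xz] xy_xz.
move: (uy); rewrite /= !inE !negb_or andbT.
case/and3P=> /and3P[_ x_yx x_yz] /andP[z_yx z_yz] yx_yz.
move: (uz); rewrite /= !inE !negb_or andbT.
case/and3P=> /and3P[_ x_zx x_zy] /andP[y_zx y_zy] zx_zy.
have cxy u w : e x u -> e y w -> u != z -> u != w.
  by move=> xu yw; apply: contraNneq => uw; rewrite (lxy xu) // uw.
have cxz u w : e x u -> e z w -> u != y -> u != w.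
  by move=> xu yw; apply: contraNneq => uw; rewrite (lxz xu) // uw.
have cyz u w : e y u -> e z w -> u != x -> u != w.
  by move=> xu yw; apply: contraNneq => uw; rewrite (lyz xu) // uw.
have [p [up /andP[sp3 sp6] cp SE]] := inst_S inst.
have uslots : uniq [:: xy; xz; yx; yz; zx; zy].
  rewrite /= !inE !negb_or xy_xz yx_yz zx_zy.
  by do !(apply/andP; split=> //);
    first [by apply: cxy; rewrite // 1?eq_sym // | by apply: cxz; rewrite // 1?eq_sym //
      | by apply: cyz; rewrite // 1?eq_sym //].
have [|_ slots] := uniq_min_size uslots _ sp6.
  by move=> u; rewrite !inE => /or4P[| | |/or3P[]] /eqP->; move: xyS xzS yxS yzS zxS zyS;
    rewrite SE !inE.
have xyp : xy \in p by rewrite SE inE in xyS.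
have only u : u \in p -> e xy u -> u = zy.
  rewrite -slots !inE => up' exu; apply/eqP; apply: contraLR exu => uzy.
  rewrite (negPf uzy) orbF in up'; apply/negP => exu.
  have x_xy := ne _ _ ex1.
  case/or4P: up' exu => [/eqP->|/eqP->|/eqP->|/orP[]/eqP->] exu.
  - by rewrite ie in exu.
  - apply: (inst_bowtie inst); exists x, y, z, xy, xz; split.
      by rewrite /= !inE !negb_or (ne _ _ exy) (ne _ _ exz) x_xy (ne _ _ ex2) (ne _ _ eyz)
        y_xy y_xz z_xy z_xz xy_xz.
    by rewrite exy exz eyz ex1 ex2 exu.
  - have h1 : path.cycle e [:: x; y; yx; xy] by rewrite /= exy ey1 se exu se ex1.
    have h2 : uniq [:: x; y; yx; xy].
      rewrite /= !inE !negb_or (ne _ _ exy) x_yx x_xy y_xy (ne _ _ ey1) /= andbT.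
      by rewrite eq_sym; apply: cxy => //; rewrite eq_sym.
    case/orP: (sy1 [:: xy] h1 h2 isT); rewrite inE => /eqP h.
      by rewrite h eqxx in z_xy.
    by have := cxy xy yz ex1 ey2; rewrite -h eqxx eq_sym z_yz => /(_ isT).
  - have h1 : path.cycle e [:: y; x; xy; yz] by rewrite /= (se y x) exy ex1 exu se ey2.
    have h2 : uniq [:: y; x; xy; yz].
      rewrite /= !inE !negb_or eq_sym (ne _ _ exy) y_xy (ne _ _ ey2) x_xy x_yz /= andbT.
      by apply: cxy => //; rewrite eq_sym.
    case/orP: (sx1 [:: yz] h1 h2 isT); rewrite inE => /eqP h.
      by rewrite h eqxx in z_yz.
    by have := cxy xz yz ex2 ey2; rewrite h eqxx eq_sym z_yz => /(_ isT).
  - have h1 : path.cycle e [:: x; z; zx; xy] by rewrite /= exz ez1 se exu se ex1.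
    have h2 : uniq [:: x; z; zx; xy].
      rewrite /= !inE !negb_or (ne _ _ exz) x_zx x_xy (ne _ _ ez1) z_xy /= andbT.
      by rewrite eq_sym; apply: cxz => //; rewrite eq_sym.
    case/orP: (sz1 [:: xy] h1 h2 isT); rewrite inE => /eqP h.
      by rewrite h eqxx in y_xy.
    by have := cxz xy zy ex1 ez2; rewrite h eqxx eq_sym y_xy => /(_ isT).
have := next_neq_prev up sp3 xyp.
rewrite (only (next p xy)) ?mem_next ?next_cycle // (only (prev p xy)) ?mem_prev ?eqxx //.
by rewrite se prev_cycle.
Qed.

End Lonely.

(** * The structure of a minimal counterexample *)

Section Maps.
Variables (T : finType) (e : rel T) (D : finType) (sg ep : {perm D}) (src : D -> T).
Hypotheses (pm : plane_map e sg ep src) (se : simple_graph e).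

Definition dg v := #|[set u | e v u]|.
Local Notation live d := (ep d != d).
Local Notation tgt d := (src (ep d)).
Local Notation ph := (ep * sg)%g.

Let rp : prerep e sg ep src := proj1 pm.
Let dead d : ep d = d -> sg d = d := proj2 pm d.

Lemma epK d : ep (ep d) = d. Proof. exact: (rep_inv rp). Qed.

Lemma live_sg d : live (sg d) = live d.
Proof.
apply/idP/idP; apply: contra => /eqP h; first by rewrite (dead h) h.
by have /perm_inj E := dead h; rewrite E in h; rewrite h.
Qed.

Lemma live_ph d : live (ph d) = live d.
Proof. by rewrite permM live_sg live_epE. Qed.

Lemma src_sg d : src (sg d) = src d. Proof. exact: (rep_src rp). Qed.

Lemma src_ph d : src (ph d) = tgt d. Proof. by rewrite permM src_sg. Qed.

Lemma dart_edge d : live d -> e (src d) (tgt d).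
Proof. by move=> ld; apply/(rep_edge rp); exists d. Qed.

Lemma edge_dart u v : e u v -> exists d, [/\ live d, src d = u & tgt d = v].
Proof. by move/(rep_edge rp). Qed.

Lemma dart_inj d d' : live d -> live d' -> src d = src d' -> tgt d = tgt d' -> d = d'.
Proof. exact: (rep_uniq rp). Qed.

Lemma mem_orbit d x : live d -> (x \in porbit sg d) = live x && (src x == src d).
Proof.
move=> ld; apply/idP/andP => [/porbitP[i ->]|[lx /eqP xd]].
  by rewrite permX; elim: i => //= i [h1 h2]; rewrite live_sg src_sg.
exact: (rep_orb rp).
Qed.

Lemma card_orbit d : live d -> #|porbit sg d| = dg (src d).
Proof.
move=> ld; rewrite /dg -(@card_in_imset _ _ (fun x => tgt x)); last first.
  move=> x y; rewrite !mem_orbit // => /andP[lx /eqP xd] /andP[ly /eqP yd].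
  by apply: dart_inj; rewrite // xd yd.
apply: eq_card => w; rewrite !inE; apply/imsetP/idP => [[x]|/edge_dart[x [lx xd xw]]].
  by rewrite mem_orbit // => /andP[lx /eqP <-] ->; apply: dart_edge.
by exists x; rewrite // mem_orbit // lx xd eqxx.
Qed.

(** Turns a degree bound into distinctness of the neighbours met by consecutive darts. *)
Lemma rot_uniq n d : live d -> n <= dg (src d) ->
  uniq [seq tgt x | x <- traject sg d n].
Proof.
move=> ld; rewrite -card_orbit // => ln.
have lt x : x \in traject sg d n -> live x /\ src x = src d.
  case/trajectP => i _ ->; elim: i => //= i [h1 h2].
  by rewrite live_sg src_sg.
rewrite map_inj_in_uniq; last first.
  move=> x y /lt[lx xd] /lt[ly yd]; by apply: dart_inj; rewrite // xd yd.
have := uniq_traject_porbit sg d; rewrite -(subnKC ln) trajectD cat_uniq.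
by case/andP.
Qed.

Lemma nbr4 d w : live d -> dg (src d) = 4 -> e (src d) w =
  (w \in [:: tgt d; tgt (sg d); tgt (sg (sg d)); tgt (sg (sg (sg d)))]).
Proof.
move=> ld d4; set l := [:: _; _; _; _].
have ul : uniq l by have := rot_uniq ld (_ : 4 <= dg (src d)); rewrite d4; apply.
suff -> : l =i [set u | e (src d) u] by rewrite inE.
have [||_ //] := uniq_min_size ul (s2 := enum [set u | e (src d) u]).
- move=> u ul'; rewrite mem_enum inE; move: u ul'; apply/allP.
  have E x : live x -> src x = src d -> e (src d) (tgt x).
    by move=> lx <-; apply: dart_edge.
  by rewrite /= !E ?live_sg ?src_sg.
- by rewrite -cardE -/(dg _) d4.
by move=> E u; rewrite E mem_enum.
Qed.

End Maps.

Section MinimalMap.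
Variables (T : finType) (e : rel T).
Variables (M : T -> T -> 'I_4 -> 'I_4 -> bool) (S : {set T}) (phi : T -> 'I_4).
Hypothesis inst : instance e M S phi.
Hypothesis IH : below T #|active e S|.
Hypothesis nex : ~ extends e M S phi.
Variables (D : finType) (sg ep : {perm D}) (src : D -> T).
Hypothesis pm : plane_map e sg ep src.
Local Notation live d := (ep d != d).
Local Notation tgt d := (src (ep d)).
Local Notation ph := (ep * sg)%g.
Let rp : prerep e sg ep src := proj1 pm.
Let se : symmetric e := proj1 (inst_simple inst).
Let ie : irreflexive e := proj2 (inst_simple inst).
Let live_epE := @live_epE D ep.
Let epK := epK pm.
Let src_sg := src_sg pm.
Let live_sg := live_sg pm.

Lemma degree4 v w : v \notin S -> e v w -> 4 <= dg e v.
Proof.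
move=> vS vw; rewrite leqNgt; apply/negP => dv; apply: nex.
by apply: (min_degree inst IH (v := v)) => //; rewrite inE vS; apply/isolatedPn; exists w.
Qed.

(** The side changes only across edges of [q], and none of these ends at a vertex off [q]. *)
Lemma side_vertex (q : seq T) X d d' : (forall d, X (ep d) = X d (+) on_cycle ep src q d) ->
  (forall d, X (ph d) = X d) -> live d -> live d' -> src d = src d' ->
  src d \notin q -> X d = X d' :> bool.
Proof.
move=> X1 X2 ld ld' dd' dq.
have /porbitP[i ->] : d' \in porbit sg d by rewrite (mem_orbit pm) // ld' dd' eqxx.
have Xs x : src x \notin q -> X (sg x) = X x.
  move=> xq; rewrite -{1}[x]epK -permM X2 X1 /on_cycle (negPf xq) andbF addbF //.
rewrite permX; elim: i => //= i ->.
suff : src (iter i sg d) = src d by move=> E; rewrite Xs ?E.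
by elim: i => //= i; rewrite src_sg.
Qed.

(* [p] bounds a face. *)
Definition outer (p : seq T) := forall d, live d -> src d \in p ->
  tgt d = next p (src d) -> tgt (ph d) = next p (tgt d).

(** [no_inside] for the set [B] of vertices on the side where [X] is false: [src z] belongs to it,
    and [v] is an active vertex outside it, possibly on [q] itself. *)
Lemma two_sided (q : seq T) X v z : uniq q -> 3 <= size q <= 6 -> path.cycle e q ->
  (forall d, X (ep d) = X d (+) on_cycle ep src q d) -> (forall d, X (ph d) = X d) ->
  (forall d, live d -> src d \in S -> src d \notin q -> X d) ->
  live z -> src z \notin q -> X z = false -> 
  v \in active e S -> (forall d, live d -> src d = v -> src d \notin q -> X d) -> False.
Proof.
move=> uq sq cq X1 X2 XS lz zq Xz va Xv; apply: nex.
pose B := [set u | (u \notin q) && [exists d, [&& live d, src d == u & ~~ X d]]].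
have BP u d : u \in B -> live d -> src d = u -> ~~ X d.
  rewrite inE => /andP[uq' /existsP[d' /and3P[ld' /eqP d'u Xd']]] ld du.
  by rewrite (side_vertex X1 X2 (d' := d')) // du // d'u.
apply: (no_inside inst IH (q := q) (B := B) (z := src z) (v := v)) => //.
- move=> u uB; have := uB; rewrite inE => /andP[uq' /existsP[d' /and3P[ld' /eqP d'u Xd']]].
  by split=> //; apply: contra Xd' => uS; apply: XS; rewrite ?d'u.
- move=> u w uB /(edge_dart pm)[d [ld du dw]]; rewrite inE orbC.
  case: (boolP (w \in q)) => //= wq; apply/existsP; exists (ep d).
  rewrite live_epE ld dw eqxx /= X1.
  have -> : on_cycle ep src q d = false.
    apply/negP => /and3P[_ dq]; rewrite dw => /orP[] /eqP wE; move: wq;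
    by rewrite wE ?mem_next ?mem_prev dq.
  by rewrite addbF (BP u).
- by rewrite inE zq; apply/existsP; exists z; rewrite lz eqxx Xz.
- by apply/isolatedPn; exists (tgt z); apply: (dart_edge pm).
- apply/negP; rewrite inE => /andP[vq /existsP[d /and3P[ld /eqP dv]]].
  by rewrite Xv // dv.
Qed.

Variable p : seq T.
Hypotheses (up : uniq p) (sp : 3 <= size p <= 6) (cp : path.cycle e p)
  (Sp : forall u, (u \in S) = (u \in p)).
Hypothesis chordless : forall u v, u \in p -> v \in p -> e u v ->
  (v == next p u) || (v == prev p u).

(** [two_sided] for [p] itself shows that all vertices off [p] lie on one side, called [b]. A face
    walk on the other side cannot leave [p], cannot use a chord and does not turn back, so it
    follows [p] in one of the two directions. *)
Lemma outer_or : outer p \/ outer (rev p).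
Proof.
have sp3 : 2 < size p by case/andP: sp.
have [X X1 X2] := jordan rp up sp3 cp.
have [b Xb] : exists b, forall d, live d -> src d \notin p -> X d = b.
  case: (pickP [pred d | live d && (src d \notin p)]) => [z /andP[lz zp]|no]; last first.
    by exists true => d ld dp; have := no d; rewrite /= ld dp.
  exists (X z) => d ld dp; apply/eqP; apply/negPn/negP => Xd.
  have za : src z \in active e S.
    by rewrite inE Sp zp; apply/isolatedPn; exists (tgt z); apply: (dart_edge pm).
  have YS Y d' : live d' -> src d' \in S -> src d' \notin p -> Y by rewrite Sp => _ ->.
  pose Y x := ~~ (X x (+) X z).
  apply: (@two_sided p Y (src z) d) => //.
  - by move=> x; rewrite /Y X1; case: (X x) (on_cycle _ _ _ _) (X z) => [] [] [].
  - by move=> x; rewrite /Y X2.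
  - by move=> x lx; rewrite Sp => ->.
  - by rewrite /Y; move: Xd; case: (X d) (X z) => [] [].
  - move=> x lx xz xp; rewrite /Y (side_vertex X1 X2 (d' := z)) // ?addbb //.
pose o v d := [/\ live d, src d = v & tgt d = next p v].
have oE v : v \in p -> exists d, o v d.
  by move=> vp; apply: (edge_dart pm); apply: next_cycle.
(* Darts on the side without vertices follow the cycle. *)
have follow d : live d -> src d \in p -> X d = ~~ b ->
    tgt d \in p /\ ~~ on_cycle ep src p (ph d) = false.
  move=> ld dp Xd.
  have in_p x : live x -> src x \in p -> X x = ~~ b -> tgt x \in p.
    move=> lx xp Xx; apply/negPn/negP => xq; have := Xb (ep x); rewrite live_epE lx.
    move=> /(_ isT xq); rewrite X1 Xx.
    have -> : on_cycle ep src p x = false; last by rewrite addbF; case: (b).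
    apply/negP => /and3P[_ _ /orP[] /eqP E]; move: xq;
    by rewrite E ?mem_next ?mem_prev xp.
  have tp := in_p d ld dp Xd; split=> //.
  apply/negPn; rewrite /on_cycle (live_ph pm) ld (src_ph pm) tp /=.
  have tp2 : tgt (ph d) \in p by apply: in_p; rewrite ?(live_ph pm) // ?(src_ph pm) // X2.
  by apply: chordless => //; rewrite -(src_ph pm) (dart_edge pm) // (live_ph pm).
have noback d : live d -> src d \in p -> X d = ~~ b -> tgt (ph d) != src d.
  move=> ld dp Xd; apply/eqP => E.
  have phE : ph d = ep d.
    by apply: (dart_inj pm); rewrite ?(live_ph pm) ?live_epE ?(src_ph pm) // epK.
  have := X1 d; rewrite -phE X2.
  suff -> : on_cycle ep src p d by case: (X d).
  have [tp _] := follow d ld dp Xd; rewrite /on_cycle ld dp /=.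
  by apply: chordless => //; apply: (dart_edge pm).
have step d : live d -> src d \in p -> X d = ~~ b ->
    (tgt d = next p (src d) -> tgt (ph d) = next p (tgt d)) /\
    (tgt d = prev p (src d) -> tgt (ph d) = prev p (tgt d)).
  move=> ld dp Xd; have [tp] := follow d ld dp Xd; have nb := noback d ld dp Xd.
  move/negbFE/and3P => [_ _]; rewrite (src_ph pm) => /orP[]/eqP E; split=> // E'.
    by move: nb; rewrite E E' next_prev // eqxx.
  by move: nb; rewrite E E' prev_next // eqxx.
case: (pickP [pred d | [&& live d, src d \in p, tgt d == next p (src d) & X d == ~~ b]])
    => [d1 /and4P[l1 p1 /eqP t1 /eqP X1'] | no]; [left | right].
  have all v d : v \in p -> o v d -> X d = ~~ b.
    move=> vp; have : fconnect (next p) (src d1) v by rewrite (fconnect_cycle (cycle_next up)).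
    move/iter_findex => <-; move: (findex _ _ _) => n.
    elim: n d => [|n IHn] d [ld dn tn] /=.
      by rewrite (_ : d = d1) //; apply: (dart_inj pm); rewrite // tn.
    have wp : iter n (next p) (src d1) \in p by elim: (n) => //= k; rewrite mem_next.
    have [d' od'] := oE _ wp; have X' := IHn d' od'; have [ld' dn' tn'] := od'.
    rewrite (_ : d = ph d') ?X2 //.
    apply: (dart_inj pm); rewrite ?(live_ph pm) ?(src_ph pm) // ?dn ?tn' //.
    have [+ _] := step d' ld' (ltac:(by rewrite dn')) X'; rewrite tn' dn' => -> //.
  by move=> d ld dp dn; have [+ _] := step d ld dp (all _ d dp (And3 ld erefl dn)); apply.
move=> d ld; rewrite mem_rev !next_rev // => dp dn.
have Xd : X d = ~~ b.
  have := no (ep d); rewrite /= live_epE ld epK dn mem_prev dp next_prev // eqxx /= X1.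
  have -> : on_cycle ep src p d by rewrite /on_cycle ld dp dn eqxx orbT.
  by move: (b) (X d) => [] [].
by have [_ +] := step d ld dp Xd; apply.
Qed.

Hypothesis out : outer p.

(** The darts of [p] belong to one face, so all of [S] off [q] lies on one side of [q]. Vertices on
    the other side are excluded by [two_sided], with the vertex [v] of [q] as the active one; [b] is
    that empty side. *)
Lemma sides (q : seq T) v : uniq q -> 3 <= size q <= 6 -> path.cycle e q ->
  v \in q -> v \notin S ->
  exists X b, [/\ forall d, X (ep d) = X d (+) on_cycle ep src q d,
    forall d, X (ph d) = X d & forall d, live d -> X d = b -> src d \in q].
Proof.
move=> uq sq cq vq vS; have sq3 : 2 < size q by case/andP: sq.
have [X X1 X2] := jordan rp uq sq3 cq.
have [u0 u0p] : exists u, u \in p.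
  by case: (p) sp => // u l _; exists u; rewrite mem_head.
have [d0 [l0 s0 t0]] := edge_dart pm (next_cycle cp u0p).
have XC d : live d -> src d \in p -> tgt d = next p (src d) -> X d = X d0.
  move=> ld dp td.
  have : fconnect (next p) u0 (src d) by rewrite (fconnect_cycle (cycle_next up)).
  move/iter_findex; move: (findex _ _ _) => n; elim: n d ld dp td => [|n IHn] d ld dp td /= E.
    by rewrite (_ : d = d0) //; apply: (dart_inj pm); rewrite // -?E // td -E t0.
  have wp : iter n (next p) u0 \in p by elim: (n) => //= k; rewrite mem_next.
  have [d' [ld' dn' tn']] := edge_dart pm (next_cycle cp wp).
  rewrite -(IHn d') ?dn' // -(X2 d'); congr X.
  apply: (dart_inj pm); rewrite ?(live_ph pm) ?(src_ph pm) ?tn' ?E //.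
  by rewrite td out ?dn' // tn' E.
exists X, (~~ X d0); split=> // d ld Xd; apply/negPn/negP => dq.
pose Y x := ~~ (X x (+) X d0).
apply: (@two_sided q Y v d) => //.
- by move=> x; rewrite /Y X1; case: (X x) (on_cycle _ _ _ _) (X d0) => [] [] [].
- by move=> x; rewrite /Y X2.
- move=> x lx; rewrite Sp => xp xq.
  have [y [ly sy ty]] := edge_dart pm (next_cycle cp xp).
  rewrite /Y (side_vertex X1 X2 (d' := y)) // (XC y) ?sy ?addbb //.
- by rewrite /Y Xd; case: (X d0).
- rewrite inE vS; apply/isolatedPn; exists (next q v); exact: next_cycle.
- by move=> x _ -> ; rewrite vq.
Qed.

Lemma off_cycle (q : seq T) d : live d -> tgt d \notin q -> on_cycle ep src q d = false.
Proof.
move=> ld tq; apply/negP => /and3P[_ dq] /orP[] /eqP E; move: tq;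
by rewrite E ?mem_next ?mem_prev dq.
Qed.

(** The cycle uses [d] and the opposite dart, so the two remaining darts start on different sides.
    One of them starts on the side without vertices and must end on the cycle. *)
Lemma separated4 d : live d -> src d \notin S -> dg e (src d) = 4 ->
  separated e (src d) (tgt d) (tgt (sg (sg d))) (tgt (sg d)) (tgt (sg (sg (sg d)))).
Proof.
move=> ld dS d4 l cq uq sl; set q := [:: _, _, _ & l] in cq uq.
have := rot_uniq pm ld (_ : 4 <= dg e (src d)); rewrite d4 /= => /(_ isT).
rewrite !inE !negb_or => /and4P[/and3P[n01 n02 n03] /andP[n12 n13] n23 _].
have vq : src d \in q by rewrite !inE eqxx orbT.
have sq : 3 <= size q <= 6 by rewrite /= !ltnS.
have [X [b [X1 X2 Xb]]] := sides uq sq cq vq dS.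
have Xs x : X (sg x) = X x (+) on_cycle ep src q x by rewrite -X1 -(X2 (ep x)) permM epK.
have ntd : src d != tgt d.
  by apply: contraTneq (dart_edge pm ld) => <-; rewrite ie.
have nxt : next q (src d) = tgt (sg (sg d)).
  by rewrite /q /= (negPf ntd) eqxx.
have prv : prev q (src d) = tgt d by rewrite /q /= eqxx.
have onE x : live x -> src x = src d -> on_cycle ep src q x =
    (tgt x == tgt (sg (sg d))) || (tgt x == tgt d).
  by move=> lx xd; rewrite /on_cycle lx xd vq nxt prv.
have ls x : live (sg x) = live x by apply: live_sg.
have E0 : on_cycle ep src q d by rewrite onE // eqxx orbT.
have E1 : on_cycle ep src q (sg d) = false.
  by rewrite onE ?ls ?src_sg // (negPf n12) eq_sym (negPf n01).
have E2 : on_cycle ep src q (sg (sg d)) by rewrite onE ?ls ?src_sg // eqxx.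
have E3 : on_cycle ep src q (sg (sg (sg d))) = false.
  by rewrite onE ?ls ?src_sg // eq_sym (negPf n23) eq_sym (negPf n03).
have Xne : X (sg (sg (sg d))) = ~~ X (sg d) by rewrite Xs E2 Xs E1 addbF addbT.
have fin x : live x -> X x = b -> on_cycle ep src q x = false -> src x = src d ->
    tgt x != tgt d -> tgt x != tgt (sg (sg d)) -> tgt x \in l.
  move=> lx Xx Ex xd n1 n2.
  have : src (ep x) \in q by apply: Xb; rewrite ?live_epE // X1 Ex Xx addbF.
  rewrite !inE (negPf n1) (negPf n2) /= => /orP[/eqP E|//].
  by have := dart_edge pm lx; rewrite E xd ie.
case: (boolP (X (sg d) == b)) => [/eqP Eb|Eb]; apply/orP; [left|right].
  by apply: fin; rewrite ?ls ?src_sg // eq_sym.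
apply: fin; rewrite ?ls ?src_sg // 1?eq_sym // Xne; move: Eb; clear.
by case: (X _) b => [] [].
Qed.

Lemma cross4 d : live d -> src d \notin S -> dg e (src d) = 4 ->
  cross e (src d) (tgt d) (tgt (sg d)) (tgt (sg (sg d))) (tgt (sg (sg (sg d)))).
Proof.
move=> ld dS d4; split.
- by move=> w; apply: (nbr4 pm).
- by have := rot_uniq pm ld (_ : 4 <= dg e (src d)); rewrite d4; apply.
- exact: separated4.
have s4 : sg (sg (sg (sg d))) = d.
  by have := iter_porbit sg d; rewrite (card_orbit pm) // d4.
have := @separated4 (sg d); rewrite live_sg src_sg s4 => /(_ ld dS d4) sep l cq uq sl.
by rewrite orbC; apply: sep.
Qed.

Definition tri d := ph (ph (ph d)) == d.

(** One side of the 3-cycle has no vertices, so a face walk on that side stays on the three vertices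
    and closes after three steps. Either [g] or its reverse is on that side. *)
Lemma tri_face x y w : e x y -> e y w -> e x w -> x \notin S ->
  forall g, live g -> src g = x -> tgt g = y ->
  (tri g /\ tgt (ph g) = w) \/ (tri (ep g) /\ tgt (ph (ep g)) = w).
Proof.
move=> exy eyw exw xS g lg gx gy; pose q := [:: x; y; w].
have ne u v : e u v -> u != v by apply: contraTneq => ->; rewrite ie.
have uq : uniq q by rewrite /= !inE !negb_or !ne.
have cq : path.cycle e q by rewrite /= exy eyw se exw.
have xq : x \in q by rewrite mem_head.
have [X [b [X1 X2 Xb]]] := sides uq isT cq xq xS.
have nxy := ne _ _ exy; have nyw := ne _ _ eyw; have nxw := ne _ _ exw.
have onq h : live h -> src h \in q -> tgt h \in q -> on_cycle ep src q h.
  move=> lh hs ht; rewrite /on_cycle lh hs /=.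
  have nh := ne _ _ (dart_edge pm lh); move: hs ht nh.
  rewrite !inE => /or3P[]/eqP-> /or3P[]/eqP->; rewrite ?eqxx //= => _;
  by rewrite ?eqxx ?(negPf nxy) ?(negPf nyw) ?(negPf nxw) ?(eq_sym y x) ?(eq_sym w y)
    ?(eq_sym w x) ?(negPf nxy) ?(negPf nyw) ?(negPf nxw) ?eqxx ?orbT.
have step h : live h -> X h = b -> src h \in q -> tgt h \in q ->
    [/\ live (ph h), X (ph h) = b, src (ph h) = tgt h, tgt (ph h) \in q
      & (tgt (ph h) != tgt h) /\ (tgt (ph h) != src h)].
  move=> lh Xh hs ht; have lp : live (ph h) by rewrite (live_ph pm).
  have sh : src (ph h) = tgt h by rewrite (src_ph pm).
  have th : tgt (ph h) \in q.
    apply/negPn/negP => tq; have := Xb (ep (ph h)); rewrite live_epE lp X1 X2 Xh.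
    by rewrite off_cycle // addbF => /(_ isT erefl); rewrite (negPf tq).
  split=> //; first by rewrite X2.
  split; first by rewrite -sh eq_sym ne // (dart_edge pm).
  apply/eqP => E; have phE : ph h = ep h.
    by apply: (dart_inj pm); rewrite ?live_epE ?epK.
  by have := X1 h; rewrite -phE X2 onq //; case: (X h).
have main h : live h -> X h = b -> src h \in q -> tgt h \in q -> w != src h ->
    w != tgt h -> tri h /\ tgt (ph h) = w.
  move=> lh Xh hs ht ws wt.
  have [l1 X1' s1 t1 [n1 m1]] := step h lh Xh hs ht.
  have nh := ne _ _ (dart_edge pm lh).
  have w1 : tgt (ph h) = w.
    move: nh n1 m1 ws wt; move: hs ht t1; rewrite !inE.
    by do 3![case/or3P=> /eqP->]; rewrite ?eqxx.
  have s1q : src (ph h) \in q by rewrite s1.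
  have [l2 X2' s2 t2 [n2 m2]] := step _ l1 X1' s1q t1.
  have s2q : src (ph (ph h)) \in q by rewrite s2.
  have [l3 X3' s3 t3 [n3 m3]] := step _ l2 X2' s2q t2.
  rewrite s1 w1 in n2 m2; rewrite s2 w1 in m3.
  have h2 : tgt (ph (ph h)) = src h.
    move: nh n2 m2 ws wt; move: hs ht t2; rewrite !inE.
    by do 3![case/or3P=> /eqP->]; rewrite ?eqxx.
  have h3 : tgt (ph (ph (ph h))) = tgt h.
    rewrite h2 in n3; move: nh n3 m3 ws wt; move: hs ht t3; rewrite !inE.
    by do 3![case/or3P=> /eqP->]; rewrite ?eqxx.
  by split=> //; apply/eqP; apply: (dart_inj pm); rewrite // s3 h2.
have gq : src g \in q by rewrite gx.
have tq : tgt g \in q by rewrite gy !inE eqxx orbT.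
case: (eqVneq (X g) b) => [E|E]; [left|right].
  by apply: (main g lg E gq tq); rewrite ?gx ?gy eq_sym.
apply: (main (ep g)); rewrite ?live_epE ?epK //; last 2 first.
- by rewrite gy eq_sym.
- by rewrite gx eq_sym.
by rewrite X1 onq //; move: E; case: (X g) (b) => [] [].
Qed.

End MinimalMap.

(** * Faces next to triangles *)

Section Faces.
Variables (T : finType) (e : rel T) (D : finType) (sg ep : {perm D}) (src : D -> T).
Hypotheses (pm : plane_map e sg ep src) (simp : simple_graph e).
Hypotheses (nbow : ~ contains_bowtie e) (nb : ~ contains_graph_b e).
Local Notation live d := (ep d != d).
Local Notation tgt d := (src (ep d)).
Local Notation ph := (ep * sg)%g.
Local Notation tri := (tri sg ep).
Let se : symmetric e := proj1 simp.
Let ie : irreflexive e := proj2 simp.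
Let live_epE := @live_epE D ep.
Let epK := epK pm.
Let src_sg := src_sg pm.
Let live_sg := live_sg pm.
Let live_ph := live_ph pm.
Let src_ph := src_ph pm.
Let edge := dart_edge pm.

Lemma ph_ep d : ph (ep d) = sg d.
Proof. by rewrite permM epK. Qed.

Lemma bowtieF o a b c d : uniq [:: o; a; b; c; d] -> e o a -> e o b -> e a b ->
  e o c -> e o d -> e c d -> False.
Proof.
by move=> u h1 h2 h3 h4 h5 h6; apply: nbow; exists o, a, b, c, d; rewrite h1 h2 h3 h4 h5 h6.
Qed.

Lemma tgt_back d : live d -> 2 <= dg e (tgt d) -> tgt (ph d) != src d.
Proof.
move=> ld d2; have l' : live (ep d) by rewrite live_epE.
have := rot_uniq pm l' d2; rewrite /= !inE andbT epK -ph_ep epK.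
by rewrite eq_sym.
Qed.

Lemma tri_ph d : tri (ph d) = tri d.
Proof. by rewrite /tri (inj_eq perm_inj). Qed.

Lemma triP d : live d -> tri d ->
  [/\ src (ph (ph d)) = tgt (ph d), tgt (ph (ph d)) = src d,
      e (tgt d) (tgt (ph d)), e (tgt (ph d)) (src d) & e (src d) (tgt d)].
Proof.
move=> ld /eqP td; have l1 : live (ph d) by rewrite live_ph.
have l2 : live (ph (ph d)) by rewrite live_ph.
have E : tgt (ph (ph d)) = src d by rewrite -(src_ph (ph (ph d))) td.
split; [exact: src_ph | exact: E | | | exact: edge].
  by have := edge l1; rewrite src_ph.
by have := edge l2; rewrite src_ph E.
Qed.

(* The two triangles would share only the vertex [tgt d]. *)
Lemma corner_tri d : live d -> 4 <= dg e (tgt d) -> tri (ep d) -> tri (ep (ph d)) -> False.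
Proof.
move=> ld d4 t1 t2; set x := ep d; set y := ph d.
have lx : live x by rewrite live_epE.
have ly : live y by rewrite live_ph.
have ley : live (ep y) by rewrite live_epE.
have yE : y = sg x by rewrite /y -[in LHS](epK d) ph_ep.
pose w := ep (ph (ph x)).
have lw : live w by rewrite live_epE !live_ph.
have swx : sg w = x by rewrite -ph_ep epK; apply/eqP.
have sw : src w = tgt d by rewrite -src_sg swx.
have [_ _ b1 b2 b3] := triP lx t1; have [_ _ c1 c2 c3] := triP ley t2.
have sy : src y = tgt d by rewrite src_ph.
have tw : tgt w = tgt (ph x) by rewrite epK src_ph.
have := rot_uniq pm lw (_ : 4 <= dg e (src w)); rewrite sw => /(_ d4).
rewrite /= swx -yE -ph_ep => u.
have E1 : src x = tgt d by [].
rewrite -!/(tgt _) epK ?sy ?E1 in b1 b2 b3 c1 c2 c3.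
have neb a : e (tgt d) a -> tgt d != a by apply: contraTneq => <-; rewrite ie.
have h1 : e (tgt d) (tgt w) by rewrite tw se.
have h4 : e (tgt d) (tgt y) by rewrite se.
apply: (@bowtieF (tgt d) (tgt w) (tgt x) (tgt y) (tgt (ph (ep y)))) => //.
  by apply/andP; split; [rewrite !inE !negb_or !neb | exact: u].
  by rewrite tw se.
by rewrite se.
Qed.

Lemma face_ge3 d : live d -> (forall v w, e v w -> 2 <= dg e v) ->
  [/\ 3 <= #|porbit ph d|, tri d = (#|porbit ph d| == 3)
    & #|porbit ph d| = 4 -> ph (ph (ph (ph d))) = d].
Proof.
move=> ld d2; have it := iter_porbit ph d; have un := uniq_traject_porbit ph d.
have gt0 : 0 < #|porbit ph d| by rewrite lt0n card_porbit_neq0.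
have n1 : ph d != d.
  by apply: contraTneq (edge ld) => E; rewrite -src_ph E ie.
have n2 : ph (ph d) != d.
  apply/eqP => E; have := tgt_back ld (d2 _ (src d) _).
  rewrite se edge // => /(_ isT).
  by rewrite -src_ph E eqxx.
have ge3 : 3 <= #|porbit ph d|.
  move: it gt0; case: #|_| => [|[|[|//]]] //= E; first by rewrite E eqxx in n1.
  by rewrite E eqxx in n2.
split=> //; last by move=> E; rewrite E in it.
apply/idP/eqP => [/eqP t|E]; last by rewrite E in it; apply/eqP.
apply/eqP; rewrite eqn_leq ge3 andbT leqNgt; apply/negP => gt3.
by move: un; rewrite -(subnKC gt3) /= t !inE eqxx !orbT.
Qed.

Section Diamond.
Hypothesis d2 : forall v w, e v w -> 2 <= dg e v.

(** In its uses, [k] runs along the edge [o c] on the side away from [d], and [a] is the next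
    neighbour of [o] there. Length 3 gives the triangles [o c a] and [o d f], a bowtie. Length 4
    gives the cycle [o a b c]: with [b = f] the triangles [o c d] and [o f a] form a bowtie, and
    otherwise graph (b) appears. *)
Lemma big_face o a b c d f k : live k ->
  uniq [:: f; d; c; a] -> e o c -> e c d -> e d o -> e d f -> e f o -> e o a ->
  (tri k -> e a c) ->
  (#|porbit ph k| = 4 -> [/\ e a b, e b c, b != o & b != d]) ->
  5 <= #|porbit ph k|.
Proof.
move=> lk u oc cd d_o df fo oa t3 t4.
have neo v : e o v -> o != v by apply: contraTneq => <-; rewrite ie.
have [ge3 tE q4] := face_ge3 lk d2.
move: (u); rewrite /= !inE !negb_or andbT => /and3P[/and3P[fd fc fa] /andP[dc da] ca].
have od : e o d by rewrite se. have of_ : e o f by rewrite se.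
have bow1 : ~ e a c.
  move=> ac; apply: (@bowtieF o c a d f) => //; last by rewrite se.
  by rewrite /= !inE !negb_or !neo // ca (eq_sym c d) dc (eq_sym c f) fc !(eq_sym a) da fa
    (eq_sym d) fd.
case: (ltngtP #|porbit ph k| 4) => [lt4|//|/t4[ab bc bo bd]].
  by case: bow1; apply: t3; rewrite tE eqn_leq -ltnS lt4 ge3.
case: (eqVneq b f) => [bf|bf].
  exfalso; rewrite bf in ab bc.
  apply: (@bowtieF o c d f a) => //; last by rewrite se.
  by rewrite /= !inE !negb_or !neo // ca (eq_sym c d) dc (eq_sym c f) fc da (eq_sym d) fd fa.
exfalso; apply: nb; exists o, a, b, c, d, f; split; last by split; split; rewrite // se.
have ne v w : e v w -> v != w by apply: contraTneq => <-; rewrite ie.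
by rewrite /= !inE !negb_or (ne _ _ oa) (ne _ _ oc) (ne _ _ od) (ne _ _ of_)
  (eq_sym o) bo (ne _ _ ab) (ne _ _ bc) bd bf !(eq_sym a)
  ca da fa !(eq_sym c) dc fc (eq_sym d) fd.
Qed.

(** [g] is the side shared by two triangles. Degree 4 at [tgt g] makes the neighbours there
    distinct; degree 3 at the apex keeps a 4-face from running back over [src g]. *)
Lemma diamond_next g : live g -> tri g -> tri (ep g) ->
  4 <= dg e (tgt g) -> 3 <= dg e (tgt (ph g)) ->
  5 <= #|porbit ph (ep (ph g))|.
Proof.
move=> lg t1 t2 d4 d3.
have leg : live (ep g) by rewrite live_epE.
have [_ a0 a1 a2 a3] := triP lg t1; have [_ b0 b1 b2 b3] := triP leg t2.
rewrite epK in b1 b3.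
pose w := ep (ph (ph (ep g))).
have lw : live w by rewrite live_epE !live_ph.
have sw : sg w = ep g by rewrite -ph_ep epK; apply/eqP.
have srcw : src w = tgt g by rewrite -src_sg sw.
have tw : tgt w = tgt (ph (ep g)) by rewrite epK src_ph.
set k := ep (ph g); have lk : live k by rewrite live_epE live_ph.
have sE : sg (ep g) = ph g by rewrite -ph_ep epK.
have sE2 : sg (ph g) = ph k by rewrite -ph_ep.
have := rot_uniq pm lw (_ : 4 <= dg e (src w)); rewrite srcw => /(_ d4).
rewrite /= sw sE sE2 epK tw => u.
have sk : src k = tgt (ph g) by [].
have tk : tgt k = tgt g by rewrite epK src_ph.
have lpk : live (ph k) by rewrite live_ph.
have lppk : live (ph (ph k)) by rewrite live_ph.
have E1 : e (tgt g) (tgt (ph k)) by have := edge lpk; rewrite src_ph tk.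
apply: (@big_face (tgt g) (tgt (ph k)) (tgt (ph (ph k))) (tgt (ph g)) (src g)
  (tgt (ph (ep g)))) => //.
- by move=> tk3; have [_ _ _ h _] := triP lk tk3.
- case/face_ge3: (lk) => // _ _ q4 /q4 k4.
  have l3 : live (ph (ph (ph k))) by rewrite live_ph.
  have s4 : tgt (ph (ph (ph k))) = tgt (ph g) by rewrite -src_ph k4.
  split.
  + by have := edge lppk; rewrite src_ph.
  + by have := edge l3; rewrite src_ph s4.
  + have := tgt_back lpk (d2 (w := src (ph k)) _); rewrite src_ph tk; apply.
    by rewrite se -tk -src_ph edge.
  + apply/eqP => E.
    have kE : ph (ph (ph k)) = ep (ph (ph g)).
      by apply: (dart_inj pm); rewrite ?live_epE ?live_ph // ?epK src_ph ?a0 ?E ?s4.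
    have sk1 : sg (ph (ph g)) = k by rewrite -ph_ep -kE.
    have sk2 : sg k = ph (ph g) by rewrite -ph_ep epK.
    have := rot_uniq pm lk (_ : 3 <= dg e (src k)); rewrite sk => /(_ d3).
    by rewrite /= sk2 sk1 !inE eqxx !orbT.
Qed.

(** The mirror image of [diamond_next], at the other end of the shared side. *)
Lemma diamond_prev g : live g -> tri g -> tri (ep g) ->
  4 <= dg e (src g) -> 3 <= dg e (tgt (ph g)) ->
  5 <= #|porbit ph (ep (ph (ph g)))|.
Proof.
move=> lg t1 t2 d4 d3.
have leg : live (ep g) by rewrite live_epE.
have [_ a0 a1 a2 a3] := triP lg t1; have [_ b0 b1 b2 b3] := triP leg t2.
rewrite epK in b1 b3.
set k := ep (ph (ph g)); have lk : live k by rewrite live_epE !live_ph.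
have sk : src k = src g by rewrite a0.
have tk : tgt k = tgt (ph g) by rewrite epK src_ph.
have sE : sg k = g by rewrite -ph_ep epK; apply/eqP.
have sE2 : sg g = ph (ep g) by rewrite ph_ep.
pose m := (sg^-1)%g k; have sm : sg m = k by rewrite permKV.
have lm : live m by rewrite -live_sg sm.
have srcm : src m = src g by rewrite -src_sg sm.
have := rot_uniq pm lm (_ : 4 <= dg e (src m)); rewrite srcm => /(_ d4).
rewrite /= sm sE sE2 tk => u.
have phm : ph (ep m) = k by rewrite ph_ep.
have lpk : live (ph k) by rewrite live_ph.
have lppk : live (ph (ph k)) by rewrite live_ph.
have lem : live (ep m) by rewrite live_epE.
have E1 : e (src g) (tgt m) by rewrite -srcm edge.
have E2 : e (src g) (tgt (ph g)) by rewrite se.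
apply: (@big_face (src g) (tgt m) (src (ph (ph k))) (tgt (ph g)) (tgt g)
  (tgt (ph (ep g)))) => //; rewrite 1?(se _ (src g)) //.
- move: u; rewrite /= !inE !negb_or !andbT => /and3P[/and3P[h1 h2 h3] /andP[h4 h5] h6].
  by rewrite !(eq_sym (tgt (ph (ep g)))) h6 h5 h3 !(eq_sym (tgt g)) h4 h2 eq_sym h1.
- by rewrite se.
- by rewrite se.
- move=> /eqP tk3; have mE : ph (ph k) = ep m.
    by apply: (@perm_inj _ ph); rewrite tk3 phm.
  by have := edge lpk; rewrite src_ph tk -[tgt (ph k)]src_ph mE se.
- case/face_ge3: (lk) => // _ _ q4 /q4 k4.
  have mE : ph (ph (ph k)) = ep m by apply: (@perm_inj _ ph); rewrite k4 phm.
  split.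
  + by have := edge lppk; rewrite se -[tgt (ph (ph k))]src_ph mE.
  + by have := edge lpk; rewrite src_ph tk se -[tgt (ph k)]src_ph.
  + rewrite src_ph; have := tgt_back lk (d2 (w := src k) _); rewrite sk; apply.
    by rewrite se -sk edge.
  + apply/eqP => E; rewrite src_ph in E.
    have kE : ph k = ep (ph g).
      by apply: (dart_inj pm); rewrite ?live_epE ?live_ph // ?epK !src_ph ?tk.
    have s1 : sg (ep k) = ep (ph g) by rewrite -kE -ph_ep epK.
    have s2 : sg (ep (ph g)) = ep k by rewrite -ph_ep !epK.
    have lek : live (ep k) by rewrite live_epE.
    have := rot_uniq pm lek (_ : 3 <= dg e (tgt k)); rewrite tk => /(_ d3).
    by rewrite /= s1 s2 !inE eqxx !orbT.
Qed.

End Diamond.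
End Faces.

(** * Orbits of live darts *)

Section LiveOrbits.
Variables (D : finType) (A : {set D}).
Implicit Types s : {perm D}.

Definition orbits_in s := [set porbit s d | d in A].

Lemma porbit_fix s d : s d = d -> porbit s d = [set d].
Proof.
move=> sd; apply/setP=> x; rewrite inE; apply/idP/eqP => [/porbitP[i ->]|->].
  by rewrite permX; elim: i => //= i ->.
exact: porbit_id.
Qed.

Lemma porbit_sub s (B : {set D}) d x : (forall d, d \in B -> s d \in B) -> d \in B ->
  x \in porbit s d -> x \in B.
Proof.
by move=> sB dB /porbitP[i ->]; rewrite permX; elim: i => //= i; apply: sB.
Qed.

Lemma orbs_live s : (forall d, d \notin A -> s d = d) -> (forall d, d \in A -> s d \in A) ->
  orbs s = #|orbits_in s| + #|~: A|.
Proof.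
move=> fixs sA; have dead : [set porbit s d | d in ~: A] = [set [set d] | d in ~: A].
  by apply: eq_in_imset => d; rewrite inE => /fixs /porbit_fix.
rewrite -(card_imset (mem (~: A)) (@set1_inj D)) -[in RHS]dead /orbits_in -cardsUI.
rewrite -imsetU setUCr (_ : _ :&: _ = set0) ?cards0 ?addn0 //.
  by apply: eq_card => B; apply/imsetP/imsetP => -[x _ ->]; exists x.
apply/setP=> B; rewrite !inE; apply/negP => /andP[/imsetP[d dA ->] /imsetP[x]].
rewrite inE => /negP xA E; apply: xA; apply: (porbit_sub sA dA).
by rewrite E porbit_id.
Qed.

Lemma sum_orbits_in s (Z : {set D}) : Z \subset A ->
  \sum_(f in orbits_in s) #|f :&: Z| = #|Z|.
Proof.
move=> ZA; rewrite -[RHS]sum1_card (partition_big (porbit s) (mem (orbits_in s))) /=.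
  apply: eq_bigr => _ /imsetP[d _ ->]; rewrite -sum1_card; apply: eq_bigl => x.
  by rewrite !inE eq_porbit_mem andbC.
by move=> d dZ; apply: imset_f; apply: (subsetP ZA).
Qed.

(** [Y] and its image under [s] are disjoint parts of the orbit. *)
Lemma independent s (f Y : {set D}) : f \in orbits_in s -> Y \subset f ->
  (forall y, y \in Y -> s y \notin Y) -> 2 * #|Y| <= #|f|.
Proof.
case/imsetP => d _ -> Yf indep.
have dis : Y :&: s @: Y = set0.
  apply/setP=> x; rewrite !inE; apply/negP => /andP[xY /imsetP[y yY xE]].
  by have := indep y yY; rewrite -xE xY.
rewrite mul2n -addnn -[X in _ + X](card_imset _ (@perm_inj _ s)) -cardsUI dis cards0 addn0.
apply: subset_leq_card; rewrite subUset Yf; apply/subsetP=> _ /imsetP[y /(subsetP Yf) yd ->].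
move: yd; rewrite -!eq_porbit_mem => /eqP <-; rewrite eq_porbit_mem.
exact: (mem_porbit s 1).
Qed.

Lemma comps_live (sg ep : {perm D}) (B : {set D}) :
  (forall d, d \notin A -> sg d = d /\ ep d = d) ->
  (forall d, d \in B -> d \in A) ->
  (forall d d', d \in B -> d' \in B -> connect (link sg ep) d d' -> d = d') ->
  #|B| + #|~: A| <= comps sg ep.
Proof.
move=> dead BA Bsep; have sy := link_sym sg ep; set r := link sg ep in Bsep sy *.
have croot d x : d \notin A -> connect r d x -> x = d.
  move=> dA /connectP[q]; elim: q => [|y q IHq] //= /andP[dy pq] xE.
  have yd : y = d by case/orP: dy => /= /eqP<-; have [] := dead d dA.
  by move: pq xE; rewrite yd; apply: IHq.
have rd d : d \notin A -> root r d = d by move=> dA; apply: croot (connect_root r d).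
have disj : B :&: ~: A = set0.
  by apply/setP=> x; rewrite !inE; apply/negP => /andP[/BA ->].
rewrite -cardsUI disj cards0 addn0 /comps /n_comp_mem -/r.
rewrite -(@card_in_imset _ _ (root r)).
  apply: subset_leq_card; apply/subsetP=> _ /imsetP[d _ ->].
  by rewrite !inE roots_root.
move=> d d'; rewrite !inE => dB d'B /(rootP sy) c.
case/orP: dB => [dB|dA]; last by rewrite (croot d d').
case/orP: d'B => [d'B|d'A]; first exact: Bsep.
by rewrite sy in c; rewrite (croot d' d).
Qed.

End LiveOrbits.

(** * Discharging *)

Section Discharging.
Variables (T : finType) (e : rel T).
Variables (M : T -> T -> 'I_4 -> 'I_4 -> bool) (S : {set T}) (phi : T -> 'I_4).
Hypothesis inst : instance e M S phi.
Hypothesis IH : below T #|active e S|.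
Hypothesis nex : ~ extends e M S phi.
Variables (D : finType) (sg ep : {perm D}) (src : D -> T).
Hypothesis pm : plane_map e sg ep src.
Variable p : seq T.
Hypotheses (up : uniq p) (sp : 3 <= size p <= 6) (cp : path.cycle e p)
  (Sp : forall u, (u \in S) = (u \in p)).
Hypothesis chordless : forall u v, u \in p -> v \in p -> e u v ->
  (v == next p u) || (v == prev p u).
Hypothesis out : outer sg ep src p.
Local Notation live d := (ep d != d).
Local Notation tgt d := (src (ep d)).
Local Notation ph := (ep * sg)%g.
Local Notation tri := (tri sg ep).
Let simp := inst_simple inst.
Let nbow := inst_bowtie inst.
Let nb := inst_b inst.
Let se : symmetric e := proj1 simp.
Let ie : irreflexive e := proj2 simp.
Let live_epE := @live_epE D ep.
Let epK := epK pm.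
Let src_sg := src_sg pm.
Let live_sg := live_sg pm.
Let live_ph := live_ph pm.
Let src_ph := src_ph pm.
Let edge := dart_edge pm.
Let ph_ep := ph_ep pm.
Let sp3 : 2 < size p. Proof. by case/andP: sp. Qed.

Let d4 v w : v \notin p -> e v w -> 4 <= dg e v.
Proof. by rewrite -Sp; apply: (degree4 inst IH nex). Qed.

Lemma degree_ge2 v w : e v w -> 2 <= dg e v.
Proof.
case: (boolP (v \in p)) => [vp _|/d4 h /h/ltnW/ltnW //].
have : [set next p v; prev p v] \subset [set u | e v u].
  apply/subsetP=> u; rewrite !inE => /orP[]/eqP->; first exact: next_cycle.
  by rewrite se prev_cycle.
by move/subset_leq_card; rewrite cards2 (next_neq_prev up).
Qed.

Lemma degree_ge3 v w : v \in p -> e v w -> w \notin p -> 3 <= dg e v.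
Proof.
move=> vp vw wp.
have : [set w; next p v; prev p v] \subset [set u | e v u].
  apply/subsetP=> u; rewrite !inE => /orP[/orP[]|]/eqP-> //; first exact: next_cycle.
  by rewrite se prev_cycle.
move/subset_leq_card; rewrite -setUA cardsU1 !inE cards2 (next_neq_prev up) //.
have -> : (w == next p v) = false by apply: contraNF wp => /eqP->; rewrite mem_next.
by have -> : (w == prev p v) = false by apply: contraNF wp => /eqP->; rewrite mem_prev.
Qed.

Definition darts := [set d | live d].
Definition faces := orbits_in darts ph.
Definition outer_darts := [set d in darts | (src d \in p) && (tgt d == next p (src d))].
Definition inner_faces := faces :\ outer_darts.
(* R stands for the vertices off [p], S for those of [p]; SS only has the darts on the
   inner side of [p]. *)
Definition RR := [set d in darts | (src d \notin p) && (tgt d \notin p)].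
Definition SS := [set d in darts | (src d \in p) && (tgt d == prev p (src d))].
Definition SR := [set d in darts | (src d \in p) && (tgt d \notin p)].
Definition RS := [set d in darts | (src d \notin p) && (tgt d \in p)].

Lemma dart_cases d : live d -> [|| d \in outer_darts, d \in RR, d \in SS, d \in SR | d \in RS].
Proof.
move=> ld; rewrite !inE ld /=.
case: (boolP (src d \in p)) => sd; case: (boolP (tgt d \in p)) => td; rewrite ?orbT //=.
by case/orP: (chordless sd td (edge ld)) => ->; rewrite ?orbT.
Qed.

Lemma outer_face : outer_darts \in faces.
Proof.
have [u0 u0p] : exists u, u \in p.
  by case: (p) sp => // u l _; exists u; rewrite mem_head.
have [d0 [l0 s0 t0]] := edge_dart pm (next_cycle cp u0p).
apply/imsetP; exists d0; first by rewrite inE.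
apply/setP=> d; rewrite !inE; apply/idP/porbitP => [/and3P[ld dp /eqP td]|[i ->]].
  have : fconnect (next p) u0 (src d) by rewrite (fconnect_cycle (cycle_next up)).
  move/iter_findex; move: (findex _ _ _) => n E; exists n.
  have H : live (iter n ph d0) /\ src (iter n ph d0) = iter n (next p) u0 /\
      tgt (iter n ph d0) = next p (src (iter n ph d0)).
    elim: (n) => [|m [l1 [s1 t1]]]; first by rewrite /= s0 t0.
    rewrite !iterS live_ph src_ph t1 s1; split=> //; split=> //.
    rewrite out // ?s1 ?t1 ?s1 //.
    by elim: (m) => //= k; rewrite mem_next.
  rewrite permX; case: H => [l1 [s1 t1]]; apply: (dart_inj pm) => //.
    by rewrite s1 E.
  by rewrite td t1 s1 E.
rewrite permX; elim: i => [|i]; first by rewrite /= l0 s0 u0p t0 eqxx.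
rewrite iterS => /and3P[l1 p1 /eqP t1].
by rewrite live_ph l1 src_ph t1 mem_next p1 -t1 out // eqxx.
Qed.

Lemma card_outer : #|outer_darts| = size p.
Proof.
rewrite -(@card_in_imset _ _ src); last first.
  move=> x y; rewrite !inE => /and3P[lx xp /eqP tx] /and3P[ly yp /eqP ty] xy.
  by apply: (dart_inj pm); rewrite // tx ty xy.
rewrite -(card_uniqP up); apply: eq_card => v; apply/imsetP/idP => [[d]|vp].
  by rewrite !inE => /and3P[_ dp _] ->.
have [d [ld dv dt]] := edge_dart pm (next_cycle cp vp).
by exists d; rewrite // !inE ld dv vp dt eqxx.
Qed.

Lemma SS_ep : SS = ep @: outer_darts.
Proof.
apply/setP=> d; rewrite -[in RHS](epK d) (mem_imset _ _ (@perm_inj _ ep)) !inE live_epE epK.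
case: (boolP (live d)) => //= ld; apply/andP/andP => [[dp /eqP td]|[tp /eqP sd]].
  by rewrite td mem_prev dp next_prev.
by rewrite sd mem_next prev_next.
Qed.

Lemma card_SS : #|SS| = size p.
Proof. by rewrite SS_ep card_imset ?card_outer //; apply: perm_inj. Qed.

Lemma card_RS : #|RS| = #|SR|.
Proof.
rewrite -(card_imset _ (@perm_inj _ ep)); apply: eq_card => d.
rewrite -{1}(epK d) (mem_imset _ _ (@perm_inj _ ep)) !inE live_epE epK.
by rewrite andbCA andbA andbC andbA andbC.
Qed.

Lemma face_darts f : f \in faces -> f \subset darts.
Proof.
case/imsetP=> d; rewrite inE => ld ->; apply/subsetP=> x xf; rewrite inE.
have H y : y \in darts -> ph y \in darts by rewrite !inE live_ph.
by have := porbit_sub H (_ : d \in darts) xf; rewrite !inE; apply.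
Qed.

Lemma face_of f d : f \in faces -> d \in f -> f = porbit ph d.
Proof.
case/imsetP=> x _ -> dx; apply/eqP; by rewrite eq_porbit_mem porbit_sym.
Qed.

Lemma face_ph f d : f \in faces -> d \in f -> ph d \in f.
Proof. by move=> fF df; rewrite (face_of fF df) (mem_porbit _ 1). Qed.

Lemma in_face d : live d -> porbit ph d \in faces.
Proof. by move=> ld; apply: imset_f; rewrite inE. Qed.

Lemma inner_face d : live d -> d \notin outer_darts -> porbit ph d \in inner_faces.
Proof.
move=> ld nd; rewrite !inE in_face // andbT; apply: contraNneq nd => <-.
exact: porbit_id.
Qed.

Lemma inner_notin f d : f \in inner_faces -> d \in f -> d \notin outer_darts.
Proof.
case/setD1P => fo fF df; apply: contraNN fo => /(face_of outer_face) ->.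
by rewrite (face_of fF df).
Qed.

Lemma sum_inner (Z : {set D}) : Z \subset darts -> [disjoint Z & outer_darts] ->
  \sum_(f in inner_faces) #|f :&: Z| = #|Z|.
Proof.
move=> ZA dis; rewrite -(sum_orbits_in ph ZA) (big_setD1 _ outer_face) /=.
by rewrite setIC (disjoint_setI0 dis) cards0.
Qed.

Lemma sum_inner_size : \sum_(f in inner_faces) #|f| + size p = #|darts|.
Proof.
rewrite -(sum_orbits_in ph (subxx darts)) (big_setD1 _ outer_face) /= addnC.
congr (_ + _).
  by rewrite -card_outer; apply/esym/eq_card => x; rewrite !inE;
    case: (live x); rewrite ?andbT ?andbF.
apply: eq_bigr => f /setD1P[_ /face_darts]; by move/setIidPl->.
Qed.

Lemma tri_card d : live d -> tri d = (#|porbit ph d| == 3).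
Proof. by move=> ld; have [] := face_ge3 pm simp ld degree_ge2. Qed.

Lemma face_size f : f \in faces -> 3 <= #|f|.
Proof.
by case/imsetP=> d; rewrite inE => ld ->; have [] := face_ge3 pm simp ld degree_ge2.
Qed.

Definition triangles := [set f in inner_faces | #|f| == 3].
Definition inside (f : {set D}) := [forall d in f, src d \notin p].
Definition paired := [set f in triangles | inside f && [exists d in f, tri (ep d)]].
Definition lonely := [set f in triangles | inside f && [forall d in f, ~~ tri (ep d)]].

Lemma tri_in f d : f \in triangles -> d \in f -> tri d.
Proof.
rewrite inE => /andP[/setD1P[_ fF] /eqP f3] df.
have ld : live d by have := subsetP (face_darts fF) _ df; rewrite inE.
by rewrite tri_card // -(face_of fF df) f3.
Qed.

Lemma triangle_live f d : f \in triangles -> d \in f -> live d.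
Proof.
rewrite inE => /andP[/setD1P[_ fF] _] df.
by have := subsetP (face_darts fF) _ df; rewrite inE.
Qed.

(** Otherwise all corners have degree 4 and [lonely_triangle] applies. Its conditions on common
    neighbours hold by [tri_face]: a further common neighbour of two corners would make the face
    across their edge a triangle. *)
Lemma lonely_big f : f \in lonely -> exists2 d, d \in f & 5 <= dg e (src d).
Proof.
rewrite inE => /and3P[ft /forall_inP fin /forall_inP fl].
have [d df] : exists d, d \in f.
  move: ft; rewrite inE => /andP[_ /eqP f3].
  by apply/set0Pn; rewrite -card_gt0 f3.
have fF : f \in faces by move: ft; rewrite inE => /andP[/setD1P[]].
have df1 := face_ph fF df; have df2 := face_ph fF df1.
case: (leqP 5 (dg e (src d))) => [|x5]; first by exists d.
case: (leqP 5 (dg e (src (ph d)))) => [|y5]; first by exists (ph d).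
case: (leqP 5 (dg e (src (ph (ph d))))) => [|z5]; first by exists (ph (ph d)).
exfalso; apply: nex.
have ld := triangle_live ft df; have ld1 := triangle_live ft df1.
have ld2 := triangle_live ft df2.
have td := tri_in ft df; have td1 := tri_in ft df1; have td2 := tri_in ft df2.
have [a0 a1 a2 a3 a4] := triP pm ld td.
have x4 : dg e (src d) = 4 by apply/eqP; rewrite eqn_leq -ltnS x5 (d4 (fin d df) a4).
have y4 : dg e (src (ph d)) = 4.
  by apply/eqP; rewrite eqn_leq -ltnS y5 (d4 (fin _ df1) (edge ld1)).
have z4 : dg e (src (ph (ph d))) = 4.
  by apply/eqP; rewrite eqn_leq -ltnS z5 (d4 (fin _ df2) (edge ld2)).
have nS x : x \in f -> src x \notin S by move=> xf; rewrite Sp fin.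
have cr x : live x -> src x \notin S -> dg e (src x) = 4 -> cross e (src x) (tgt x)
    (tgt (sg x)) (tgt (sg (sg x))) (tgt (sg (sg (sg x)))).
  exact: (cross4 inst IH nex pm up sp cp Sp out).
have c1 := cr (ep (ph (ph d))).
rewrite live_epE ld2 a1 epK in c1.
have s1 : sg (ep (ph (ph d))) = d by rewrite -ph_ep epK; apply/eqP.
rewrite s1 a0 in c1; have {}c1 := cross_swap (c1 isT (nS _ df) x4).
have c2 := cr (ep d); rewrite live_epE ld epK -src_ph in c2.
have s2 : sg (ep d) = ph d by rewrite -ph_ep epK.
rewrite s2 -(src_ph (ph d)) in c2; have {}c2 := c2 isT (nS _ df1) y4.
have c3 := cr (ep (ph d)); rewrite live_epE ld1 epK -(src_ph (ph d)) in c3.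
have s3 : sg (ep (ph d)) = ph (ph d) by rewrite -ph_ep epK.
rewrite s3 a1 in c3; have {}c3 := cross_swap (c3 isT (nS _ df2) z4).
rewrite -(src_ph d) in c1; rewrite -(src_ph (ph d)) in c1.
have tf x y w g : e x y -> e y w -> e x w -> x \notin S -> live g -> src g = x ->
    tgt g = y -> g \in f -> tgt (ph g) = w.
  move=> xy yw xw xS lg gx gy gf.
  have [[]|[]] // := tri_face inst IH nex pm up sp cp Sp out xy yw xw xS lg gx gy.
  by move: (fl g gf) => /negPf->.
apply: (lonely_triangle inst IH c1 c2 c3); rewrite ?nS //.
- move=> w xw yw; rewrite src_ph; apply/esym.
  by apply: (tf _ _ _ d _ yw xw) => //; rewrite ?src_ph ?nS //.
- move=> w xw zw; apply/esym; rewrite src_ph.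
  have E : ph (ph (ph d)) = d by apply/eqP.
  rewrite -[in LHS]E; apply: (tf (src (ph (ph d))) (src d) w (ph (ph d))) => //.
    by rewrite -a1 edge.
  exact: nS.
- move=> w yw zw; apply/esym; rewrite -a1.
  apply: (tf (src (ph d)) (src (ph (ph d))) w (ph d)) => //.
    by rewrite (src_ph (ph d)) edge.
  exact: nS.
Qed.

(* The darts through which a large face gives charge to a paired triangle. *)
Definition givers :=
  [set d in darts | [&& 5 <= #|porbit ph d|, tri (ep d) & porbit ph (ep d) \in paired]].

Lemma paired_triangle f : f \in paired -> [/\ f \in triangles, f \in faces &
  forall d, d \in f -> [/\ live d, tri d & src d \notin p]].
Proof.
rewrite inE => /and3P[ft /forall_inP fin _]; split=> //.
  by move: ft; rewrite inE => /andP[/setD1P[]].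
by move=> d df; rewrite (triangle_live ft df) (tri_in ft df) fin.
Qed.

Lemma giver_RR d : d \in givers -> d \in RR.
Proof.
case/setIdP => ld /and3P[_ _ /paired_triangle[_ fF fP]].
move: ld; rewrite !inE => -> /=.
have ef := porbit_id ph (ep d); have [_ _ ->] := fP _ ef.
by have [_ _] := fP _ (face_ph fF ef); rewrite src_ph epK => ->.
Qed.

(** Two consecutive darts with triangles across them contradict [corner_tri] at a vertex off [p],
    where the degree is at least 4; at a vertex of [p] the last hypothesis takes over. So at most
    half of the sides are counted. [X] makes room for a side that is not a giver. *)
Lemma givers_free f (X : {set D}) : f \in faces -> X \subset f ->
  (forall x, x \in X -> tri (ep x)) ->
  (forall x, x \in X -> tgt x \in p -> ph x \notin X) ->
  2 * #|(f :&: givers) :|: X| <= #|f|.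
Proof.
move=> fF Xf Xt Xp; set Y := _ :|: X.
have Yf : Y \subset f by rewrite subUset Xf subsetIl.
have Yt y : y \in Y -> tri (ep y).
  rewrite inE => /orP[/setIP[_]|/Xt//].
  by case/setIdP => _ /and3P[].
apply: (independent fF Yf) => y yY; apply/negP => pyY.
have ly : live y.
  by have := subsetP (face_darts fF) _ (subsetP Yf _ yY); rewrite inE.
case: (boolP (tgt y \in p)) => yp; last first.
  apply: (corner_tri pm simp nbow ly _ (Yt _ yY) (Yt _ pyY)).
  by apply: (d4 yp (w := src y)); rewrite se edge.
have yX : y \in X.
  move: yY; rewrite inE => /orP[/setIP[_ /giver_RR]|//].
  by rewrite !inE yp !andbF.
have := Xp y yX yp; move: pyY; rewrite inE => /orP[/setIP[_ /giver_RR]|->//].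
by rewrite !inE src_ph yp andbF.
Qed.

Lemma card_givers f : f \in faces -> 2 * #|f :&: givers| <= #|f|.
Proof.
move=> fF; have := @givers_free f set0 fF (sub0set _).
by rewrite setU0; apply=> x; rewrite inE.
Qed.

(** If the triangle shares the side [g] with another one, its two other sides border faces of length
    at least 5 by the diamond lemmas. Each of them pays half of the missing unit. *)
Lemma paired_givers : 2 * #|paired| <= #|givers|.
Proof.
rewrite -(sum1_card (mem givers)) (partition_big (fun y => porbit ph (ep y)) (mem paired)) /=.
  rewrite mulnC -sum_nat_const; apply: leq_sum => f fp.
  have [ft fF fP] := paired_triangle fp.
  have [g gf tg] : exists2 g, g \in f & tri (ep g).
    by move: fp; rewrite inE => /and3P[_ _ /exists_inP].
  have g1 := face_ph fF gf; have g2 := face_ph fF g1.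
  have [lg t0 n0] := fP _ gf; have [l1 t1 n1] := fP _ g1; have [l2 t2 n2] := fP _ g2.
  have D0 : 4 <= dg e (src g) by apply: (d4 n0 (edge lg)).
  have D1 : 4 <= dg e (tgt g) by rewrite -src_ph; apply: (d4 n1 (edge l1)).
  have D2 : 3 <= dg e (tgt (ph g)) by rewrite -src_ph; apply/ltnW/(d4 n2 (edge l2)).
  rewrite sum1_card.
  have ne : ep (ph g) != ep (ph (ph g)).
    rewrite (inj_eq perm_inj); apply: contraTneq (edge l1) => E.
    by rewrite -src_ph -E ie.
  have <- : #|[set ep (ph g); ep (ph (ph g))]| = 2 by rewrite cards2 ne.
  apply: subset_leq_card; apply/subsetP=> y.
  have G h : h \in f -> live h -> tri h -> 5 <= #|porbit ph (ep h)| ->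
      (ep h \in givers) && (porbit ph (ep (ep h)) == f).
    move=> hf lh th h5; rewrite epK -(face_of fF hf) eqxx andbT.
    by apply/setIdP; rewrite inE live_epE lh epK h5 th -(face_of fF hf) fp.
  by case/set2P=> ->; apply: G => //; [exact: (diamond_next pm simp nbow nb degree_ge2)|
    exact: (diamond_prev pm simp nbow nb degree_ge2)].
by move=> y /setIdP[_ /and3P[]].
Qed.

Lemma face_balance f : f \in faces -> #|f :&: SR| = #|f :&: RS|.
Proof.
move=> fF; have fd := face_darts fF.
pose A := f :&: [set d | src d \in p]; pose B := f :&: [set d | tgt d \in p].
have AB : #|A| = #|B|.
  rewrite -(card_imset B (@perm_inj _ ph)); apply: eq_card => d.
  apply/idP/imsetP => [|[x]]; last first.
    by rewrite !inE => /andP[xf xp] ->; rewrite src_ph xp face_ph.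
  rewrite !inE => /andP[df dp]; exists (ph^-1 d)%g; last by rewrite permKV.
  rewrite !inE -src_ph permKV dp andbT.
  rewrite (face_of fF df) porbit_sym -{1}(permKV ph d); exact: (mem_porbit _ 1).
have E1 : A = (f :&: SR) :|: (A :&: B).
  apply/setP=> d; rewrite !inE; case: (boolP (d \in f)) => //= /(subsetP fd).
  by rewrite inE => ->; case: (_ \in p) => //=; case: (_ \in p).
have E2 : B = (f :&: RS) :|: (A :&: B).
  apply/setP=> d; rewrite !inE; case: (boolP (d \in f)) => //= /(subsetP fd).
  by rewrite inE => ->; case: (src d \in p) => //=; case: (_ \in p).
have D1 : (f :&: SR) :&: (A :&: B) = set0.
  by apply/setP=> d; rewrite !inE; case: (tgt d \in p); rewrite ?andbF.
have D2 : (f :&: RS) :&: (A :&: B) = set0.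
  by apply/setP=> d; rewrite !inE; case: (src d \in p); rewrite ?andbF.
have := cardsUI (f :&: SR) (A :&: B); have := cardsUI (f :&: RS) (A :&: B).
by rewrite -E1 -E2 D1 D2 cards0 AB => -> /addIn.
Qed.

Lemma face_sum f : f \in inner_faces ->
  #|f| = #|f :&: SS| + #|f :&: RR| + #|f :&: SR| + #|f :&: RS|.
Proof.
move=> fI; have /setD1P[_ fF] := fI.
have ns d : (tgt d == prev p (src d)) && (src d \in p) ==> (tgt d \in p).
  by apply/implyP=> /andP[/eqP->]; rewrite mem_prev.
have E : f = (f :&: SS) :|: (f :&: RR) :|: (f :&: SR) :|: (f :&: RS).
  apply/setP=> d; rewrite !in_setU !in_setI; case: (boolP (d \in f)) => //= df.
  have ld : live d by have := subsetP (face_darts fF) _ df; rewrite inE.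
  by have := dart_cases ld; rewrite (negPf (inner_notin fI df)) /= => /or4P[] ->; rewrite ?orbT.
have U (A B : {set D}) : A :&: B = set0 -> #|A :|: B| = #|A| + #|B|.
  by move=> AB; rewrite -cardsUI AB cards0 addn0.
rewrite {1}E !U //; apply/setP=> d; have := ns d; rewrite !inE;
by move: (_ == prev _ _) (src d \in p) (tgt d \in p) (d \in f) (live d) => [] [] [] [] [].
Qed.

(** A dead dart is an orbit of each of the three permutations and a component, so dead darts cancel
    in Euler's formula; [#|B|] bounds the number of live components from below. *)
Lemma euler_live (B : {set D}) : B \subset darts ->
  (forall d d', d \in B -> d' \in B -> connect (link sg ep) d d' -> d = d') ->
  #|darts| + 4 * #|B| <= 2 * #|orbits_in darts sg| + 2 * #|faces|.
Proof.
move=> BA sepB.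
have deadE d : d \notin darts -> sg d = d /\ ep d = d.
  rewrite inE negbK => /eqP h; split=> //; exact: (proj2 pm).
have fix_ s : s = sg \/ s = ep \/ s = ph -> forall d, d \notin darts -> s d = d.
  by move=> H d /deadE[h1 h2]; case: H => [->|[->|->]]; rewrite ?permM ?h2 ?h1.
have stab s : s = sg \/ s = ep \/ s = ph -> forall d, d \in darts -> s d \in darts.
  by move=> H d; rewrite !inE; case: H => [->|[->|->]]; rewrite ?live_sg ?live_epE ?live_ph.
have orE s : s = sg \/ s = ep \/ s = ph -> orbs s = #|orbits_in darts s| + #|~: darts|.
  by move=> H; apply: orbs_live; [exact: fix_ | exact: stab].
have := comps_live deadE (subsetP BA) sepB.
have := rep_euler (proj1 pm); rewrite /euler /orbs3 !orE; [|by auto..].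
have := cardsC darts; rewrite -/faces.
have : 2 * #|orbits_in darts ep| <= #|darts|.
  rewrite -(sum_orbits_in ep (subxx darts)) mulnC -sum_nat_const; apply: leq_sum => f.
  case/imsetP=> d ld ->; rewrite inE in ld.
  have <- : #|[set d; ep d]| = 2 by rewrite cards2 eq_sym ld.
  apply: subset_leq_card; apply/subsetP=> x; rewrite !inE => /orP[]/eqP->.
    by rewrite porbit_id.
  by rewrite live_epE ld (mem_porbit _ 1).
move: #|D| #|darts| #|~: darts| #|B| (comps _ _) #|orbits_in _ sg| #|orbits_in _ ep| #|faces|.
clear; lia.
Qed.

Definition rim := [set d in darts | src d \notin p].

Lemma sg_rim d : d \in rim -> sg d \in rim.
Proof. by rewrite !inE live_sg src_sg. Qed.

Lemma vertex_bound : #|orbits_in darts sg| <= size p + #|orbits_in rim sg|.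
Proof.
rewrite -card_outer; apply: leq_trans (leq_add (leq_imset_card (porbit sg) _) (leqnn _)).
rewrite -cardsUI; apply: leq_trans (leq_addr _ _).
apply: subset_leq_card; apply/subsetP=> _ /imsetP[d + ->]; rewrite inE => ld.
rewrite inE; case: (boolP (src d \in p)) => dp; last first.
  by apply/orP; right; apply: imset_f; rewrite !inE ld.
have [y [ly sy ty]] := edge_dart pm (next_cycle cp dp).
have -> : porbit sg d = porbit sg y.
  by apply/eqP; rewrite eq_porbit_mem (mem_orbit pm) // ld sy eqxx.
by apply/orP; left; apply: imset_f; rewrite !inE ly sy dp ty eqxx.
Qed.

(* Lonely triangles at a common vertex form a bowtie or share an edge. *)
Lemma lonely_inj f f' d d' : f \in lonely -> f' \in lonely -> d \in f -> d' \in f' ->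
  src d = src d' -> f = f'.
Proof.
move=> fl fl' df df' dd'.
have H g : g \in lonely -> [/\ g \in triangles, g \in faces & forall d, d \in g -> ~~ tri (ep d)].
  rewrite inE => /and3P[gt _ /forall_inP gl]; split=> //.
  by move: gt; rewrite inE => /andP[/setD1P[]].
have [ft fF nt] := H f fl; have [ft' fF' nt'] := H f' fl'.
have meet x : x \in f -> x \in f' -> f = f'.
  by move=> xf xf'; rewrite (face_of fF xf) -(face_of fF' xf').
have [ld td] := (triangle_live ft df, tri_in ft df).
have [ld' td'] := (triangle_live ft' df', tri_in ft' df').
have f1 := face_ph fF df; have f2 := face_ph fF f1.
have f1' := face_ph fF' df'; have f2' := face_ph fF' f1'.
have l2 := triangle_live ft f2; have l2' := triangle_live ft' f2'.
have [a0 a1 a2 a3 a4] := triP pm ld td; have [b0 b1 b2 b3 b4] := triP pm ld' td'.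
case: (eqVneq (tgt d) (tgt d')) => [E|n1].
  by apply: (meet d) => //; rewrite (dart_inj pm ld ld' dd' E).
case: (eqVneq (tgt (ph d)) (tgt (ph d'))) => [E|n2].
  apply: (meet (ph (ph d))) => //.
  by rewrite (dart_inj pm l2 l2') // ?a0 ?b0 ?a1 ?b1.
case: (eqVneq (tgt d) (tgt (ph d'))) => [E|n3].
  have E' : ep d = ph (ph d').
    by apply: (dart_inj pm); rewrite ?live_epE ?epK // ?b0 ?b1.
  by have := nt d df; rewrite E' (tri_in ft').
case: (eqVneq (tgt (ph d)) (tgt d')) => [E|n4].
  have E' : ep d' = ph (ph d).
    by apply: (dart_inj pm); rewrite ?live_epE ?epK // ?a0 ?a1.
  by have := nt' d' df'; rewrite E' (tri_in ft).
have ne u v : e u v -> u != v by apply: contraTneq => ->; rewrite ie.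
exfalso; rewrite -dd' in b3 b4.
apply: (@bowtieF _ e nbow (src d) (tgt d) (tgt (ph d)) (tgt d') (tgt (ph d'))) => //;
  rewrite 1?se //.
by rewrite /= !inE !negb_or !(ne (src d)) ?(se (src d)) // 1?se //
  (ne _ _ a2) (ne _ _ b2) n1 n2 n3 n4.
Qed.

(** Vertices off [p] have degree at least 4, and the large corner of a lonely triangle contributes
    one more. These corners are distinct by [lonely_inj]. *)
Lemma lonely_bound : 4 * #|orbits_in rim sg| + #|lonely| <= #|rim|.
Proof.
rewrite -(sum_orbits_in sg (subxx rim)).
pose w (f : {set D}) := odflt f (omap (porbit sg) [pick d in f | 5 <= dg e (src d)]).
have wP f : f \in lonely -> exists d, [/\ d \in f,
    d \in rim, 5 <= dg e (src d) & w f = porbit sg d].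
  move=> fl; have [d df d5] := lonely_big fl; rewrite /w; case: pickP; last first.
    by move/(_ d); rewrite df d5.
  move=> x /andP[xf x5] /=; exists x; split=> //.
  move: fl; rewrite inE => /and3P[ft /forall_inP fin _].
  by rewrite !inE (triangle_live ft xf) fin.
have le : #|lonely| <= #|[set o in orbits_in rim sg | 5 <= #|o| ]|.
  rewrite -(@card_in_imset _ _ w); last first.
    move=> f f' fl fl'; have [d [df dr _ ->]] := wP f fl; have [d' [df' dr' _ ->]] := wP f' fl'.
    move/eqP; rewrite eq_porbit_mem (mem_orbit pm) => [/andP[_ /eqP dd']|].
      exact: (lonely_inj fl fl' df df').
    by move: dr'; rewrite !inE => /andP[].
  apply: subset_leq_card; apply/subsetP=> _ /imsetP[f fl ->].
  have [d [df dr d5 ->]] := wP f fl; rewrite inE imset_f // (card_orbit pm) //.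
  by move: dr; rewrite !inE => /andP[].
have -> : 4 * #|orbits_in rim sg| = \sum_(o in orbits_in rim sg) 4.
  by rewrite sum_nat_const mulnC.
apply: leq_trans (leq_add (leqnn _) le) _.
rewrite -sum1dep_card big_mkcondr /=.
rewrite -big_split; apply: leq_sum => _ /imsetP[d dr ->] /=.
have /setIidPl-> : porbit sg d \subset rim.
  by apply/subsetP=> x; apply: porbit_sub dr; exact: sg_rim.
move: dr; rewrite !inE => /andP[ld dp]; rewrite (card_orbit pm) //.
by have := d4 dp (edge ld); rewrite leq_eqVlt; case: ltnP => //= _ /orP[/eqP <-|].
Qed.

Lemma dart_bound : 2 * size p + #|SR| + #|rim| <= #|darts|.
Proof.
rewrite mul2n -addnn -{1}card_outer -card_SS.
have U (A B : {set D}) : A :&: B = set0 -> #|A| + #|B| = #|A :|: B|.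
  by move=> AB; rewrite -cardsUI AB cards0 addn0.
have H1 d : [==> src d \in p, tgt d == next p (src d) => tgt d \in p].
  by apply/implyP=> dp; apply/implyP=> /eqP->; rewrite mem_next.
have H2 d : [==> src d \in p, tgt d == prev p (src d) => tgt d \in p].
  by apply/implyP=> dp; apply/implyP=> /eqP->; rewrite mem_prev.
have H3 d : [==> src d \in p, tgt d == next p (src d) => tgt d != prev p (src d)].
  by apply/implyP=> dp; apply/implyP=> /eqP->; apply: (next_neq_prev up sp3 dp).
rewrite !U; first by apply: subset_leq_card; apply/subsetP=> d; rewrite !inE;
  case: (live d); rewrite ?andbF.
all: apply/setP=> d; rewrite !inE; move: (H1 d) (H2 d) (H3 d).
all: by move: (_ == next _ _) (_ == prev _ _) (src d \in p) (tgt d \in p) (live d)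
  => [] [] [] [] [].
Qed.

Lemma tri_notriangle f d : f \in inner_faces -> d \in f -> tri d = (f \in triangles).
Proof.
move=> fI df; have /setD1P[_ fF] := fI.
have ld : live d by have := subsetP (face_darts fF) _ df; rewrite inE.
by rewrite inE fI tri_card // -(face_of fF df).
Qed.

(* Vertices have charge [degree - 4] and faces [length - 4], here doubled. [B] contains
   darts of different components. *)
Lemma discharge (B : {set D}) (w g : {set D} -> nat) : B \subset darts ->
  (forall d d', d \in B -> d' \in B -> connect (link sg ep) d d' -> d = d') ->
  (forall f, f \in inner_faces -> 8 + #|f :&: givers| + w f <=
     2 * #|f| + 2 * #|f :&: SR| + 2 * (f \in lonely) + 2 * (f \in paired) + g f) ->
  \sum_(f in inner_faces) w f + 16 * #|B| <=
    8 + 2 * size p + \sum_(f in inner_faces) g f.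
Proof.
move=> BA sepB H.
have := leq_sum (index_enum _) H; rewrite !big_split /= sum_nat_const.
have nout (Z : {set D}) : (forall d, d \in Z -> [|| d \in RR, d \in SS, d \in SR | d \in RS]) ->
    [disjoint Z & outer_darts].
  move=> ZP; rewrite disjoint_subset; apply/subsetP=> d /ZP; rewrite !inE.
  case: (boolP (live d)) => //= ld; case: (boolP (src d \in p)) => //= dp.
  case/orP=> [/eqP-> |]; first by rewrite eq_sym (next_neq_prev up sp3 dp).
  by rewrite orbF => tp; apply: contra tp => /eqP->; rewrite mem_next.
have sub (Z : {set D}) (P : pred D) : Z = [set d in darts | P d] -> Z \subset darts.
  by move=> ->; apply/subsetP=> d /setIdP[].
rewrite !big1_eq !addn0 (sum_inner (sub givers _ erefl)); last first.
  by apply: nout => d /giver_RR->.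
rewrite (sum_inner (sub SR _ erefl)); last by apply: nout => d ->; rewrite !orbT.
have cl (A : {set {set D}}) : A \subset inner_faces -> \sum_(f in inner_faces) (f \in A) = #|A|.
  move=> AI; transitivity (\sum_(f in inner_faces | f \in A) 1).
    by rewrite big_mkcondr; apply: eq_bigr => f _; case: (f \in A).
  by rewrite -sum1_card; apply: eq_bigl => f; apply/andb_idl/(subsetP AI).
have tI : triangles \subset inner_faces by apply/subsetP=> f /setIdP[].
rewrite !cl; try by apply: subset_trans tI; apply/subsetP=> f /setIdP[].
(* Euler's formula enters with factor 4, which gives [16 * #|B|], and the [8] stands for the outer
   face. The terms with [SR], [lonely] and [paired] cancel against [dart_bound], [lonely_bound] and
   [paired_givers]. *)
have := euler_live BA sepB; have := vertex_bound; have := lonely_bound; have := dart_bound.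
have := paired_givers; have := sum_inner_size.
have : #|faces| = #|inner_faces|.+1 by rewrite [in LHS](cardsD1 outer_darts) outer_face.
move: #|darts| #|B| #|faces| #|inner_faces| #|SR| #|rim| #|orbits_in darts sg| #|orbits_in rim sg|.
move: #|lonely| #|paired| #|givers|.
move: (\sum_(f in inner_faces) #|f|) (\sum_(f in _) w f) (\sum_(f in _) g f) (size p).
clear; lia.
Qed.

(** A face walk without darts from [p] to the rest has none back either, by [face_balance], so it
    stays off [p] or on [p]. *)
Lemma mixed_face f : f \in inner_faces -> [\/ inside f, f \subset SS | 0 < #|f :&: SR| ].
Proof.
move=> fI; have /setD1P[_ fF] := fI.
case: (posnP #|f :&: SR|) => [E|]; last by constructor 3.
have := face_balance fF; rewrite E => /esym E'.
have ld d : d \in f -> live d by move=> /(subsetP (face_darts fF)); rewrite inE.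
have eqp d : d \in f -> (src d \in p) = (tgt d \in p).
  move=> df; apply/idP/idP => h; apply/negPn/negP => h'.
    by move/eqP: E; rewrite cards_eq0 => /eqP/setP/(_ d); rewrite !inE df ld // h h'.
  by move/eqP: E'; rewrite cards_eq0 => /eqP/setP/(_ d); rewrite !inE df ld // h h'.
have const d x : d \in f -> x \in f -> (src x \in p) = (src d \in p).
  move=> df; rewrite (face_of fF df) => /porbitP[i ->].
  rewrite permX; elim: i => //= i <-; rewrite src_ph -eqp //.
  by elim: i => //= i; apply: face_ph.
case: (boolP (inside f)) => [|/forall_inPn[d df]]; first by constructor 1.
rewrite negbK => dp; constructor 2; apply/subsetP=> x xf.
have xp : src x \in p by rewrite (const d).
have := dart_cases (ld x xf); rewrite (negPf (inner_notin fI xf)) /=.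
by rewrite !inE -(eqp x xf) xp !andbF !orbF.
Qed.

(** Faces of length 3 and 4 give nothing. From length 5 on at most half of the sides give, and
    already [8 + 2 <= 2 * 5]. *)
Lemma face_givers f : f \in inner_faces ->
  if f \in triangles then #|f| = 3 /\ #|f :&: givers| = 0
  else 8 + #|f :&: givers| <= 2 * #|f|.
Proof.
move=> fI; have /setD1P[_ fF] := fI; have f3 := face_size fF.
have small : #|f| < 5 -> #|f :&: givers| = 0.
  move=> f5; apply/eqP; rewrite cards_eq0; apply/eqP/setP=> d; rewrite in_set0.
  apply/negP => /setIP[df /setIdP[_ /and3P[d5 _ _]]].
  by move: d5; rewrite -(face_of fF df) leqNgt f5.
rewrite inE fI /=; case: eqP => [E|ne]; first by rewrite small ?E.
have := card_givers fF; move: f3 ne; case: (ltnP #|f| 5) => [f5|]; last by clear; lia.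
by rewrite small //; move: f5; clear; lia.
Qed.

Lemma inside_triangle f : f \in triangles -> inside f -> (f \in lonely) + (f \in paired) = 1.
Proof.
move=> ft fin.
have -> : (f \in lonely) = [forall d in f, ~~ tri (ep d)] by rewrite inE ft fin.
have -> : (f \in paired) = [exists d in f, tri (ep d)] by rewrite inE ft fin.
by rewrite -negb_exists_in; case: [exists _ in _, _].
Qed.

Lemma rim_neq0 : exists d, d \in rim.
Proof.
case: (set_0Vmem rim) => [r0|[d dr]]; last by exists d.
exfalso; apply: nex; exists phi; split=> // u v _ _ uv.
have inS x y : e x y -> x \in S.
  move=> /(edge_dart pm)[d [ld <- _]]; rewrite Sp; apply/negPn/negP => dp.
  by move/setP/(_ d): r0; rewrite !inE ld dp.
by apply: (inst_phi inst) => //; apply: inS; [exact: uv | rewrite se; exact: uv].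
Qed.

Lemma outer_dart_exists : exists d, d \in outer_darts.
Proof.
have [u0 u0p] : exists u, u \in p.
  by case: (p) sp => // u l _; exists u; rewrite mem_head.
have [d0 [l0 s0 t0]] := edge_dart pm (next_cycle cp u0p).
by exists d0; rewrite !inE l0 s0 u0p t0 eqxx.
Qed.

(* Otherwise [p] is a component of its own, and Euler's formula improves. *)
Lemma SR_neq0 : 0 < #|SR|.
Proof.
rewrite lt0n; apply/negP => /eqP m0; have := card_RS; rewrite m0 => m0'.
have eqp d : live d -> (src d \in p) = (tgt d \in p).
  move=> ld; apply/idP/idP => h; apply/negPn/negP => h'.
    by move/eqP: m0; rewrite cards_eq0 => /eqP/setP/(_ d); rewrite !inE ld h h'.
  by move/eqP: m0'; rewrite cards_eq0 => /eqP/setP/(_ d); rewrite !inE ld h h'.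
have [d0 d0o] := outer_dart_exists; have [d1 d1r] := rim_neq0.
have [l0 s0] : live d0 /\ src d0 \in p by move: d0o; rewrite !inE => /and3P[].
have [l1 s1] : live d1 /\ src d1 \notin p by move: d1r; rewrite !inE => /andP[].
have clos : closed (link sg ep) [pred d | src d \in p].
  move=> x y; rewrite !inE => /orP[]/eqP<-; first by rewrite src_sg.
  by case: (eqVneq (ep x) x) => [->//|lx]; rewrite eqp.
have n01 : ~ connect (link sg ep) d0 d1.
  by move/(closed_connect clos); rewrite !inE s0 (negPf s1).
have /(@discharge [set d0; d1] (fun => 0) (fun f => #|f :&: SS|)) dis :
    [set d0; d1] \subset darts.
  by apply/subsetP=> d /set2P[]->; rewrite inE.
(* With two components the left side is 32, the right side at most 26. The darts of [SS] pay for a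
   triangle that runs along [p], which nothing else would cover. *)
have : 16 * #|[set d0; d1]| <= 8 + 2 * size p + size p.
  rewrite -{2}card_SS -(sum_inner (Z := SS)).
  - have := dis; rewrite big1 // add0n; apply.
    + move=> x y /set2P[]-> /set2P[]-> // c.
      by case: n01; rewrite link_sym.
    move=> f fI; have := face_givers fI; have := mixed_face fI.
    case: (boolP (f \in triangles)) => [ft mix [-> ->]|_ _]; last by clear; lia.
    case: mix => [fin|/setIidPl->|].
    + have := inside_triangle ft fin; clear; lia.
    + have -> : #|f| = 3 by move: ft; rewrite inE => /andP[_ /eqP].
      clear; lia.
    + suff -> : f :&: SR = set0 by rewrite cards0.
      by apply/eqP; rewrite -cards_eq0 -leqn0 -m0 subset_leq_card // subsetIr.
  - by apply/subsetP=> d; rewrite !inE => /andP[].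
  rewrite disjoint_subset; apply/subsetP=> d; rewrite !inE.
  case/and3P=> -> dp /eqP->; rewrite dp /= eq_sym; exact: (next_neq_prev up sp3 dp).
have -> : #|[set d0; d1]| = 2.
  by rewrite cards2 (_ : d0 != d1) //; apply: contraNneq s1 => <-.
by case/andP: sp; clear; lia.
Qed.

(** Such a face runs backwards through all of [p]. Together with the outer face it uses up both
    darts at each vertex of [p] and leaves no place for a dart of [SR]. *)
Lemma inner_SS f : f \in inner_faces -> ~ f \subset SS.
Proof.
move=> fI fSS; have /setD1P[_ fF] := fI.
have sS d : d \in f -> [/\ live d, src d \in p & tgt d = prev p (src d)].
  by move/(subsetP fSS); rewrite !inE => /and3P[? ? /eqP].
have [d0 d0f] : exists d, d \in f.
  by case/imsetP: fF => d _ ->; exists d; exact: porbit_id.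
have ur : uniq (rev p) by rewrite rev_uniq.
have all v : v \in p -> exists2 d, d \in f & src d = v.
  move=> vp; have [_ s0 _] := sS _ d0f.
  have : fconnect (next (rev p)) (src d0) v.
    by rewrite (fconnect_cycle (cycle_next ur)) mem_rev.
  move/iter_findex => <-; elim: (findex _ _ _) => [|n [d df dv]]; first by exists d0.
  have [ld dp dt] := sS _ df.
  by exists (ph d); rewrite ?face_ph // src_ph dt dv iterS next_rev.
have /card_gt0P[y] := SR_neq0; rewrite !inE => /and3P[ly yp tyn].
have [d df dv] := all _ (etrans (mem_next p (src y)) yp).
have [ld dp dt] := sS _ df; have := dt; rewrite dv prev_next // => dt'.
pose o := ep d; have lo : live o by rewrite live_epE.
have so : src o = src y by [].
have s1 : sg o = ph d by rewrite /o -ph_ep epK.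
have to : tgt o = next p (src o) by rewrite epK dv so.
have s2 : sg (ph d) = o.
  have [d' df' dv'] := all _ yp.
  have E : ph d = d'.
    have [l1 p1 t1] := sS _ (face_ph fF df); have [l2 p2 t2] := sS _ df'.
    by apply: (dart_inj pm) => //; rewrite ?t1 ?t2 src_ph dt' dv'.
  rewrite E; have [l2 p2 t2] := sS _ df'.
  rewrite -(epK d') -ph_ep epK; have lE : live (ep d') by rewrite live_epE.
  have tE : tgt (ep d') = next p (src (ep d')) by rewrite epK t2 next_prev.
  have pE : src (ep d') \in p by rewrite t2 mem_prev.
  apply: (dart_inj pm) => //; first by rewrite live_ph lE.
    by rewrite src_ph epK dv'.
  by rewrite (out lE pE tE) epK dv' to so.
have : y \in porbit sg o by rewrite (mem_orbit pm) // ly so eqxx.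
case/porbitP=> i; rewrite permX => yE.
have : y \in [set o; ph d].
  rewrite yE; elim: i {yE} => [|i] /=; first by rewrite !inE eqxx.
  by rewrite !inE => /orP[]/eqP->; rewrite ?s1 ?s2 eqxx ?orbT.
case/set2P=> E; move: tyn; rewrite E.
  by rewrite to mem_next so yp.
by have [_ p1 ->] := sS _ (face_ph fF df); rewrite mem_prev p1.
Qed.

Lemma SS_inner d : d \in SS -> porbit ph d \in inner_faces.
Proof.
rewrite inE => /and3P[]; rewrite inE => ld dp /eqP dt; apply: inner_face => //.
rewrite !inE ld dp dt /= eq_sym; exact: (next_neq_prev up sp3 dp).
Qed.

Lemma SS_triangle d : d \in SS -> tri d ->
  [/\ live d, src d \in p, tgt d = prev p (src d), ph d \in SR & ph (ph d) \in RS].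
Proof.
move=> dS td; have fI := SS_inner dS; have df := porbit_id ph d.
have [ld dp dt] : [/\ live d, src d \in p & tgt d = prev p (src d)].
  by move: dS; rewrite !inE => /and3P[? ? /eqP].
have [a0 a1 a2 a3 a4] := triP pm ld td.
have tp : tgt d \in p by rewrite dt mem_prev.
have pdSR : ph d \in SR.
  case: (mixed_face fI) => [/forall_inP/(_ d df)|/(inner_SS fI)//|].
    by rewrite dp.
  case/card_gt0P=> x /setIP[]; rewrite porbit_traject.
  have -> : #|porbit ph d| = 3 by apply/eqP; rewrite -tri_card.
  rewrite /= !in_cons orbF => /or3P[]/eqP-> //.
    by rewrite !inE tp !andbF.
  by rewrite !inE a1 dp !andbF.
split=> //; move: pdSR; rewrite !inE !live_ph ld src_ph tp a0 a1 dp andbT; exact: id.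
Qed.

Definition notri (Z : {set D}) := [set d in Z | ~~ tri d].

Lemma face_notri f Z : f \in inner_faces ->
  #|f :&: notri Z| = if f \in triangles then 0 else #|f :&: Z|.
Proof.
move=> fI; case: ifP => ft.
  apply/eqP; rewrite cards_eq0; apply/eqP/setP=> d; rewrite in_set0.
  apply/negP => /setIP[df /setIdP[_]]; by rewrite (tri_notriangle fI df) ft.
apply: eq_card => d; rewrite !inE; case: (boolP (d \in f)) => //= df.
by rewrite (tri_notriangle fI df) ft andbT.
Qed.

Lemma inner_sub Z : Z \in [:: RR; SS; SR; RS] -> Z \subset darts /\ [disjoint Z & outer_darts].
Proof.
rewrite !in_cons in_nil orbF => ZE; split.
  by case/or4P: ZE => /eqP->; apply/subsetP=> d /setIdP[].
rewrite disjoint_subset; apply/subsetP=> d; case/or4P: ZE => /eqP->; rewrite !inE.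
- by case/and3P=> -> /negPf->.
- by case/and3P=> -> dp /eqP->; rewrite dp /= eq_sym (next_neq_prev up sp3 dp).
- by case/and3P=> -> dp tp; rewrite dp /=; apply: contraNneq tp => ->; rewrite mem_next.
- by case/and3P=> -> /negPf->.
Qed.

Lemma sum_notri Z : Z \in [:: RR; SS; SR; RS] ->
  \sum_(f in inner_faces) #|f :&: notri Z| = #|notri Z|.
Proof.
case/inner_sub => Zd dis; have sub : notri Z \subset Z by apply/subsetP=> d /setIdP[].
by apply: sum_inner; [apply: subset_trans Zd | apply: disjointWl dis].
Qed.

Lemma card_notri : #|notri RS| = #|notri SR|.
Proof.
rewrite -!sum_notri ?in_cons ?eqxx ?orbT //; apply: eq_bigr => f fI.
by have /setD1P[_ fF] := fI; rewrite !face_notri // face_balance.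
Qed.

Lemma single_dart : exists d, [set d] \subset darts /\ (forall x y, x \in [set d] ->
  y \in [set d] -> connect (link sg ep) x y -> x = y).
Proof.
have [d] := outer_dart_exists; rewrite inE => /andP[dd _]; exists d; rewrite sub1set.
by split=> // x y /set1P-> /set1P->.
Qed.

Lemma triangle_weight f : f \in triangles ->
  2 <= 2 * #|f :&: SR| + 2 * (f \in lonely) + 2 * (f \in paired).
Proof.
move=> ft; have fI : f \in inner_faces by case/setIdP: ft.
case: (mixed_face fI) => [/(inside_triangle ft)|/(inner_SS fI)//|]; clear; lia.
Qed.

(** A face that is not a triangle keeps [2 * #|f :&: SR|], counted here once through [SR] and once
    through [RS]. The bit [b] is an extra unit from a face [f0] for which [face_givers] is not
    sharp. *)
Lemma mixed_count f0 (b : bool) : (b -> [/\ f0 \in inner_faces, f0 \notin triangles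
    & 9 + #|f0 :&: givers| <= 2 * #|f0| ]) -> 2 * #|notri SR| + 8 + b <= 2 * size p.
Proof.
move=> f0P; have [d [dd sepd]] := single_dart.
have := @discharge [set d] (fun f => #|f :&: notri SR| + #|f :&: notri RS| + (f == f0) * b)
  (fun => 0) dd sepd.
rewrite cards1 sum_nat_const muln0 !big_split /= !sum_notri ?in_cons ?eqxx ?orbT // card_notri.
have -> : \sum_(f in inner_faces) (f == f0) * b = b.
  case: b f0P => [/(_ isT)[f0I _ _]|_]; last by rewrite big1 // => f _; rewrite muln0.
  rewrite (bigD1 f0) //= eqxx big1 ?addn0 // => f /andP[_ /negPf->] //.
suff H f : f \in inner_faces -> 8 + #|f :&: givers| +
    (#|f :&: notri SR| + #|f :&: notri RS| + (f == f0) * b) <=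
    2 * #|f| + 2 * #|f :&: SR| + 2 * (f \in lonely) + 2 * (f \in paired) + 0.
  by move/(_ H); clear; lia.
move=> fI; have /setD1P[_ fF] := fI; rewrite !face_notri // -face_balance //.
have := face_givers fI; case: ifP => ft.
  case=> -> ->; have := triangle_weight ft.
  have -> : (f == f0) * b = 0.
    case: b f0P => [/(_ isT)[_ + _]|_]; last by rewrite muln0.
    by case: eqP => // <-; rewrite ft.
  clear; lia.
case: eqP f0P => [->|_] f0P; last by clear; lia.
by case: b f0P => [/(_ isT)[_ _]|_]; clear; lia.
Qed.

Definition mixed f := (f \notin triangles) && (0 < #|f :&: SR|).

(** By [face_sum] and [face_balance], a mixed face has [2 * #|f| + 2 * #|f :&: SR|] equal to twice
    its [SS] and [RR] darts plus six times its [SR] darts, and its givers are among its [RR] darts.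
    The weights are what remains when the [8] of each mixed face is granted on the right. *)
Lemma boundary_count :
  8 + 6 * #|notri SR| + \sum_(f in inner_faces) mixed f * #|f :&: RR| <=
  8 * (\sum_(f in inner_faces) mixed f) + 2 * #|[set d in SS | tri d]|.
Proof.
have [d [dd sepd]] := single_dart.
set L := \sum_(f in _) _ * _; set q := \sum_(f in _) _.
pose w f := 2 * #|f :&: notri SS| + 6 * #|f :&: notri SR| + mixed f * #|f :&: RR|.
have wE : \sum_(f in inner_faces) w f = 2 * #|notri SS| + 6 * #|notri SR| + L.
  by rewrite -!sum_notri ?in_cons ?eqxx ?orbT // !big_distrr -!big_split.
have : #|[set d in SS | tri d]| + #|notri SS| = size p.
  rewrite -card_SS -(cardsID [set d | tri d] SS); congr (_ + _); apply: eq_card => x;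
  by rewrite !inE // andbC.
have := @discharge [set d] w (fun f => 8 * mixed f) dd sepd.
rewrite cards1 wE -big_distrr /= -/q => H kE; suff /H : forall f, f \in inner_faces ->
   8 + #|f :&: givers| + w f <=
   2 * #|f| + 2 * #|f :&: SR| + 2 * (f \in lonely) + 2 * (f \in paired) + 8 * mixed f.
  by move: kE; clear; lia.
rewrite /w {L q w wE H kE}.
move=> f fI; have /setD1P[_ fF] := fI; rewrite !face_notri //.
have := face_givers fI; rewrite /mixed; case: ifP => ft /=.
  by case=> -> ->; have := triangle_weight ft; clear; lia.
have := face_sum fI; rewrite -face_balance //.
have : #|f :&: givers| <= #|f :&: RR|.
  by apply: subset_leq_card; apply: setIS; apply/subsetP=> x /giver_RR.
case: (mixed_face fI) => [fin|/(inner_SS fI)//|->]; last by clear; lia.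
have -> : #|f :&: SS| = 0.
  apply/eqP; rewrite cards_eq0; apply/eqP/setP=> x; rewrite in_set0.
  apply/negP => /setIP[xf /setIdP[_ /andP[xp _]]].
  by move/forall_inP/(_ x xf): fin; rewrite xp.
case: posnP => [->|_]; clear; lia.
Qed.

Lemma SS_apex d : d \in SS -> tri d -> 4 <= dg e (tgt (ph d)).
Proof.
move=> dS td; have [ld _ _ + _] := SS_triangle dS td; rewrite inE => /and3P[_ _ vp].
by apply: (d4 vp (w := src (ph d))); rewrite se edge // live_ph.
Qed.

(** [x] counts in [givers_free] but is no giver, as givers lie in [RR]. So the face of [x] has one
    giver less than half of its sides allows, which is the extra unit of [mixed_count]. *)
Lemma big_side x : x \in SR :|: RS -> tri (ep x) -> 5 <= #|porbit ph x| ->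
  2 * #|notri SR| + 9 <= 2 * size p.
Proof.
move=> xS tx x5; rewrite -[9]/(8 + 1) addnA; apply: (@mixed_count (porbit ph x) true) => _.
have lx : live x by move: xS; rewrite inE => /orP[] /setIdP[]; rewrite inE.
have nx : (src x \in p) != (tgt x \in p).
  by move: xS; rewrite !inE => /orP[] /and3P[_]; [move=> -> /negPf-> | move=> /negPf-> ->].
have fF := in_face lx.
have fI : porbit ph x \in inner_faces.
  apply: inner_face => //; apply: contraNN nx; rewrite !inE => /and3P[_ sp' /eqP->].
  by rewrite mem_next sp'.
have ft : porbit ph x \notin triangles.
  by rewrite inE fI /=; apply: contraTneq x5 => ->.
split=> //; have := @givers_free (porbit ph x) [set x] fF; rewrite sub1set porbit_id.
move=> /(_ isT) free; have {free} : 2 * #|(porbit ph x :&: givers) :|: [set x]| <= #|porbit ph x|.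
  apply: free => y /set1P->; rewrite // => xp; rewrite in_set1.
  by apply: contraNneq nx => E; rewrite -{1}E src_ph.
rewrite setUC cardsU1 (_ : x \in _ = false).
  by move: x5; clear; lia.
apply/negP => /setIP[_ /giver_RR]; rewrite !inE => /and3P[_ h1 h2].
by rewrite (negPf h1) (negPf h2) in nx.
Qed.

Lemma no_minimal : False.
Proof.
pose tS := [set d in SS | tri d]; pose n := #|notri SR|.
have tSP d : d \in tS -> [/\ d \in SS, tri d & [/\ live d, src d \in p, tgt d = prev p (src d),
    ph d \in SR & ph (ph d) \in RS]].
  by case/setIdP=> dS td; split=> //; apply: SS_triangle.
pose rr d := ep (ph d); pose rl d := ep (ph (ph d)).
have rrI : injective rr by apply: inj_comp; exact: perm_inj.
have rlI : injective rl.
  by apply: inj_comp; [exact: perm_inj | apply: inj_comp; exact: perm_inj].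
have rrS d : d \in tS -> rr d \in RS.
  by case/tSP=> _ _ [_ _ _ + _]; rewrite !inE live_epE epK => /and3P[-> -> ->].
have rlS d : d \in tS -> rl d \in SR.
  by case/tSP=> _ _ [_ _ _ _]; rewrite !inE live_epE epK => /and3P[-> -> ->].
have qn : \sum_(f in inner_faces) mixed f <= n.
  rewrite /n -sum_notri ?in_cons ?eqxx ?orbT //; apply: leq_sum => f fI.
  by rewrite face_notri // /mixed; case: (f \in triangles) => //=; case: #|_|.
have bc := boundary_count; rewrite -/n -/tS in bc.
(* Suppose that a triangle on an edge of [p] shares another side with a triangle. Its third side
   then borders a face of length at least 5, and [big_side] gives [n <= 1]. At each apex
   [corner_tri] leaves one of [rr], [rl] outside triangles, so [#|tS| <= 2 * n], and [bc] yields
   [8 <= 6 * n], a contradiction. *)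
case: (boolP [exists d in tS, tri (rr d) || tri (rl d)]) => [/exists_inP[d dt tt]|none].
  have [dS td [ld dp dt' pS ppS]] := tSP d dt.
  have l1 : live (ph d) by rewrite live_ph.
  have l2 : live (ph (ph d)) by rewrite live_ph.
  have td1 : tri (ph d) by rewrite tri_ph.
  have td2 : tri (ph (ph d)) by rewrite tri_ph.
  have [a0 a1 a2 a3 a4] := triP pm ld td; have v4 := SS_apex dS td.
  have vp : tgt (ph d) \notin p by move: pS; rewrite !inE => /and3P[].
  have n9 : 2 * n + 9 <= 2 * size p.
    case/orP: tt => tt.
      apply: (@big_side (rl d)); rewrite ?in_setU ?rlS // /rl ?epK //.
      apply: (diamond_next pm simp nbow nb degree_ge2 l1) => //.
      by rewrite a1; apply: (degree_ge3 dp (w := tgt (ph d))) => //; rewrite se.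
    apply: (@big_side (rr d)); rewrite ?in_setU ?rrS ?orbT // /rr ?epK //.
    have := diamond_prev pm simp nbow nb degree_ge2 l2 td2 tt.
    have E : ph (ph (ph d)) = d by apply/eqP.
    rewrite E a0 => /(_ v4); apply.
    by apply: (degree_ge3 (w := tgt (ph d))) => //; rewrite dt' mem_prev.
  have t2n : #|tS| <= 2 * n.
    pose h x := if tri (rr x) then rl x else rr x.
    have hP x : x \in tS -> h x \in notri SR :|: notri RS.
      move=> xt; have [xS tx [lx _ _ _ _]] := tSP x xt.
      have lpx : live (ph x) by rewrite live_ph.
      rewrite /h; case: (boolP (tri (rr x))) => tr; apply/setUP; [left | right].
        apply/setIdP; split; first exact: rlS.
        by apply/negP; apply: (corner_tri pm simp nbow lpx (SS_apex xS tx) tr).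
      by apply/setIdP; split; first exact: rrS.
    rewrite -(@card_in_imset _ _ h).
      apply: leq_trans (subset_leq_card _) _.
      - by apply/subsetP=> _ /imsetP[x xt ->]; exact: hP.
      - by rewrite cardsU card_notri; apply: leq_trans (leq_subr _ _) _; rewrite mul2n addnn.
    have dif x y : x \in tS -> y \in tS -> rl x <> rr y.
      by move=> /rlS + /rrS + E; rewrite -E !inE => /and3P[_ -> _] /and3P[_ /negP].
    move=> x y xt yt; rewrite /h; case: ifP; case: ifP => _ _.
    - exact: rlI.
    - by move/(dif _ _ xt yt).
    - by move/esym/(dif _ _ yt xt).
    exact: rrI.
  case/andP: sp => _; move: bc qn n9 t2n; clear.
  by move: (\sum_(f in inner_faces) mixed f * #|f :&: RR|)
    (\sum_(f in inner_faces) mixed f) n #|tS| (size p); lia.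
have {}none d : d \in tS -> ~~ tri (rr d) /\ ~~ tri (rl d).
  by move=> dt; move/exists_inPn/(_ d dt): none; rewrite negb_or => /andP.
have subL : rl @: tS \subset notri SR.
  by apply/subsetP=> _ /imsetP[d dt ->]; apply/setIdP; split; [exact: rlS | case: (none d)].
have subR : rr @: tS \subset notri RS.
  by apply/subsetP=> _ /imsetP[d dt ->]; apply/setIdP; split; [exact: rrS | case: (none d)].
have tn : #|tS| <= n by rewrite -(card_imset _ rlI) subset_leq_card.
have n8 : 2 * n + 8 <= 2 * size p.
  by have := @mixed_count set0 false; rewrite addn0; apply.
(* Now [bc] gives [8 <= 4 * n] and [n8] gives [n <= 2], so equality holds throughout. *)
have [n2 t2 L0] : [/\ n = 2, #|tS| = 2 & \sum_(f in inner_faces) mixed f * #|f :&: RR| = 0].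
  case/andP: sp => _; move: bc qn n8 tn; clear.
  move: (\sum_(f in inner_faces) mixed f * #|f :&: RR|)
    (\sum_(f in inner_faces) mixed f) n #|tS| (size p) => L q n t k *.
  by split; lia.
have eqL : rl @: tS = notri SR.
  by apply/eqP; rewrite eqEcard subL card_imset // t2 -/n n2.
have eqR : rr @: tS = notri RS.
  by apply/eqP; rewrite eqEcard subR card_imset // t2 card_notri -/n n2.
have /card_gt0P[d dt] : 0 < #|tS| by rewrite t2.
have [dS td [ld dp dt' pS ppS]] := tSP d dt.
have l1 : live (ph d) by rewrite live_ph.
have l2 : live (ph (ph d)) by rewrite live_ph.
have [a0 a1 a2 a3 a4] := triP pm ld td; have v4 := SS_apex dS td.
pose x := rl d; have xL : x \in notri SR by rewrite -eqL imset_f.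
have lx : live x by rewrite live_epE.
have xF := porbit_id ph x.
have [xSR ntx] : x \in SR /\ ~~ tri x by case/setIdP: xL.
have xo : x \notin outer_darts.
  move: xSR; rewrite !inE => /and3P[-> xp tp]; rewrite xp /=.
  by apply: contraNneq tp => ->; rewrite mem_next.
have fI := inner_face lx xo; have /setD1P[_ fF] := fI.
have fm : mixed (porbit ph x).
  rewrite /mixed -(tri_notriangle fI xF) ntx /=.
  by apply/card_gt0P; exists x; rewrite inE xF.
have tx : tgt x = tgt (ph d) by rewrite epK a0.
have sx : src x = src d by rewrite /x /rl a1.
(* By [L0] a face that leaves [p] along [x] returns with its next dart. By [eqR] that dart runs
   along a side of a second triangle on [p] with the same apex, and the two triangles form the
   bowtie. *)
have noRR : ph x \notin RR.
  apply/negP => pxRR; move: L0; rewrite (bigD1 (porbit ph x)) //= fm mul1n => /eqP.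
  rewrite addn_eq0 cards_eq0 => /andP[/eqP/setP/(_ (ph x))].
  by rewrite !inE face_ph //; move: pxRR; rewrite !inE => ->.
have pxR : ph x \in notri RS.
  apply/setIdP; rewrite tri_ph; split=> //; move: noRR xSR.
  by rewrite !inE live_ph lx src_ph => + /and3P[_ _ tp]; rewrite tp /= negbK.
move: pxR; rewrite -eqR => /imsetP[d' dt2 pxE].
have [dS' td' [ld' dp' dt2' pS' ppS']] := tSP d' dt2.
have [b0 b1 b2 b3 b4] := triP pm ld' td'.
have l1' : live (ph d') by rewrite live_ph.
have vE : tgt (ph d) = tgt (ph d') by rewrite -tx -src_ph pxE.
have nE : tgt (ph x) = tgt d' by rewrite pxE /rr epK src_ph.
have ne u w : e u w -> u != w by apply: contraTneq => ->; rewrite ie.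
have n1 : tgt d' != src d.
  rewrite -nE -sx; apply: (tgt_back pm lx); rewrite tx; exact: ltnW (ltnW v4).
have dd' : d' <> d.
  move=> E; rewrite E in pxE.
  have s1 : sg (ph (ph d)) = ep (ph d) by rewrite -ph_ep -/(rl d) -/x pxE.
  have s2 : sg (ep (ph d)) = ph (ph d) by rewrite -ph_ep epK.
  have := rot_uniq pm l2 (_ : 3 <= dg e (src (ph (ph d)))); rewrite a0 => /(_ (ltnW v4)).
  by rewrite /= s1 s2 !inE eqxx !orbT.
have n2' : tgt d' != tgt d.
  apply/eqP => E; apply: dd'; apply: (@perm_inj _ ph).
  by apply: (dart_inj pm); rewrite // ?src_ph.
have n3 : src d' != src d.
  apply/eqP => E; apply: dd'; apply: (dart_inj pm) => //.
  by rewrite dt' dt2' E.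
have n4 : src d' != tgt d.
  apply/eqP => E; have [+ _] := none d dt; rewrite /rr.
  have -> : ep (ph d) = ph (ph d').
    by apply: (dart_inj pm); rewrite ?live_epE ?live_ph // ?epK ?b0 ?b1 ?src_ph.
  by rewrite !tri_ph td'.
rewrite -vE in b2 b3.
apply: (@bowtieF _ e nbow (tgt (ph d)) (src d) (tgt d) (src d') (tgt d')) => //;
  rewrite 1?se //.
rewrite se in a2; rewrite se in b2.
by rewrite /= !inE !negb_or !(ne (tgt (ph d))) // (ne _ _ a4) (ne _ _ b4) !(eq_sym (src d))
  !(eq_sym (tgt d)) n1 n2' n3 n4.
Qed.

End Discharging.

(** * Deletion of chords and the induction *)

Section Main.
Variable T : finType.
Implicit Types (e : rel T) (M : T -> T -> 'I_4 -> 'I_4 -> bool) (S : {set T}).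

(** There are finitely many colourings, which makes the argument by contradiction constructive. *)
Lemma extends_dec e M S phi : extends e M S phi \/ ~ extends e M S phi.
Proof.
pose good (c : {ffun T -> 'I_4}) := [forall u, forall v, e u v ==> ~~ M u v (c u) (c v)] &&
  [forall v in S, c v == phi v].
case: (pickP good) => [c /andP[/forallP h1 /forall_inP h2]|no]; [left | right].
  exists c; split=> [u v _ _|v vS]; last exact/eqP/h2.
  by apply/implyP; move/forallP: (h1 u); apply.
case=> c [h1 h2]; have /andP[] := no (finfun c); split.
  by apply/forallP=> u; apply/forallP=> v; apply/implyP; rewrite !ffunE; apply: h1.
by apply/forall_inP=> v vS; rewrite ffunE h2.
Qed.

Lemma chordless_extends e M S phi p : instance e M S phi -> below T #|active e S| ->
  uniq p -> 3 <= size p <= 6 -> path.cycle e p -> (forall u, (u \in S) = (u \in p)) ->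
  (forall u v, u \in p -> v \in p -> e u v -> (v == next p u) || (v == prev p u)) ->
  extends e M S phi.
Proof.
move=> inst IH up sp cp Sp chord; case: (extends_dec e M S phi) => // nex.
have [D [sg [ep [src pm]]]] := plane_mapP (inst_plane inst).
case: (outer_or inst IH nex pm up sp cp Sp chord) => [out|out].
  by case: (no_minimal inst IH nex pm up sp cp Sp chord out).
case: (@no_minimal _ _ _ _ _ inst IH nex _ _ _ _ pm (rev p) _ _ _ _ _ out).
- by rewrite rev_uniq.
- by rewrite size_rev.
- rewrite rev_cycle (eq_cycle (e' := e)) // => u v; exact: (proj1 (inst_simple inst)).
- by move=> u; rewrite mem_rev.
by move=> u v; rewrite !mem_rev next_rev // prev_rev // orbC; apply: chord.
Qed.

(** Chords of the cycle join vertices of [S], where [phi] already respects their matchings. Deleting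
    them makes no vertex active, so the induction hypothesis still covers all instances below the
    new one. *)
Lemma instance_extends n e M S phi : instance e M S phi -> #|active e S| < n ->
  extends e M S phi.
Proof.
elim: n e M S phi => // n IHn e M S phi inst; rewrite ltnS => le.
have [p [up sp cp SE]] := inst_S inst.
have Sp u : (u \in S) = (u \in p) by rewrite SE inE.
have [se ie] := inst_simple inst.
pose chord u v := [&& u \in p, v \in p, v != next p u & v != prev p u].
pose e' u v := e u v && ~~ chord u v.
have np u v : u \in p -> v \in p -> (v == next p u) = (u == prev p v).
  by move=> uP vP; apply/eqP/eqP => ->; rewrite ?prev_next ?next_prev.
have sub : subrel e' e by move=> u v /andP[].
have se' : simple_graph e'.
  split=> [u v|u]; rewrite /e' ?ie // se; congr (_ && ~~ _); rewrite /chord.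
  case: (boolP (u \in p)) (boolP (v \in p)) => uP [] vP; rewrite ?andbF //=.
  by rewrite (np u v) // -(np v u) // andbC.
have cp' : path.cycle e' p.
  by apply: cycle_from_next => // u up'; rewrite /e' /chord next_cycle // eqxx !andbF.
have inst' : instance e' (restrict e' M) S phi.
  by apply: (instance_sub inst) => //; [exists p | exact: (inst_phi inst)].
have sub_active : {subset active e' S <= active e S}.
  move=> u; rewrite !inE => /andP[-> /isolatedPn[v uv]].
  by apply/isolatedPn; exists v; apply: sub.
have IH : below T #|active e' S|.
  move=> e1 M1 S1 phi1 inst1 lt1; apply: IHn inst1 (leq_trans lt1 _).
  by apply: leq_trans le; apply/subset_leq_card/subsetP.
have chordless u v : u \in p -> v \in p -> e' u v -> (v == next p u) || (v == prev p u).
  by rewrite /e' /chord => -> -> /andP[_]; rewrite /= -negb_or negbK.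
have [c [cP cS]] := chordless_extends inst' IH up sp cp' Sp chordless.
exists c; split=> // u v _ _ uv; case: (boolP (chord u v)) => [/and4P[uP vP _ _]|nc].
  by rewrite !cS ?Sp //; apply: (inst_phi inst); rewrite ?Sp.
have e'uv : e' u v by rewrite /e' uv nc.
by have := cP u v (in_setT u) (in_setT v) e'uv; rewrite /restrict e'uv.
Qed.

End Main.

Theorem theorem4 (T : finType) (e : rel T)
  (M : T -> T -> 'I_4 -> 'I_4 -> bool) (S : {set T}) (phi : T -> 'I_4) :
  simple_graph e -> planar e ->
  ~ contains_bowtie e -> ~ contains_graph_b e ->
  matching_assignment e M ->
  short_cycle_vertex_set e S ->
  M_coloring_on e M S phi ->
  exists varphi : T -> 'I_4,
    M_coloring_on e M setT varphi /\ (forall v, v \in S -> varphi v = phi v).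
Proof.
move=> se pe nbow nb mM cS cphi.
apply: (@instance_extends _ #|active e S|.+1) => //.
by split=> //; apply: planar_plane.
Qed.
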